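(* Let $n\ge 1$, $1\le r\le n$, and let $e$ be an integer with $0\le e\le n-1$ and $n-e\equiv 1\pmod 2$. Then there exist congruences $\Sigma\subset G(r,r+2)$ without fixed points, of order $1$ and class $n$, with reducible focal locus, and with invariant $e$.
   Context: Everything is over $\mathbb{C}$. $G(r,r+2)$ is the Grassmannian of $r$-dimensional linear subspaces of $\mathbb{P}^{r+2}$, in its Plücker embedding; $\mathbb{P}^r(\sigma)$ is the subspace corresponding to $\sigma$. A congruence is a $2$-dimensional reduced irreducible closed subvariety $\Sigma\subset G(r,r+2)$. Its order is the number of $\sigma\in\Sigma$ with $\mathbb{P}^r(\sigma)$ through a general point of $\mathbb{P}^{r+2}$; its class is the number of $\sigma\in\Sigma$ such that $\mathbb{P}^r(\sigma)$ meets a general plane in (at least) a line. A fixed point is a point lying on all $\mathbb{P}^r(\sigma)$. For order $1$ the focal locus is the set of points lying on infinitely many $\mathbb{P}^r(\sigma)$. A congruence of order $1$ with reducible focal locus is a rational ruled surface of degree $n+1$ ($n$ its class); it has invariant $e$ if its linearly normal model is the geometrically ruled rational surface $X_e$ of invariant $e$ (minimal directrix $C_0$ with $C_0^2=-e$, fibre $F$), i.e. $\Sigma$ is a birational projection (possibly an isomorphic one) of the rational normal ruled surface of degree $n+1$ which is the image of $X_e$ by the complete linear system $|C_0+\tfrac{n+e+1}{2}F|$, lines of the ruling going to lines of the ruling. *)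

(* Defs.v *)
From HB Require Import structures.
From mathcomp Require Import all_boot all_order all_algebra.
From mathcomp Require Import boolp classical_sets cardinality reals.
From mathcomp Require Import mpoly complex.

Set Implicit Arguments.
Unset Strict Implicit.
Unset Printing Implicit Defensive.

Import Order.TTheory GRing.Theory Num.Theory.

Local Open Scope classical_set_scope.
Local Open Scope card_scope.
Local Open Scope ring_scope.

(** * Topological notions, relative to a family [cl] of closed sets *)

Definition irreducible_set {T : Type} (cl : set (set T)) (Z : set T) : Prop :=
  Z !=set0 /\
  forall A B : set T, cl A -> cl B -> Z `<=` A `|` B -> Z `<=` A \/ Z `<=` B.

Definition reducible_set {T : Type} (cl : set (set T)) (Z : set T) : Prop :=
  Z !=set0 /\ ~ irreducible_set cl Z.

Definition irreducible_chain {T : Type} (cl : set (set T)) (Z : set T)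
    (d : nat) : Prop :=
  exists c : nat -> set T,
    (forall i, (i <= d)%N ->
       [/\ cl (c i), irreducible_set cl (c i) & c i `<=` Z]) /\
    (forall i, (i < d)%N -> c i `<` c i.+1).

(* Krull dimension of a closed set [Z]. *)
Definition has_dim {T : Type} (cl : set (set T)) (Z : set T) (d : nat) : Prop :=
  irreducible_chain cl Z d /\ ~ irreducible_chain cl Z d.+1.

(* [P] holds on a nonempty open subset of [X]; this is "for a general element
   of [X]" when [X] is irreducible, the only case in which it is used. *)
Definition generally {T : Type} (cl : set (set T)) (X : set T)
    (P : T -> Prop) : Prop :=
  exists C : set T, [/\ cl C, ~ (X `<=` C) & forall x, X x -> ~ C x -> P x].

(** * Projective spaces and Grassmannians *)

(* Dimensions are those of the linear subspaces of K^m: the space of r-planes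
   of P^s is [Gr K r.+1 s.+1], and P^s itself is [Gr K 1 s.+1]. *)
Definition Gr (K : fieldType) (k m : nat) : Type :=
  {U : {vspace 'rV[K]_m} | \dim U == k}.

(* Incidence of projective subspaces. *)
Definition incident {K : fieldType} {k l m : nat} (x : Gr K k m) (y : Gr K l m)
  : bool := (val x <= val y)%VS.

(* Forms vanish at all representatives of the point [x]. *)
Definition zariski_closed {K : fieldType} {m : nat} (A : set (Gr K 1 m))
  : Prop :=
  exists S : set {mpoly K[m]},
    (forall p, S p -> exists d, p \is d.-homog) /\
    (forall x, A x <->
       forall p, S p -> forall v : 'rV[K]_m, v \in val x -> p.@[v 0] = 0).

Definition ksub (k m : nat) : finType := {S : {set 'I_m} | #|S| == k}.

(* The increasing enumeration of a k-element subset of 'I_m. *)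
Definition ksub_nth {k m : nat} (S : ksub k m) (j : 'I_k) : 'I_m :=
  enum_val (cast_ord (esym (eqP (valP S))) j).

Definition basis_mx {K : fieldType} {k m : nat} (x : Gr K k m) : 'M[K]_(k, m) :=
  \matrix_(i < k) (vbasis (val x))`_i.

Definition plucker_row {K : fieldType} {k m : nat} (B : 'M[K]_(k, m))
  : 'rV[K]_#|ksub k m| :=
  \row_i \det (colsub (ksub_nth (enum_val i)) B).

Lemma plucker_row_neq0 (K : fieldType) (k m : nat) (B : 'M[K]_(k, m)) :
  row_free B -> plucker_row B != 0.
Proof.
move=> freeB.
have fullB : row_full B^T by rewrite /row_full mxrank_tr.
pose f := fullrankfun fullB.
have cS : #|[set f i | i : 'I_k]%SET| == k.
  by rewrite card_imset ?card_ord //; apply: fullrankfun_inj.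
pose S : ksub k m := exist _ [set f i | i : 'I_k]%SET cS.
apply/negP => /eqP/rowP/(_ (enum_rank S)); rewrite !mxE enum_rankK.
apply/eqP; rewrite -det_tr -unitfE -[_ \is a _]/(_ \in unitmx) -row_full_unit.
have fullf : row_full (rowsub f B^T) by apply: fullrowsub_full.
rewrite -sub1mx; apply: (@submx_trans _ _ _ _ _ _ (rowsub f B^T)).
  by rewrite sub1mx.
apply/row_subP => i.
have fiS : f i \in val S by apply: imset_f.
pose j : 'I_k := cast_ord (eqP (valP S)) (enum_rank_in fiS (f i)).
have fj : ksub_nth S j = f i.
  rewrite /ksub_nth /j (_ : cast_ord _ _ = enum_rank_in fiS (f i)).
    by rewrite enum_rankK_in.
  exact/val_inj.
apply: (submx_trans _ (row_sub j _)).
rewrite (_ : row i _ = row j (colsub (ksub_nth S) B)^T) //.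
by apply/rowP => l; rewrite !mxE fj.
Qed.

Lemma plucker_subproof (K : fieldType) (k m : nat) (x : Gr K k m) :
  \dim <[plucker_row (basis_mx x)]> == 1%N.
Proof.
rewrite dim_vline plucker_row_neq0 //.
apply/inj_row_free => u; rewrite mulmx_sum_row => u0.
apply/rowP => i; rewrite mxE.
have /freeP fr := basis_free (vbasisP (val x)).
pose w (l : 'I_(\dim (val x))) := u 0 (cast_ord (eqP (valP x)) l).
have /fr/(_ (cast_ord (esym (eqP (valP x))) i)) :
    \sum_(l < \dim (val x)) w l *: (vbasis (val x))`_l = 0.
  apply: etrans u0; rewrite [RHS](reindex (cast_ord (eqP (valP x)))) /=.
    by apply: eq_bigr => l _; rewrite rowK.
  by exists (cast_ord (esym (eqP (valP x)))) => l _; apply/val_inj.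
by rewrite /w cast_ordKV.
Qed.

Definition plucker {K : fieldType} {k m : nat} (x : Gr K k m)
  : Gr K 1 #|ksub k m| :=
  exist (fun U : {vspace 'rV[K]_#|ksub k m|} => \dim U == 1%N)
        <[plucker_row (basis_mx x)]>%VS (plucker_subproof x).

(* Zariski topology induced by the Plücker embedding. *)
Definition gr_closed {K : fieldType} {k m : nat} (Z : set (Gr K k m)) : Prop :=
  exists2 Y, zariski_closed Y & Z = plucker @^-1` Y.

(** * Congruences *)

Definition congruence {K : fieldType} {k m : nat} (Sigma : set (Gr K k m))
  : Prop :=
  [/\ gr_closed Sigma, irreducible_set gr_closed Sigma
    & has_dim gr_closed Sigma 2].

Definition members_through {K : fieldType} {k m : nat}
    (Sigma : set (Gr K k m)) (x : Gr K 1 m) : set (Gr K k m) :=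
  [set s | Sigma s /\ incident x s].

Definition has_order {K : fieldType} {k m : nat} (Sigma : set (Gr K k m))
    (a : nat) : Prop :=
  generally zariski_closed setT
    (fun x : Gr K 1 m => members_through Sigma x #= `I_a).

(* A plane and a member meet in (at least) a line: their linear spans share a
   2-dimensional subspace. *)
Definition has_class {K : fieldType} {k m : nat} (Sigma : set (Gr K k m))
    (a : nat) : Prop :=
  generally gr_closed setT
    (fun h : Gr K 3 m =>
       [set s | Sigma s /\ (2 <= \dim (val s :&: val h))%N] #= `I_a).

Definition fixed_point {K : fieldType} {k m : nat} (Sigma : set (Gr K k m))
    (x : Gr K 1 m) : Prop :=
  forall s, Sigma s -> incident x s.

Definition focal_locus {K : fieldType} {k m : nat} (Sigma : set (Gr K k m))
  : set (Gr K 1 m) :=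
  [set x | infinite_set (members_through Sigma x)].

(** * Rational maps between projective varieties *)

Definition eval_forms {K : fieldType} {m N : nat} (f : 'I_N -> {mpoly K[m]})
    (v : 'rV[K]_m) : 'rV[K]_N := \row_i (f i).@[v 0].

(* The tuple of forms [f] is defined at the point [x] (does not vanish
   identically there) and sends it to the point [y]. *)
Definition maps_to {K : fieldType} {m N : nat} (f : 'I_N -> {mpoly K[m]})
    (x : Gr K 1 m) (y : Gr K 1 N) : Prop :=
  exists2 v : 'rV[K]_m, val x = <[v]>%VS & val y = <[eval_forms f v]>%VS.

Definition rational_map {K : fieldType} {m N : nat} (X : set (Gr K 1 m))
    (Y : set (Gr K 1 N)) (f : 'I_N -> {mpoly K[m]}) : Prop :=
  [/\ exists d, forall i, f i \is d.-homog,
      exists2 x, X x & exists y, maps_to f x y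
    & forall x y, X x -> maps_to f x y -> Y y].

Definition birational {K : fieldType} {m N : nat} (X : set (Gr K 1 m))
    (Y : set (Gr K 1 N)) (f : 'I_N -> {mpoly K[m]}) : Prop :=
  rational_map X Y f /\
  exists g : 'I_m -> {mpoly K[N]},
    [/\ rational_map Y X g,
        generally zariski_closed X
          (fun x => exists2 y, maps_to f x y & maps_to g y x)
      & generally zariski_closed Y
          (fun y => exists2 x, maps_to g y x & maps_to f x y)].

(* A family of lines contained in [Y] and covering it, exactly one of them
   passing through a general point of [Y]. *)
Definition ruling {K : fieldType} {m : nat} (Y : set (Gr K 1 m))
    (L : set (Gr K 2 m)) : Prop :=
  [/\ forall l, L l -> forall y, incident y l -> Y y,
      forall y, Y y -> exists2 l, L l & incident y l
    & generally zariski_closed Y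
        (fun y => exists! l, L l /\ incident y l)].

(** * The ruled surfaces X_e and their projective models *)

(* X_e is (K^2 \ 0) x (K^2 \ 0), with coordinates (s, t; u, v), modulo the
   action of pairs of nonzero scalars
     (a, b) . (s, t; u, v) = (a s, a t; a^e b u, b v).
   The fibration over P^1 is (s : t); F is the class of its fibres s = 0, and
   C_0 is the curve v = 0. The curve u = 0 is disjoint from C_0 and linearly
   equivalent to C_0 + e F, so that C_0^2 = -e. *)
Definition Xe_coord {K : fieldType} (c : 'rV[K]_(2 + 2)) : bool :=
  (lsubmx c != 0) && (rsubmx c != 0).

(* Sections of O(i C_0 + j F): polynomials in s, t, u, v all of whose monomials
   have class i C_0 + j F, where s, t have class F, u has class C_0 + e F and
   v has class C_0. *)
Definition Xe_section {K : fieldType} (e i j : nat) (p : {mpoly K[2 + 2]})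
  : Prop :=
  let s : 'I_(2 + 2) := lshift 2 ord0 in
  let t : 'I_(2 + 2) := lshift 2 ord_max in
  let u : 'I_(2 + 2) := rshift 2 ord0 in
  let v : 'I_(2 + 2) := rshift 2 ord_max in
  forall mu, mu \in msupp p ->
    (mu u + mu v = i)%N /\ (mu s + mu t + e * mu u = j)%N.

(* [phi] is a basis of the space of sections of O(i C_0 + j F), i.e. it defines
   the map given by the complete linear system |i C_0 + j F|. *)
Definition complete_linear_system {K : fieldType} {N : nat} (e i j : nat)
    (phi : 'I_N -> {mpoly K[2 + 2]}) : Prop :=
  (forall l, Xe_section e i j (phi l)) /\
  (forall p, Xe_section e i j p ->
     exists! a : 'I_N -> K, p = \sum_(l < N) a l *: phi l).

Definition Xe_image {K : fieldType} {N : nat} (phi : 'I_N -> {mpoly K[2 + 2]})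
  : set (Gr K 1 N) :=
  [set x | exists2 c : 'rV[K]_(2 + 2),
     Xe_coord c & val x = <[eval_forms phi c]>%VS].

(* The image of the fibre of X_e over the point [q] of P^1. *)
Definition fibre_image {K : fieldType} {N : nat}
    (phi : 'I_N -> {mpoly K[2 + 2]}) (q : Gr K 1 2) : set (Gr K 1 N) :=
  [set x | exists2 c : 'rV[K]_(2 + 2),
     Xe_coord c /\ lsubmx c \in val q & val x = <[eval_forms phi c]>%VS].

(* The surface [Y] in P^(N-1) is a birational projection, by the linear forms
   [pi], of the rational normal ruled surface S of degree n+1 in P^(n+2) which
   is the image of X_e by |C_0 + (n+e+1)/2 F|. Both surfaces have degree n+1
   (this is what makes S the linearly normal model of [Y]), hence the centre of
   projection does not meet S and [Y] is the whole image of S. *)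
Definition has_normal_model {K : fieldType} {N : nat} (Y : set (Gr K 1 N))
    (n e : nat) : Prop :=
  exists (phi : 'I_n.+3 -> {mpoly K[2 + 2]}) (pi : 'I_N -> {mpoly K[n.+3]})
         (L : set (Gr K 2 N)),
    complete_linear_system e 1 ((n + e + 1) %/ 2) phi /\
    [/\ forall i, pi i \is 1.-homog,
        forall x, Xe_image phi x -> exists y, maps_to pi x y,
        Y = [set y | exists2 x, Xe_image phi x & maps_to pi x y],
        birational (Xe_image phi) Y pi
      & ruling Y L /\
        forall q : Gr K 1 2, exists2 l, L l &
          [set y | exists2 x, fibre_image phi q x & maps_to pi x y]
          = [set y | incident y l]].

Definition has_invariant {K : fieldType} {k m : nat} (Sigma : set (Gr K k m))
    (n e : nat) : Prop :=
  has_normal_model (plucker @` Sigma) n e.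

(* Main.v *)
Require Import Defs.
From HB Require Import structures.
From mathcomp Require Import all_boot all_order all_algebra.
From mathcomp Require Import boolp classical_sets cardinality reals.
From mathcomp Require Import mpoly complex.
From mathcomp Require Import perm separable zify ring.

Set Implicit Arguments.
Unset Strict Implicit.
Unset Printing Implicit Defensive.

Import Order.TTheory GRing.Theory Num.Theory.

Local Open Scope classical_set_scope.
Local Open Scope card_scope.
Local Open Scope ring_scope.

(** The congruences are constructed from rational scrolls of planes.

    A subspace of codimension 2 of K^(r+3) is given by its space of equations,
    a line in the dual projective space; dually, a congruence is a surface of
    lines. Let a = (n-1-e)/2 and b = a + e, so that a + b = n - 1. For a point
    (s : t) of the projective line take three dual vectors, whose components
    are forms in s, t of degrees 1, a and b:
      pvec = (s, t, 0, ...),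
      qvec1 = (t^a, 0, s^a, 0, ...),    qvec2 = (0, s^b, 0, t^b, ...).
    The remaining r - 1 components of qvec1 and qvec2 are monomials that have
    not been used, each occurring in only one component and in only one of the
    two vectors; there are a + b = n - 1 of these, which is where r <= n is
    used. The three vectors are independent for every (s : t) and span a
    plane of a scroll of degree n. The member of the family [Sigma] with
    parameters (s, t; u, v) is the annihilator of pvec and u qvec1 + v qvec2;
    its equations form a line of the pencil through the point pvec in that
    plane. The parameters are the coordinates (s, t; u, v) of X_e, and the
    Plücker coordinates of the members are sections of O(C_0 + (b+1) F).

    Order. A point x lies on the member if s x_0 + t x_1 = 0, which gives one
    (s : t), and if u qvec1(x) + v qvec2(x) = 0, which then gives one (u : v)
    ([unique_member]).

    Class. A plane meets the member in a line if the restrictions of pvec and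
    u qvec1 + v qvec2 to the plane are dependent. This happens over the zeros
    of the determinant of the restrictions of pvec, qvec1 and qvec2, a form
    of degree n in s, t. For one plane it is s^n + t^n; hence for a general
    plane it has n distinct zeros, and a simple zero contributes exactly one
    member ([class_count]).

    Focal locus. It is contained in the union of the linear space
    x_0 = x_1 = 0 and of the locus of points at which pvec, qvec1 and qvec2
    vanish for a common (s : t), which lies in the zero set of a resultant.
    Neither of these contains it ([focal_reducible]).

    Fixed points. There are none, since each component of the three vectors
    contains a monomial of its own ([no_fixed_point]).

    Congruence. Explicit equations show that [Sigma] is closed
    ([equations_Sigma]). It is irreducible, being parametrized
    ([irreducible_param]). Its dimension is at least 2 because of a point in
    a fibre in [Sigma], and at most 2 because the sections of the d-th power
    of a line bundle on X_e form a space of dimension of order d^2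
    ([not_irreducible_chain3]).

    Invariant. The normal model is the image of X_e by the monomials of class
    C_0 + (b+1) F. The Plücker coordinates are linear combinations of them,
    which is the projection; it is birational since (s : t) and (u : v) can
    be recovered from the Plücker coordinates with indices 02, 12 and 03
    ([inverse_torus]). *)

(** * Forms and closed sets *)

Section Forms.
Variables (K : fieldType) (T : Type) (N : nat) (rho : T -> 'rV[K]_N).

(** Functions on [T] given by forms in the coordinates [rho]. Equations of
    closed sets are written as such functions rather than as polynomials; that
    they are homogeneous is then checked by the closure lemmas below. *)
Definition hform (d : nat) (f : T -> K) : Prop :=
  exists2 F : {mpoly K[N]}, F \is d.-homog & forall z, f z = F.@[rho z 0].

Lemma hform_eq d f g : f =1 g -> hform d f -> hform d g.
Proof. by move=> fg [F hF eF]; exists F => // z; rewrite -fg. Qed.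

Lemma hform_coord i : hform 1 (fun z => rho z 0 i).
Proof.
exists 'X_i; first by rewrite dhomogX /= mdeg1.
by move=> z; rewrite mevalXU.
Qed.

Lemma hform0 d : hform d (fun=> 0).
Proof. by exists 0; [exact: dhomog0 | move=> z; rewrite meval0]. Qed.

Lemma hformC c : hform 0 (fun=> c).
Proof.
exists c%:MP; last by move=> z; rewrite mevalC.
by rewrite -[c%:MP]mulr1 mul_mpolyC; apply: dhomogZ; exact: dhomog1.
Qed.

Lemma hformD d f g : hform d f -> hform d g -> hform d (fun z => f z + g z).
Proof.
move=> [F hF eF] [G hG eG]; exists (F + G); first exact: dhomogD.
by move=> z; rewrite mevalD eF eG.
Qed.

Lemma hformZ d c f : hform d f -> hform d (fun z => c * f z).
Proof.
move=> [F hF eF]; exists (c *: F); first exact: dhomogZ.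
by move=> z; rewrite mevalZ eF.
Qed.

Lemma hformN d f : hform d f -> hform d (fun z => - f z).
Proof. by move=> /(hformZ (-1)); apply: hform_eq => z; rewrite mulN1r. Qed.

Lemma hformB d f g : hform d f -> hform d g -> hform d (fun z => f z - g z).
Proof. by move=> hf /hformN; apply: hformD. Qed.

Lemma hformM d e f g : hform d f -> hform e g -> hform (d + e) (fun z => f z * g z).
Proof.
move=> [F hF eF] [G hG eG]; exists (F * G); first exact: dhomogM.
by move=> z; rewrite mevalM eF eG.
Qed.

Lemma hformX d f k : hform d f -> hform (d * k) (fun z => f z ^+ k).
Proof.
move=> [F hF eF]; exists (F ^+ k); first exact: dhomogMn.
by move=> z; rewrite rmorphXn /= eF.
Qed.

Lemma hform_sum d (I : Type) (r : seq I) (P : pred I) (f : I -> T -> K) :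
  (forall i, P i -> hform d (f i)) -> hform d (fun z => \sum_(i <- r | P i) f i z).
Proof.
move=> hf; elim: r => [|i r IH].
  by apply: (hform_eq _ (hform0 d)) => z; rewrite big_nil.
case Pi: (P i).
  by apply: (hform_eq _ (hformD (hf i Pi) IH)) => z; rewrite big_cons Pi.
by apply: (hform_eq _ IH) => z; rewrite big_cons Pi.
Qed.

Lemma hform_prod d (I : Type) (r : seq I) (f : I -> T -> K) :
  (forall i, hform d (f i)) -> hform (size r * d) (fun z => \prod_(i <- r) f i z).
Proof.
move=> hf; elim: r => [|i r IH].
  by apply: (hform_eq _ (hformC 1)) => z; rewrite big_nil.
rewrite /= mulSn.
by apply: (hform_eq _ (hformM (hf i) IH)) => z; rewrite big_cons.
Qed.

Lemma hform_det d k (A : T -> 'M[K]_k) :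
  (forall i j, hform d (fun z => A z i j)) -> hform (k * d) (fun z => \det (A z)).
Proof.
move=> hA; rewrite /determinant; apply: hform_sum => s _; apply: hformZ.
have := @hform_prod d _ (index_enum 'I_k) (fun i z => A z i (s i)) (fun i => hA i (s i)).
rewrite (_ : size _ = k) //.
by rewrite [index_enum _]unlock -enumT -cardE card_ord.
Qed.

End Forms.

Section Homogeneous.
Variables (K : fieldType) (N : nat).

Lemma meval_dhomog d (F : {mpoly K[N]}) (lam : K) (v : 'rV[K]_N) :
  F \is d.-homog -> F.@[(lam *: v) 0] = lam ^+ d * F.@[v 0].
Proof.
move=> /dhomogP hF; rewrite !mevalE mulr_sumr [LHS]big_seq [RHS]big_seq.
apply: eq_bigr => m /hF /= <-.
rewrite mulrCA; congr (_ * _).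
rewrite mdegE -prodrXr -big_split /=; apply: eq_bigr => i _.
by rewrite !mxE exprMn.
Qed.

End Homogeneous.

Definition rep {K : fieldType} {m : nat} (x : Gr K 1 m) : 'rV[K]_m :=
  vpick (val x).

Definition plrow {K : fieldType} {k m : nat} (x : Gr K k m)
  : 'rV[K]_#|ksub k m| := plucker_row (basis_mx x).

Section Points.
Variables (K : fieldType) (m : nat).
Implicit Types x y : Gr K 1 m.

Lemma rep_neq0 x : rep x != 0.
Proof.
by rewrite /rep vpick0 -dimv_eq0 (eqP (valP x)).
Qed.

Lemma rep_line x : val x = <[rep x]>%VS.
Proof.
apply/esym/eqP; rewrite eqEdim -memvE memv_pick (eqP (valP x)) dim_vline.
by rewrite (rep_neq0 x).
Qed.

Lemma line_subproof (v : 'rV[K]_m) : v != 0 -> \dim <[v]> == 1%N.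
Proof. by move=> v0; rewrite dim_vline v0. Qed.

Definition pt (v : 'rV[K]_m) (v0 : v != 0) : Gr K 1 m :=
  exist (fun U : {vspace 'rV[K]_m} => \dim U == 1%N) <[v]>%VS (line_subproof v0).

Lemma line_eq (v w : 'rV[K]_m) : v != 0 -> <[v]>%VS = <[w]>%VS ->
  exists2 lam, lam != 0 & w = lam *: v.
Proof.
move=> v0 e; have : w \in <[v]>%VS by rewrite e memv_line.
case/vlineP => lam wE; exists lam => //; apply/eqP => l0.
by move: v0; rewrite -memv0 memvE e wE l0 scale0r subvv.
Qed.

Lemma lineZ (v : 'rV[K]_m) lam : lam != 0 -> <[lam *: v]>%VS = <[v]>%VS.
Proof.
move=> l0; apply/eqP; rewrite eqEsubv -!memvE memvZ ?memv_line //=.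
by rewrite -{1}[v](scalerK l0) memvZ ?memv_line.
Qed.

Lemma rep_pt (v : 'rV[K]_m) (v0 : v != 0) :
  exists2 lam, lam != 0 & rep (pt v0) = lam *: v.
Proof. by apply: line_eq => //; rewrite -(rep_line (pt v0)). Qed.

Lemma val_rep x (w : 'rV[K]_m) : val x = <[w]>%VS -> exists2 lam, lam != 0 & rep x = lam *: w.
Proof.
rewrite rep_line => e; have [lam l0 ->] := line_eq (rep_neq0 x) e.
by exists lam^-1; rewrite ?invr_eq0 // scalerK.
Qed.

End Points.

Section Closed.
Variables (K : fieldType).

(** Both topologies in use are of this kind: on a projective space [rho] is a
    representative vector, on a Grassmannian it is the vector of Plücker
    coordinates. *)
Definition hform_closed {T : Type} {N : nat} (rho : T -> 'rV[K]_N) (A : set T)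
  : Prop :=
  exists (I : Type) (f : I -> T -> K),
    (forall i, exists d, hform rho d (f i)) /\
    forall z, A z <-> forall i, f i z = 0.

Lemma hform_closed_zero T N (rho : T -> 'rV[K]_N) d f :
  hform rho d f -> hform_closed rho [set z | f z = 0].
Proof.
move=> hf; exists unit, (fun=> f); split; first by move=> _; exists d.
by move=> z; split => [//|]; apply; exact: tt.
Qed.

Lemma hform_closedI T N (rho : T -> 'rV[K]_N) (A B : set T) :
  hform_closed rho A -> hform_closed rho B -> hform_closed rho (A `&` B).
Proof.
move=> [I [f [hf eA]]] [J [g [hg eB]]].
exists (I + J)%type, (fun ij => match ij with inl i => f i | inr j => g j end).
split=> [[i|j]|z]; [exact: hf | exact: hg |].
split=> [[/eA Az /eB Bz] [i|j] //|h].
by split; [apply/eA => i; apply: (h (inl i)) | apply/eB => j; apply: (h (inr j))].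
Qed.

Lemma hform_closed_forall T N (rho : T -> 'rV[K]_N) (I : Type) (A : I -> set T) :
  (forall i, hform_closed rho (A i)) -> hform_closed rho [set z | forall i, A i z].
Proof.
move=> hA.
have {}hA i : exists Jf : {J : Type & J -> T -> K},
    (forall j, exists d, hform rho d (projT2 Jf j)) /\
    forall z, A i z <-> forall j, projT2 Jf j z = 0.
  by have [J [f h]] := hA i; exists (existT _ J f).
have [J hJ] := choice hA.
exists {i : I & projT1 (J i)}, (fun ij => projT2 (J (projT1 ij)) (projT2 ij)).
split=> [[i j]|z /=]; first by have [h _] := hJ i; apply: h.
split=> [h [i j]|h i] /=; have [_ e] := hJ i; first exact: (e z).1.
by apply/e => j; apply: (h (existT _ i j)).
Qed.

Definition eqns {T : Type} {N : nat} (rho : T -> 'rV[K]_N) {I} (f : I -> T -> K)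
  : set {mpoly K[N]} :=
  [set F | (exists d, F \is d.-homog) /\ exists i, forall z, f i z = F.@[rho z 0]].

Lemma zariski_closed_form m (A : set (Gr K 1 m)) :
  hform_closed rep A -> zariski_closed A.
Proof.
move=> [I [f [hf eA]]]; exists (eqns rep f); split; first by move=> p [].
move=> x; split=> [/eA Ax p [[d hp] [i ep]] v | h].
  rewrite (rep_line x) => /vlineP[lam ->].
  by rewrite (meval_dhomog _ _ hp) -ep Ax mulr0.
apply/eA => i; have [d [F hF eF]] := hf i.
rewrite eF; apply: (h F); first by split; [exists d | exists i].
by rewrite rep_line memv_line.
Qed.

Lemma zariski_closed_sep m (A : set (Gr K 1 m)) x :
  zariski_closed A -> ~ A x ->
  exists d f, [/\ hform rep d f, forall z, A z -> f z = 0 & f x != 0].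
Proof.
move=> [S [hS eA]] nAx.
have : ~ forall p, S p -> p.@[rep x 0] = 0.
  move=> h; apply: nAx; apply/eA => p Sp v; have [d hp] := hS p Sp.
  rewrite rep_line => /vlineP[lam ->]; by rewrite (meval_dhomog _ _ hp) h ?mulr0.
move=> /existsNP[p /not_implyP[Sp /eqP px]]; have [d hp] := hS p Sp.
exists d, (fun z => p.@[rep z 0]); split => //; first by exists p.
by move=> z /eA; apply => //; rewrite rep_line memv_line.
Qed.

Lemma gr_closed_form k m (A : set (Gr K k m)) :
  hform_closed plrow A -> gr_closed A.
Proof.
move=> [I [f [hf eA]]].
exists [set y : Gr K 1 #|ksub k m| | forall p, eqns plrow f p ->
  forall v : 'rV[K]_#|ksub k m|, v \in val y -> p.@[v 0] = 0].
  by exists (eqns plrow f); split; first by move=> p [].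
apply/seteqP; split=> x /=; last first.
  move=> h; apply/eA => i; have [d [F hF eF]] := hf i.
  rewrite eF; apply: (h F); first by split; [exists d | exists i].
  by rewrite memv_line.
move=> /eA Ax p [[d hp] [i ep]] v /vlineP[lam ->].
by rewrite (meval_dhomog _ _ hp) -/(plrow x) -ep Ax mulr0.
Qed.

Lemma gr_closed_sep k m (A : set (Gr K k m)) x :
  gr_closed A -> ~ A x ->
  exists d f, [/\ hform plrow d f, forall z, A z -> f z = 0 & f x != 0].
Proof.
move=> [Y cY ->] nYx.
have [d [f [[F hF eF] fY fx]]] := zariski_closed_sep cY nYx.
have eF' z : exists2 lam, lam != 0 & f (plucker z) = lam ^+ d * F.@[plrow z 0].
  have [lam l0 e] := val_rep (erefl (val (plucker z))).
  by exists lam => //; rewrite eF e (meval_dhomog _ _ hF).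
exists d, (fun z => F.@[plrow z 0]); split; first by exists F.
  move=> z /fY; have [lam l0 ->] := eF' z.
  by move/eqP; rewrite mulf_eq0 expf_eq0 (negPf l0) andbF => /eqP.
have [lam l0 e] := eF' x.
by apply: contraNneq fx => h; rewrite e h mulr0.
Qed.

End Closed.

(** * Irreducibility *)

Section Irreducible.
Variable K : numFieldType.

Lemma poly_nonroot (p : {poly K}) : p != 0 -> exists x, p.[x] != 0.
Proof.
move=> p0; apply: contrapT => h.
have all0 x : root p x by rewrite /root; apply: contra_notT h => px; exists x.
pose rs := [seq i%:R : K | i <- iota 0 (size p)].
have urs : uniq rs.
  by rewrite map_inj_uniq ?iota_uniq // => i j /eqP; rewrite eqr_nat => /eqP.
have /max_poly_roots : all (root p) rs by apply/allP => x _; exact: all0.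
by move=> /(_ p0 urs); rewrite size_map size_iota ltnn.
Qed.

Lemma restrict_line k (F : {mpoly K[k]}) (c d : 'rV[K]_k) :
  exists p : {poly K}, forall x, p.[x] = F.@[(c + x *: d) 0].
Proof.
pose l i : {poly K} := (c 0 i)%:P + 'X * (d 0 i)%:P.
exists (\sum_(m <- msupp F) (F@_m)%:P * \prod_i l i ^+ m i) => x.
rewrite horner_sum mevalE; apply: eq_bigr => m _.
rewrite hornerM hornerC horner_prod; congr (_ * _); apply: eq_bigr => i _.
by rewrite horner_exp /l !hornerE !mxE.
Qed.

(** On the line through a point where [F] does not vanish and one where [G]
    does not, both polynomials have finitely many zeros. *)
Lemma meval_neq0_common k (F G : {mpoly K[k]}) (c d : 'rV[K]_k) :
  F.@[c 0] != 0 -> G.@[d 0] != 0 -> exists v : 'rV[K]_k, F.@[v 0] != 0 /\ G.@[v 0] != 0.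
Proof.
move=> Fc Gd.
have [p hp] := restrict_line F c (d - c); have [q hq] := restrict_line G c (d - c).
have p0 : p != 0.
  by apply: contraNneq Fc => p0; have := hp 0; rewrite p0 horner0 scale0r addr0 => <-.
have q0 : q != 0.
  apply: contraNneq Gd => q0; have := hq 1; rewrite q0 horner0 scale1r.
  by rewrite addrC subrK => <-.
have [x] : exists x, (p * q).[x] != 0 by apply: poly_nonroot; rewrite mulf_neq0.
by rewrite hornerM mulf_eq0 negb_or hp hq => /andP[]; exists (c + x *: (d - c)).
Qed.

Lemma pull_form k N (g : 'I_N -> {mpoly K[k]}) (F : {mpoly K[N]}) (c : 'rV[K]_k) :
  F.@[eval_forms g c 0] = (F \mPo [tuple g i | i < N]).@[c 0].
Proof.
rewrite comp_mpoly_meval; apply: meval_eq => i.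
by rewrite mxE tnth_mktuple.
Qed.

(** Two conditions [F != 0] and [G != 0] that can be met separately can be met
    at the same parameter. The polynomial [h] allows for parameters that do not
    correspond to a point of [Z]. *)
Lemma irreducible_param k m l (Z : set (Gr K k m))
    (g : 'I_#|ksub k m| -> {mpoly K[l]}) (h : {mpoly K[l]}) (c0 : 'rV[K]_l) :
  h.@[c0 0] != 0 ->
  (forall c : 'rV[K]_l, h.@[c 0] != 0 -> exists z, [/\ Z z &
     exists2 lam : K, lam != 0 & plrow z = lam *: eval_forms g c]) ->
  (forall z, Z z -> exists c, exists lam, plrow z = lam *: eval_forms g c) ->
  irreducible_set gr_closed Z.
Proof.
move=> hc0 hZ Zh; split; first by have [z [Zz _]] := hZ _ hc0; exists z.
have sep (A : set _) : gr_closed A -> ~ (Z `<=` A) -> exists F (c : 'rV[K]_l), F.@[c 0] != 0 /\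
    forall z (c : 'rV[K]_l), Z z -> A z -> forall lam, lam != 0 ->
      plrow z = lam *: eval_forms g c ->
    F.@[c 0] = 0.
  move=> cA /existsNP[z /not_implyP[Zz nAz]].
  have [d [f [[F hF eF] fA fz]]] := gr_closed_sep cA nAz.
  have [c [lam ez]] := Zh z Zz.
  exists (F \mPo [tuple g i | i < _]), c; split.
    rewrite -pull_form; apply: contraNneq fz => e.
    by rewrite eF ez (meval_dhomog _ _ hF) e mulr0.
  move=> z' c' Zz' Az' lam' l0 ez'; have := fA _ Az'.
  rewrite eF ez' (meval_dhomog _ _ hF) -pull_form => /eqP.
  by rewrite mulf_eq0 expf_eq0 (negPf l0) andbF => /eqP.
move=> A B cA cB ZAB; apply: contrapT => /not_orP[nA nB].
have [F [c [Fc FA]]] := sep A cA nA; have [G [d [Gd GB]]] := sep B cB nB.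
have [v [Fv hv]] := meval_neq0_common Fc hc0.
have [w] : exists w : 'rV[K]_l, (F * h).@[w 0] != 0 /\ G.@[w 0] != 0.
  by apply: (@meval_neq0_common _ _ _ v d) => //; rewrite mevalM mulf_neq0 //.
rewrite mevalM mulf_eq0 negb_or => -[/andP[Fw hw] Gw].
have [z [Zz [lam l0 ez]]] := hZ w hw.
have [Az|Bz] := ZAB z Zz.
  by move: Fw; rewrite (FA _ _ Zz Az _ l0 ez) eqxx.
by move: Gw; rewrite (GB _ _ Zz Bz _ l0 ez) eqxx.
Qed.

End Irreducible.

(** * Sections on the ruled surface *)

(* the coordinates s, t, u, v on X_e *)
Local Notation is_ := (lshift 2 ord0 : 'I_(2 + 2)).
Local Notation it_ := (lshift 2 ord_max : 'I_(2 + 2)).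
Local Notation iu_ := (rshift 2 ord0 : 'I_(2 + 2)).
Local Notation iv_ := (rshift 2 ord_max : 'I_(2 + 2)).

Lemma prod4 (R : comNzRingType) (f : 'I_(2 + 2) -> R) :
  \prod_i f i = f is_ * f it_ * f iu_ * f iv_.
Proof.
rewrite !big_ord_recl big_ord0 mulr1 !mulrA.
by congr (_ * _ * _ * _); congr (f _); apply/val_inj.
Qed.

Section Sections.
Variables (K : fieldType) (e : nat).
Implicit Types p q : {mpoly K[2 + 2]}.

Lemma Xe_sectionE i j p : Xe_section e i j p = (forall mu, mu \in msupp p ->
  (mu iu_ + mu iv_ = i)%N /\ (mu is_ + mu it_ + e * mu iu_ = j)%N).
Proof. by []. Qed.

Lemma Xe_section0 i j : Xe_section e i j (0 : {mpoly K[2 + 2]}).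
Proof. by rewrite Xe_sectionE => mu; rewrite msupp0. Qed.

Lemma Xe_sectionD i j p q :
  Xe_section e i j p -> Xe_section e i j q -> Xe_section e i j (p + q).
Proof.
rewrite !Xe_sectionE =>  hp hq mu h; have := msuppD_le h; rewrite mem_cat => /orP[/hp|/hq] //.
Qed.

Lemma Xe_sectionZ i j c p : Xe_section e i j p -> Xe_section e i j (c *: p).
Proof. by rewrite !Xe_sectionE => hp mu h; have /hp := msuppZ_le h. Qed.

Lemma Xe_sectionM i j k l p q :
  Xe_section e i j p -> Xe_section e k l q -> Xe_section e (i + k) (j + l) (p * q).
Proof.
rewrite !Xe_sectionE =>  hp hq mu h; have := msuppM_le h.
move=> /allpairsP[[m1 m2] /= [/hp[h1 h2] /hq[h3 h4] ->]].
by rewrite !mnmDE; split; lia.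
Qed.

Lemma Xe_section_sum i j (I : Type) (r : seq I) (P : pred I) F :
  (forall l, P l -> Xe_section e i j (F l)) ->
  Xe_section e i j (\sum_(l <- r | P l) F l : {mpoly K[2 + 2]}).
Proof.
move=> h; apply: (big_ind (Xe_section e i j)) => //.
  exact: Xe_section0.
by move=> *; apply: Xe_sectionD.
Qed.

Lemma Xe_sectionC (c : K) : Xe_section e 0 0 c%:MP.
Proof.
rewrite Xe_sectionE => mu; rewrite msuppC; case: eqP => // _; rewrite inE => /eqP->.
by rewrite !mnmE muln0.
Qed.

Lemma Xe_sectionXn i j p k : Xe_section e i j p -> Xe_section e (k * i) (k * j) (p ^+ k).
Proof.
move=> hp; elim: k => [|k IH]; first by rewrite expr0; exact: Xe_sectionC.
by rewrite exprS !mulSn; apply: Xe_sectionM.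
Qed.

Lemma Xe_section_comp i j N (g : 'I_N -> {mpoly K[2 + 2]}) d (F : {mpoly K[N]}) :
  (forall l, Xe_section e i j (g l)) -> F \is d.-homog ->
  Xe_section e (d * i) (d * j) (F \mPo [tuple g l | l < N]).
Proof.
move=> hg /dhomogP hF; rewrite comp_mpolyE big_seq.
apply: Xe_section_sum => mu /hF /= <-; apply: Xe_sectionZ.
rewrite mdegE; apply: (big_ind2 (fun (k : nat) p => Xe_section e (k * i) (k * j) p)).
- exact: Xe_sectionC.
- by move=> k1 p1 k2 p2 h1 h2; rewrite !mulnDl; apply: Xe_sectionM.
by move=> l _; rewrite tnth_mktuple; apply: Xe_sectionXn.
Qed.

(** A monomial of a given class is determined by its exponents in u and s;
    hence the sections of O(i C_0 + j F) form a space of dimension at most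
    (i+1)(j+1). *)
Lemma Xe_section_dependent i j (T : finType) (G : T -> {mpoly K[2 + 2]}) :
  (forall t, Xe_section e i j (G t)) -> (i.+1 * j.+1 < #|T|)%N ->
  exists2 c : T -> K, exists t, c t != 0 & \sum_t c t *: G t = 0.
Proof.
move=> hG lt; pose I : finType := ('I_i.+1 * 'I_j.+1)%type.
pose mon (xy : I) : 'X_{1..2 + 2} :=
  [multinom (if l == is_ then xy.2 : nat else if l == it_ then j - xy.2 - e * xy.1
     else if l == iu_ then xy.1 : nat else i - xy.1)%N | l < 2 + 2].
pose A : 'M[K]_(#|T|, #|I|) := \matrix_(t, xy) (G (enum_val t))@_(mon (enum_val xy)).
have /rowV0Pn[v /sub_kermxP vA v0] : kermx A != 0.
  rewrite kermx_eq0 /row_free neq_ltn (leq_ltn_trans (rank_leq_col A)) //.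
  by rewrite card_prod !card_ord.
exists (fun t => v 0 (enum_rank t)).
  have /rV0Pn[t vt] := v0; by exists (enum_val t); rewrite enum_valK.
apply/mpolyP => mu; rewrite mcoeff0 raddf_sum /=.
have [[tmu htmu]|no] := pselect (exists t, mu \in msupp (G t)); last first.
  apply: big1 => t _; rewrite mcoeffZ memN_msupp_eq0 ?mulr0 //.
  by apply/negP => h; apply: no; exists t.
have := hG tmu; rewrite Xe_sectionE => /(_ _ htmu)[h1 h2].
have lx : (mu iu_ < i.+1)%N by lia.
have ly : (mu is_ < j.+1)%N by lia.
have muE : mu = mon (Ordinal lx, Ordinal ly).
  apply/mnmP => l; rewrite mnmE /=.
  case: l => -[|[|[|[|//]]]] hl /=.
  - by congr (mu _); apply/val_inj.
  - rewrite (_ : Ordinal hl = it_) //; last exact/val_inj.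
    by have := h2; lia.
  - by congr (mu _); apply/val_inj.
  rewrite (_ : Ordinal hl = iv_) //; last exact/val_inj.
  by have := h1; lia.
have := congr1 (fun M : 'M_(1, _) => M 0 (enum_rank (Ordinal lx, Ordinal ly))) vA.
rewrite !mxE => h; rewrite -[RHS]h (reindex (@enum_rank T)) /=.
  by apply: eq_bigr => t _; rewrite mcoeffZ mxE !enum_rankK -muE.
by exists enum_val => t _; rewrite (enum_rankK, enum_valK).
Qed.

End Sections.

(** * The dimension bound *)

Section Dimension.
Variables (K : numFieldType) (k m : nat).
Let T := Gr K k m.

(** Since [f] does not vanish identically on the irreducible set [Z], its lowest
    power in the relation, with exponent [k0], can be cancelled. The quotient,
    restricted to [Z'], where [f] vanishes, is [g k0]. *)
Lemma lowest_coef_vanishes (Z Z' : set T) (E d df k0 : nat) (D : nat -> nat) (f : T ->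
  K) (g : nat -> T -> K) :
  irreducible_set gr_closed Z -> hform plrow df f ->
  (exists2 z, Z z & f z != 0) -> (forall z, Z' z -> Z z /\ f z = 0) ->
  (forall l, (l <= d)%N -> hform plrow (D l) (g l) /\ (D l + l * df = E)%N) ->
  (forall z, Z z -> \sum_(l < d.+1) g l z * f z ^+ l = 0) ->
  (k0 <= d)%N -> (forall l z, (l < k0)%N -> g l z = 0) ->
  forall z, Z' z -> g k0 z = 0.
Proof.
move=> [_ irr] hf [z0 Zz0 fz0] Z'Z hg rel kd gk0.
pose h z := \sum_(k0 <= l < d.+1) g l z * f z ^+ (l - k0).
have hh : hform plrow (D k0) h.
  have : hform plrow (D k0) (fun z =>
    \sum_(l <- index_iota k0 d.+1) if (k0 <= l < d.+1)%N then g l z * f z ^+ (l - k0) else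
    0).
    apply: hform_sum => l _; case kl: (k0 <= l < d.+1)%N; last exact: hform0.
    have /andP[l1 l2] := kl.
    have [gl Dl] := hg l l2; have [_ Dk] := hg k0 kd.
    have -> : (D k0 = D l + df * (l - k0))%N.
      have -> : (D k0 = E - k0 * df)%N by lia.
      by rewrite -Dl mulnBr; nia.
    by apply: hformM => //; apply: hformX.
  apply: hform_eq => z; rewrite /h big_seq [RHS]big_seq; apply: eq_bigr => l.
  by rewrite mem_index_iota => ->.
have fact z : \sum_(l < d.+1) g l z * f z ^+ l = f z ^+ k0 * h z.
  rewrite -(big_mkord xpredT (fun l => g l z * f z ^+ l)) (@big_cat_nat _ _ _ k0) //=;
    last by lia.
  rewrite big_nat big1 ?add0r => [|l /andP[_ lk]]; last by rewrite gk0 ?mul0r.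
  rewrite /h mulr_sumr big_nat [RHS]big_nat; apply: eq_bigr => l /andP[kl _].
  by rewrite mulrCA -exprD subnKC.
have ZAB : Z `<=` [set z | f z = 0] `|` [set z | h z = 0].
  move=> z Zz /=; have := rel z Zz; rewrite fact => /eqP; rewrite mulf_eq0 expf_eq0.
  by case/orP => [/andP[_ /eqP]|/eqP]; [left | right].
have [A|B] := irr _ _ (gr_closed_form (hform_closed_zero hf))
                      (gr_closed_form (hform_closed_zero hh)) ZAB.
  by have := A _ Zz0 => /= fz; rewrite fz eqxx in fz0.
move=> z /Z'Z[Zz fz]; have := B z Zz; rewrite /= /h big_ltn // subnn expr0 mulr1.
rewrite big_nat big1 ?addr0 // => l /andP[kl _].
by rewrite fz expr0n subn_eq0 leqNgt kl /= mulr0.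
Qed.

(** Compares the number of monomials in three forms with exponents at most [dd]
    with the bound of [Xe_section_dependent] for the space containing them. *)
Lemma cube_dominates delta J :
  exists dd, ((dd * delta).+1 * (dd * delta * J).+1 < dd.+1 * dd.+1 * dd.+1)%N.
Proof.
exists (delta.+1 ^ 2 * J.+1)%N; set dd := (_ ^ 2 * _)%N.
have h1 : ((dd * delta).+1 <= dd.+1 * delta.+1)%N by rewrite mulSnr -ltnS; lia.
have h2 : ((dd * delta * J).+1 <= dd.+1 * delta.+1 * J.+1)%N.
  by apply: leq_trans (leq_mul h1 (leqnn J.+1)); rewrite mulSn mulnS; lia.
apply: (leq_ltn_trans (leq_mul h1 h2)).
have -> : (dd.+1 * delta.+1 * (dd.+1 * delta.+1 * J.+1) = dd.+1 * dd.+1 * dd)%N.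
  by rewrite /dd -mulnn; ring.
by rewrite ltn_mul2l muln_gt0 /= ltnSn.
Qed.

(** The exponents of a form of degree 1 that make all monomials with exponents
    at most [dd] in three forms of degrees [d1], [d2], [d3] homogeneous of the
    same degree. *)
Lemma complementary_exponent dd d1 d2 d3 :
  let E := (dd * (d1 + d2 + d3))%N in
  exists ex : nat -> nat -> nat -> nat, forall x y w,
    (x <= dd -> y <= dd -> w <= dd ->
    [/\ ex x y w + d1 * x + d2 * y + d3 * w = E, ex 0 y w = ex x y w + d1 * x,
        ex 0 0 w = ex 0 y w + d2 * y & E = ex 0 0 w + d3 * w])%N.
Proof.
exists (fun x y w => dd * (d1 + d2 + d3) - x * d1 - y * d2 - w * d3)%N.
move=> x y w hx hy hw.
have := leq_mul hx (leqnn d1); have := leq_mul hy (leqnn d2).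
by have := leq_mul hw (leqnn d3); rewrite !mulnDr; split; lia.
Qed.

(** A set parametrized by sections on X_e has dimension at most 2. For a chain
    Z_0 < Z_1 < Z_2 < Z_3 take a coordinate f_0 that does not vanish
    identically on Z_0, and forms f_i vanishing on Z_(i-1) but not on Z_i.
    Applying [lowest_coef_vanishes] along the chain shows that the monomials
    in f_0, ..., f_3 of the same degree are linearly independent on Z_3. But
    there are of order d^3 of them in a space of sections whose dimension is
    of order d^2. *)
Lemma not_irreducible_chain3 e J (Sigma : set T) (g : 'I_#|ksub k m| -> {mpoly K[2 + 2]}) :
  (forall l, Xe_section e 1 J (g l)) ->
  (forall z, Sigma z -> exists c, exists lam : K, plrow z = lam *: eval_forms g c) ->
  ~ irreducible_chain gr_closed Sigma 3.
Proof.
move=> hg Sg [c [hc incl]].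
have [cl0 [[z0 cz0] irr0] _] := hc 0%N isT.
have sep i : (i < 3)%N -> exists df, exists2 F : {mpoly K[#|ksub k m|]}, F \is df.-homog &
   (forall z, c i z -> F.@[plrow z 0] = 0) /\ exists2 z, c i.+1 z & F.@[plrow z 0] != 0.
  move=> i3; have [sub nsub] := incl i i3.
  have [cli _ _] := hc i (ltnW i3).
  have /existsNP[z /not_implyP[cz ncz]] := nsub.
  have [d [f [[F hF eF] fc fz]]] := gr_closed_sep cli ncz.
  by exists d, F => //; split=> [z' /fc|]; [rewrite eF | exists z; rewrite -?eF].
have [d1 [F1 hF1 [F1v [w1 cw1 F1w]]]] := sep 0%N isT.
have [d2 [F2 hF2 [F2v [w2 cw2 F2w]]]] := sep 1%N isT.
have [d3 [F3 hF3 [F3v [w3 cw3 F3w]]]] := sep 2%N isT.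
have [l F0z] : exists l, plrow z0 0 l != 0.
  by apply/rV0Pn; have := plucker_subproof z0; rewrite dim_vline eqb1.
have [dd ddP] := cube_dominates (d1 + d2 + d3) J.
have [ex exE] := complementary_exponent dd d1 d2 d3.
move: (dd * (d1 + d2 + d3))%N => E /= in ddP exE.
pose I : finType := ('I_dd.+1 * 'I_dd.+1 * 'I_dd.+1)%type.
pose M (t : I) : {mpoly K[#|ksub k m|]} :=
  'X_l ^+ ex t.2 t.1.2 t.1.1 * F1 ^+ t.2 * F2 ^+ t.1.2 * F3 ^+ t.1.1.
have hX : ('X_l : {mpoly K[#|ksub k m|]}) \is 1.-homog by rewrite dhomogX /= mdeg1.
have hM t : M t \is E.-homog.
  have [||| <- _ _ _] := exE t.2 t.1.2 t.1.1; rewrite -1?ltnS //.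
  have := dhomogM (dhomogM (dhomogM (dhomogMn (ex t.2 t.1.2 t.1.1) hX) (dhomogMn t.2 hF1))
           (dhomogMn t.1.2 hF2)) (dhomogMn t.1.1 hF3).
  by rewrite mul1n.
have [|a [t0 at0] arel] := @Xe_section_dependent K e (E * 1) (E * J) I
    (fun t => M t \mPo [tuple g i | i < _]) (fun t => Xe_section_comp hg (hM t)).
  by rewrite !card_prod !card_ord muln1.
have rel z : Sigma z -> \sum_t a t * (M t).@[plrow z 0] = 0.
  move=> /Sg[c' [lam ->]].
  transitivity (lam ^+ E * (\sum_t a t *: (M t \mPo [tuple g i | i < _])).@[c' 0]).
    rewrite raddf_sum mulr_sumr; apply: eq_bigr => t _ /=.
    by rewrite (meval_dhomog _ _ (hM t)) mevalZ pull_form mulrCA.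
  by rewrite arel meval0 mulr0.
pose f (F : {mpoly K[#|ksub k m|]}) (z : T) := F.@[plrow z 0].
pose C x y w := a (inord w, inord y, inord x).
pose g1 w y x z := C x y w * f 'X_l z ^+ ex x y w.
pose g2 w y z := \sum_(x < dd.+1) g1 w y x z * f F1 z ^+ x.
pose g3 w z := \sum_(y < dd.+1) g2 w y z * f F2 z ^+ y.
have rel3 z : Sigma z -> \sum_(w < dd.+1) g3 w z * f F3 z ^+ w = 0.
  move=> Sz; rewrite -[RHS](rel z Sz).
  transitivity (\sum_w \sum_y \sum_x a (w, y, x) * (M (w, y, x)).@[plrow z 0]); last first.
    by rewrite !pair_bigA /=; apply: eq_bigr => -[[]].
  apply: eq_bigr => k' _; rewrite /g3 mulr_suml; apply: eq_bigr => j' _.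
  rewrite /g2 !mulr_suml; apply: eq_bigr => i' _.
  by rewrite /g1 /C !inord_val /M !mevalM !rmorphXn /= !mulrA.
have hf0 : hform plrow 1 (f 'X_l) by exists 'X_l.
have hf1 : hform plrow d1 (f F1) by exists F1.
have hf2 : hform plrow d2 (f F2) by exists F2.
have hf3 : hform plrow d3 (f F3) by exists F3.
have hg1 k' j' i' : hform plrow (ex i' j' k') (g1 k' j' i').
  by apply: hformZ; have := hformX (ex i' j' k') hf0; rewrite mul1n.
have hg2 k' j' : (k' <= dd)%N -> (j' <= dd)%N -> hform plrow (ex 0 j' k')%N (g2 k' j').
  move=> hk hj; apply: hform_sum => i' _; have := ltn_ord i'; rewrite ltnS => hi.
  have [_ -> _ _] := exE _ _ _ hi hj hk.
  by apply: hformM => //; apply: hformX.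
have hg3 k' : (k' <= dd)%N -> hform plrow (ex 0 0 k')%N (g3 k').
  move=> hk; apply: hform_sum => j' _; have := ltn_ord j'; rewrite ltnS => hj.
  have [_ _ -> _] := exE _ _ _ (leq0n dd) hj hk.
  by apply: hformM; [apply: hg2 | apply: hformX].
(* the smallest exponents of a nonzero term *)
pose P3 k' := (k' <= dd)%N && [exists t : I, (t.1.1 == k' :> nat) && (a t != 0)].
have [|k0 /andP[k0d /existsP[t3 /andP[/eqP t3k at3]]] k0min] := @ex_minnP P3.
  by exists t0.1.1; rewrite /P3 -ltnS ltn_ord /=; apply/existsP; exists t0; rewrite eqxx.
pose P2 j' := (j' <= dd)%N && [exists t : I, [&& t.1.1 == k0 :> nat,
  t.1.2 == j' :> nat & a t != 0]].
have [|j0 /andP[j0d /existsP[t2 /and3P[/eqP t2k /eqP t2j at2]]] j0min] := @ex_minnP P2.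
  by exists t3.1.2; rewrite /P2 -ltnS ltn_ord /=; apply/existsP; exists t3; rewrite t3k !eqxx.
pose P1 i' := (i' <= dd)%N && (C i' j0 k0 != 0).
have [|i0 /andP[i0d Ci0] i0min] := @ex_minnP P1.
  exists t2.2; rewrite /P1 -ltnS ltn_ord /= /C -t2k -t2j !inord_val.
  by case: (t2) at2 => -[].
have C3 i' j' k' : (k' < k0)%N -> C i' j' k' = 0.
  move=> lt; apply/eqP/negPn/negP => Cn0.
  have hk : (k' <= dd)%N := leq_trans (ltnW lt) k0d.
  have : P3 k'.
    rewrite /P3 hk /=; apply/existsP; exists (inord k', inord j', inord i').
    by rewrite /= inordK ?eqxx.
  by move=> /k0min; rewrite leqNgt lt.
have C2 i' j' : (j' < j0)%N -> C i' j' k0 = 0.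
  move=> lt; apply/eqP/negPn/negP => Cn0.
  have hj : (j' <= dd)%N := leq_trans (ltnW lt) j0d.
  have : P2 j'.
    rewrite /P2 hj /=; apply/existsP; exists (inord k0, inord j', inord i').
    by rewrite /= !inordK ?eqxx.
  by move=> /j0min; rewrite leqNgt lt.
have C1 i' : (i' < i0)%N -> C i' j0 k0 = 0.
  move=> lt; apply/eqP/negPn/negP => Cn0.
  have /i0min : P1 i' by rewrite /P1 Cn0 andbT (leq_trans (ltnW lt) i0d).
  by rewrite leqNgt lt.
have [_ irr1 _] := hc 1%N isT; have [_ irr2 _] := hc 2%N isT.
have [_ irr3 sub3] := hc 3%N isT.
have g3v z : c 2%N z -> g3 k0 z = 0.
  apply: (lowest_coef_vanishes (D := fun w => ex 0%N 0%N w) (E := E) irr3 hf3 _ _ _ _ k0d).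
  - by exists w3.
  - by move=> z' cz; split; [have [+ _] := incl 2%N isT; apply | apply: F3v].
  - move=> w hw; split; first exact: hg3.
    by have [_ _ _ ->] := exE _ _ _ (leq0n dd) (leq0n dd) hw; rewrite mulnC.
  - by move=> z' /sub3; apply: rel3.
  move=> w z' lt; apply: big1 => y _; rewrite [g2 _ _ _]big1 ?mul0r // => x _.
  by rewrite /g1 C3 // !mul0r.
have g2v z : c 1%N z -> g2 k0 j0 z = 0.
  apply: (lowest_coef_vanishes (D := fun w => ex 0%N w k0) (E :=
    ex 0%N 0%N k0) irr2 hf2 _ _ _ _ j0d).
  - by exists w2.
  - by move=> z' cz; split; [have [+ _] := incl 1%N isT; apply | apply: F2v].
  - move=> w hw; split; first exact: hg2.
    by have [_ _ -> _] := exE _ _ _ (leq0n dd) hw k0d; rewrite mulnC.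
  - exact: g3v.
  move=> w z' lt; apply: big1 => x _; by rewrite /g1 C2 // !mul0r.
have : g1 k0 j0 i0 z0 = 0.
  apply: (lowest_coef_vanishes (D := fun w => ex w j0 k0) (E :=
    ex 0%N j0 k0) irr1 hf1 _ _ _ _ i0d _ cz0).
  - by exists w1.
  - by move=> z' cz; split; [have [+ _] := incl 0%N isT; apply | apply: F1v].
  - move=> w hw; split => //.
    by have [_ -> _ _] := exE _ _ _ hw j0d k0d; rewrite mulnC.
  - exact: g2v.
  by move=> w z' lt; rewrite /g1 C1 // mul0r.
move/eqP; rewrite /g1 mulf_eq0 (negPf Ci0) /= expf_eq0 /f mevalXU.
by rewrite (negPf F0z) andbF.
Qed.

End Dimension.

(** * Minors and Plücker coordinates *)

Section Minors.
Variables (K : fieldType) (k m : nat).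

Lemma ksub_nthP (S : ksub k m) i : i \in val S -> exists j, ksub_nth S j = i.
Proof.
move=> iS; exists (cast_ord (eqP (valP S)) (enum_rank_in iS i)).
rewrite /ksub_nth cast_ord_comp.
by rewrite (_ : cast_ord _ _ = enum_rank_in iS i) ?enum_rankK_in //; apply/val_inj.
Qed.

(** The columns [f] differ from the increasing enumeration of [S] by a
    permutation. *)
Lemma minor_sign (S : ksub k m) (f : 'I_k -> 'I_m) :
  injective f -> (forall j, f j \in val S) ->
  exists b : bool, forall B : 'M[K]_(k, m),
    \det (colsub f B) = (-1) ^+ b * \det (colsub (ksub_nth S) B).
Proof.
move=> finj fS.
have [s hs] := choice (fun j => ksub_nthP (fS j)).
have sinj : injective s by move=> i j e; apply: finj; rewrite -!hs e.
exists (perm sinj) => B.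
rewrite (_ : colsub f B = col_perm (perm sinj) (colsub (ksub_nth S) B)).
  by rewrite col_permE det_mulmx det_perm odd_permV mulrC.
by apply/matrixP => i j; rewrite !mxE permE hs.
Qed.

Lemma minor_not_inj (f : 'I_k -> 'I_m) (B : 'M[K]_(k, m)) :
  ~ injective f -> \det (colsub f B) = 0.
Proof.
move=> ninj; rewrite -det_tr.
have /injectivePn[i [j ij e]] : ~~ injectiveb f by apply/injectiveP.
by apply: (determinant_alternate ij) => l; rewrite !mxE e.
Qed.

Lemma hform_minor (f : 'I_k -> 'I_m) :
  hform plrow 1 (fun z : Gr K k m => \det (colsub f (basis_mx z))).
Proof.
have [finj|ninj] := pselect (injective f); last first.
  by apply: hform_eq (hform0 _ 1) => z; rewrite minor_not_inj.
have cS : #|[set f i | i : 'I_k]%SET| == k by rewrite card_imset ?card_ord.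
pose S : ksub k m := exist _ [set f i | i : 'I_k]%SET cS.
have [|b hb] := @minor_sign S f finj; first by move=> j; apply: imset_f.
apply: hform_eq (hformZ ((-1) ^+ b) (hform_coord plrow (enum_rank S))) => z.
by rewrite hb mxE enum_rankK.
Qed.

Lemma plrow_neq0 (z : Gr K k m) : exists i, plrow z 0 i != 0.
Proof.
by apply/rV0Pn; have := plucker_subproof z; rewrite dim_vline eqb1.
Qed.

Lemma mem_basis_mx (z : Gr K k m) u : u \in val z -> exists c, u = c *m basis_mx z.
Proof.
move=> uz; exists (\row_i coord (vbasis (val z)) (cast_ord (esym (eqP (valP z))) i) u).
rewrite mulmx_sum_row [LHS](coord_vbasis uz) (reindex (cast_ord (esym (eqP (valP z))))) /=.
  by apply: eq_bigr => i _; rewrite rowK mxE.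
by exists (cast_ord (eqP (valP z))) => i _; apply/val_inj.
Qed.

End Minors.

Section Codim2.
Variables (K : fieldType) (r : nat).
Local Notation m := (r.+3).
Implicit Types (z : Gr K r.+1 m) (u v w : 'rV[K]_m) (x y : nat -> K).

(** The alternating form [v, w |-> v /\ w /\ z]. It gives access to the Plücker
    coordinates of [z] in terms of its two equations. *)
Definition lform z v w : K := \det (col_mx v (col_mx w (basis_mx z)) : 'M_m).

Lemma expand_det_top p (u : 'rV[K]_p.+1) (M : 'M[K]_(p, p.+1)) :
  \det (col_mx u M : 'M_p.+1) = \sum_j u 0 j * ((-1) ^+ j * \det (col' j M)).
Proof.
rewrite (expand_det_row _ ord0); apply: eq_bigr => j _.
rewrite /cofactor add0n mxE; case: splitP => [i _|//]; rewrite ord1; do 2 congr (_ * _).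
congr (\det _); apply/matrixP => a b; rewrite !mxE.
case: splitP => a'; rewrite /= /bump /=; first by rewrite ord1.
by move=> /addnI/val_inj->.
Qed.

Lemma lformE z v w : lform z v w = \sum_j v 0 j * ((-1) ^+ j *
  \sum_j' w 0 (lift j j') * ((-1) ^+ j' * \det (colsub (lift j \o lift j') (basis_mx z)))).
Proof.
rewrite /lform expand_det_top; apply: eq_bigr => j _; do 2 congr (_ * _).
have -> : col' j (col_mx w (basis_mx z)) = col_mx (col' j w) (col' j (basis_mx z)).
  by apply/matrixP => a b; rewrite !mxE; case: splitP => c _; rewrite !mxE.
apply: etrans (@expand_det_top r.+1 _ _) _; apply: eq_bigr => j' _; rewrite mxE;
  do 2 congr (_ * _).
by congr (\det _); apply/matrixP => a b; rewrite !mxE.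
Qed.

Lemma hform_lform v w : hform plrow 1 (fun z => lform z v w).
Proof.
apply: (hform_eq (fun z => esym (lformE z v w))).
apply: hform_sum => j _; do 2 apply: hformZ.
apply: hform_sum => j' _; do 2 apply: hformZ; exact: hform_minor.
Qed.

(** The two vectors are those of the standard basis that are missing among the
    columns of the minor. *)
Lemma plrow_lform i : exists j1 j2 : 'I_m, exists eps : K,
  forall z, plrow z 0 i = eps * lform z (delta_mx 0 j1) (delta_mx 0 j2).
Proof.
pose S : ksub r.+1 m := enum_val i.
have cC : #|~: (val S)| = 2 by rewrite cardsCs finset.setCK (eqP (valP S)) card_ord; lia.
have /card_gt0P[j jS] : (0 < #|~: (val S)|)%N by rewrite cC.
have /card_gt0P[j2] : (0 < #|(~: (val S)) :\ j|)%N by move: cC; rewrite (cardsD1 j) jS; lia.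
rewrite !inE => /andP[j2j j2S].
have /unlift_some[j' ej' _] : j != j2 by rewrite eq_sym.
have finj : injective (lift j \o lift j') by move=> a b /lift_inj/lift_inj.
have fS a : (lift j \o lift j') a \in val S.
  apply: contraTT isT => aS /=; set x := _ a in aS.
  have : x |: [set j; j2] \subset ~: (val S).
    apply/fintype.subsetP => b; rewrite !inE => /or3P[] /eqP-> //; by rewrite inE in jS.
  move=> /subset_leq_card; rewrite cC cardsU1 cards2 !inE negb_or.
  rewrite eq_sym neq_lift ej' (inj_eq (lift_inj (h:=j))) eq_sym neq_lift.
  by rewrite neq_lift.
have [b hb] := minor_sign K finj fS.
exists j, j2, ((-1) ^+ b * (-1) ^+ j' * (-1) ^+ j) => z.
rewrite lformE (bigD1 j) //= [X in _ + X]big1 ?addr0 => [|l lj]; last first.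
  by rewrite mxE eqxx (negPf lj) mul0r.
rewrite (bigD1 j') //= [X in _ + X]big1 ?addr0 => [|l lj]; last first.
  by rewrite mxE eqxx ej' (inj_eq (lift_inj (h:=j))) (negPf lj) mul0r.
by rewrite !mxE ej' !eqxx !mul1r hb -!mulrA !signrMK.
Qed.

Lemma lformDl z v v' w a : lform z (v + a *: v') w = lform z v w + a * lform z v' w.
Proof.
rewrite !lformE mulr_sumr -big_split /=; apply: eq_bigr => j _.
by rewrite !mxE mulrDl mulrA.
Qed.

Lemma lform_eq0 z v w (t1 t2 : 'M[K]_1) (t : 'rV[K]_r.+1) : row_mx t1 (row_mx t2 t) != 0 ->
  t1 *m v + (t2 *m w + t *m basis_mx z) = 0 -> lform z v w = 0.
Proof.
move=> t0 tE; apply/eqP/det0P; exists (row_mx t1 (row_mx t2 t)) => //.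
rewrite -[RHS]tE -mul_row_col; exact: (@mul_row_col _ _ _ _ _ t1 (row_mx t2 t) v).
Qed.

Lemma lform_memr z v w : w \in val z -> lform z v w = 0.
Proof.
move=> /mem_basis_mx[c ->]; apply: (@lform_eq0 _ _ _ 0 1%:M (- c)).
  apply/eqP => /(congr1 (fun M : 'rV_(1 + (1 + _)) => lsubmx (rsubmx M))).
  rewrite row_mxKr row_mxKl !linear0 => /matrixP/(_ 0 0) /eqP.
  by rewrite !mxE oner_eq0.
by rewrite mul0mx add0r mul1mx mulNmx subrr.
Qed.

Lemma lformxx z v : lform z v v = 0.
Proof.
apply: (@lform_eq0 _ _ _ 1%:M (- 1%:M) 0).
  apply/eqP => /(congr1 (fun M : 'rV_(1 + (1 + _)) => lsubmx M)).
  rewrite row_mxKl !linear0 => /matrixP/(_ 0 0) /eqP.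
  by rewrite !mxE oner_eq0.
by rewrite mul0mx addr0 mul1mx mulNmx mul1mx subrr.
Qed.

Lemma lformDr z v w w' a : lform z v (w + a *: w') = lform z v w + a * lform z v w'.
Proof.
rewrite !lformE mulr_sumr -big_split /=; apply: eq_bigr => j _.
rewrite (_ : \sum_j' (w + a *: w') 0 (lift j j') * _ = \sum_j' w 0 (lift j j') *
  ((-1) ^+ j' * \det (colsub (lift j \o lift j') (basis_mx z))) + a * \sum_j' w' 0 (lift j
    j') *
  ((-1) ^+ j' * \det (colsub (lift j \o lift j') (basis_mx z)))); first by ring.
rewrite mulr_sumr -big_split; apply: eq_bigr => j' _ /=.
by rewrite !mxE mulrDl mulrA.
Qed.

Lemma lformC z v w : lform z v w = - lform z w v.
Proof.
have := lformxx z (v + 1 *: w); rewrite lformDl !lformDr !lformxx !mul1r addr0 add0r.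
by move/eqP; rewrite addr_eq0 => /eqP.
Qed.

Lemma lform_meml z v w : v \in val z -> lform z v w = 0.
Proof. by move=> vz; rewrite lformC lform_memr ?oppr0. Qed.

(** The coefficients of linear forms are indexed by [nat], since most of those
    in use are defined by formulas in the index. *)
Definition dot v x : K := \sum_(i < m) v 0 i * x i.

Definition ann_mx x y : 'M[K]_(m, 2) := \matrix_(i, j) if j == ord0 then x i else y i.

Definition ann_map x y : 'Hom('rV[K]_m, 'rV[K]_2) := linfun (mulmxr (ann_mx x y)).

Definition ann x y : {vspace 'rV[K]_m} := lker (ann_map x y).

Definition indep x y : Prop :=
  forall al be, (forall i, (i < m)%N -> al * x i + be * y i = 0) -> al = 0 /\ be = 0.

Lemma mem_ann v x y : (v \in ann x y) = (dot v x == 0) && (dot v y == 0).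
Proof.
rewrite memv_ker lfunE /=; apply/eqP/andP => [/rowP h | [/eqP vx /eqP vy]].
  split; apply/eqP.
    by have := h ord0; rewrite !mxE => e; rewrite -[RHS]e; apply: eq_bigr => i _; rewrite mxE.
  by have := h ord_max; rewrite !mxE => e; rewrite -[RHS]e; apply: eq_bigr => i _; rewrite mxE.
apply/rowP => j; rewrite !mxE; case: (eqVneq j ord0) => j0.
  by rewrite -[RHS]vx; apply: eq_bigr => i _; rewrite mxE j0.
by rewrite -[RHS]vy; apply: eq_bigr => i _; rewrite mxE (negPf j0).
Qed.

Lemma indep_full x y : indep x y -> exists B : 'M_(2, m), B *m ann_mx x y = 1%:M.
Proof.
move=> ind; apply/row_fullP; rewrite /row_full -mxrank_tr.
apply: inj_row_free => t /rowP h.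
have [i|e0 e1] := ind (t 0 ord0) (t 0 ord_max).
  move=> im; have := h (Ordinal im); rewrite !mxE big_ord_recl big_ord1 !mxE /=.
  by rewrite (_ : lift _ _ = ord_max) //; apply/val_inj.
apply/rowP => j; rewrite mxE; case: (eqVneq j ord0) => [->//|j0].
by rewrite (_ : j = ord_max) //; apply/val_inj; case: j j0 => -[|[|//]].
Qed.

Lemma dim_ann x y : indep x y -> \dim (ann x y) == r.+1.
Proof.
move=> /indep_full[B hB].
have := limg_ker_dim (ann_map x y) fullv.
have -> : limg (ann_map x y) = fullv.
  apply/eqP; rewrite eqEsubv subvf /=; apply/subvP => w _.
  apply/memv_imgP; exists (w *m B); first exact: memvf.
  by rewrite lfunE /= -mulmxA hB mulmx1.
rewrite capfv -/(ann x y) !dimvf !dim_matrix => h.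
have {}h : (\dim (ann x y) + 1 * 2 = 1 * m)%N := h.
apply/eqP; lia.
Qed.

Definition annGr x y (ind : indep x y) : Gr K r.+1 m :=
  exist (fun U : {vspace 'rV[K]_m} => \dim U == r.+1) (ann x y) (dim_ann ind).

Lemma lform_neq0 z : exists v, exists w, lform z v w != 0.
Proof.
have [i zi] := plrow_neq0 z; have [j1 [j2 [eps h]]] := plrow_lform i.
exists (delta_mx 0 j1), (delta_mx 0 j2); apply: contraNneq zi => e.
by rewrite h e mulr0.
Qed.

Lemma dot_delta (i : 'I_m) x : dot (delta_mx 0 i) x = x i.
Proof.
rewrite /dot (bigD1 i) //= big1 ?addr0 ?mxE ?eqxx ?mul1r // => j ji.
by rewrite mxE (negPf ji) andbF mul0r.
Qed.

(** Both sides are alternating forms on the quotient by [z], which has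
    dimension 2. *)
Lemma lform_ann z x y : indep x y -> val z = ann x y ->
  exists2 lam, lam != 0 & forall v w,
    lform z v w = lam * (dot v x * dot w y - dot v y * dot w x).
Proof.
move=> ind zE; have [B hB] := indep_full ind.
pose v1 := row ord0 B; pose v2 := row ord_max B.
have dotB (i j : 'I_2) : dot (row i B) (if j == ord0 then x else y) = (i == j)%:R.
  have := congr1 (fun M : 'M_2 => M i j) hB; rewrite !mxE => <-.
  by apply: eq_bigr => l _; rewrite !mxE; case: eqP.
have res v : exists2 u, u \in val z & v = u + dot v x *: v1 + dot v y *: v2.
  exists (v - dot v x *: v1 - dot v y *: v2); last by rewrite [X in X + _]addrAC !subrK.
  have dotD w w' a t : dot (w - a *: w') t = dot w t - a * dot w' t.
    by rewrite /dot mulr_sumr -sumrB; apply: eq_bigr => i _; rewrite !mxE mulrBl mulrA.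
  rewrite zE mem_ann !dotD (dotB ord0 ord0) (dotB ord_max ord0) (dotB ord0 ord_max) (dotB
    ord_max ord_max).
  by rewrite /= !mulr1 !mulr0 !subr0 !subrr eqxx.
have lE t w : lform z t w = lform z v1 v2 * (dot t x * dot w y - dot t y * dot w x).
  have [u uz vE] := res t; have [u' uz' wE] := res w.
  have el t' : lform z t' w = dot w x * lform z t' v1 + dot w y * lform z t' v2.
    by rewrite {1}wE !lformDr lform_memr // add0r.
  rewrite {1}vE !lformDl lform_meml // add0r !el !lformxx [lform z v2 v1]lformC; ring.
exists (lform z v1 v2) => //.
have [v [w]] := lform_neq0 z; apply: contraNneq => e.
by rewrite lE e mul0r.
Qed.

(** If [lform z v w != 0], the forms [lform z _ w] and [lform z v _] are
    independent and vanish on [z]. *)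
Lemma ann_exists z : exists x y, indep x y /\ val z = ann x y.
Proof.
have [v [w vw]] := lform_neq0 z.
pose x i := if insub i is Some j then lform z (delta_mx 0 (j : 'I_m)) w else 0.
pose y i := if insub i is Some j then lform z v (delta_mx 0 (j : 'I_m)) else 0.
have xE i : x (nat_of_ord i) = lform z (delta_mx 0 i) w by rewrite /x valK.
have yE i : y (nat_of_ord i) = lform z v (delta_mx 0 i) by rewrite /y valK.
have dx u : dot u x = lform z u w.
  rewrite {2}[u]row_sum_delta /dot.
  apply: (big_ind2 (fun a t => a = lform z t w)).
  - by rewrite lform_meml ?mem0v.
  - by move=> a t a' t' -> ->; have := lformDl z t t' w 1; rewrite scale1r mul1r.
  by move=> i _; rewrite xE -[_ *: _]add0r lformDl (lform_meml w (mem0v (val z))) add0r.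
have dy u : dot u y = lform z v u.
  rewrite {2}[u]row_sum_delta /dot.
  apply: (big_ind2 (fun a t => a = lform z v t)).
  - by rewrite lform_memr ?mem0v.
  - by move=> a t a' t' -> ->; have := lformDr z v t t' 1; rewrite scale1r mul1r.
  by move=> i _; rewrite yE -[_ *: _]add0r lformDr (lform_memr v (mem0v (val z))) add0r.
have ind : indep x y.
  move=> al be h; have dot_lin u : al * dot u x + be * dot u y = 0.
    rewrite /dot !mulr_sumr -big_split big1 //= => i _.
    by rewrite mulrCA [be * _]mulrCA -mulrDr h ?mulr0.
  have := dot_lin v; have := dot_lin w; rewrite !dx !dy !lformxx !mulr0 addr0 add0r.
  by move=> /eqP + /eqP; rewrite !mulf_eq0 !(negPf vw) !orbF => /eqP-> /eqP->.
exists x, y; split=> //; apply/eqP;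
  rewrite eqEdim (eqP (valP z)) (eqP (dim_ann ind)) leqnn andbT.
by apply/subvP => u uz; rewrite mem_ann dx dy lform_meml // lform_memr // eqxx.
Qed.

Lemma lform_memP z u : u \in val z <-> forall w, lform z u w = 0.
Proof.
split=> [uz w|h]; first exact: lform_meml.
have [x [y [ind zE]]] := ann_exists z; have [lam l0 lE] := lform_ann ind zE.
have [B hB] := indep_full ind.
have dB (i j : 'I_2) : dot (row i B) (if j == ord0 then x else y) = (i == j)%:R.
  have := congr1 (fun M : 'M_2 => M i j) hB; rewrite !mxE => <-.
  by apply: eq_bigr => l _; rewrite !mxE; case: eqP.
have := h (row ord0 B); have := h (row ord_max B); rewrite zE mem_ann !lE.
rewrite (dB ord0 ord0) (dB ord_max ord0) (dB ord0 ord_max) (dB ord_max ord_max) /=.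
rewrite !mulr1 !mulr0 subr0 sub0r => /eqP; rewrite mulf_eq0 (negPf l0) /= => ->.
by move=> /eqP; rewrite mulf_eq0 (negPf l0) oppr_eq0.
Qed.

Lemma hform_closed_eq z0 : hform_closed plrow [set z | z = z0].
Proof.
exists ({u | u \in val z0} * 'rV[K]_m)%type, (fun uw z => lform z (sval uw.1) uw.2).
split=> [uw|z /=]; first by exists 1%N; apply: hform_lform.
split=> [-> [[u uz] w]|h]; first exact: lform_meml.
apply/esym/val_inj/eqP; rewrite eqEdim (eqP (valP z)) (eqP (valP z0)) leqnn andbT.
apply/subvP => u uz; apply/lform_memP => w; exact: (h (exist _ u uz, w)).
Qed.

End Codim2.

(** * The family of subspaces *)

Definition bform {R : comNzRingType} (d : nat) (f : nat -> R) (s t : R) : R :=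
  \sum_(i < d.+1) f i * s ^+ i * t ^+ (d - i).

Section Family.
Variables (R : comNzRingType) (a b : nat).
Implicit Types s t u v : R.

(** The coefficient of s^i t^(a-i) in the [k]-th component of [qvec1]. Components
    0 to 3 of the two vectors are (t^a, 0, s^a, 0) and (0, s^b, 0, t^b); together
    with [pvec] these already give independent vectors. Components 4, ..., 3+a are
    the monomials of [qvec1] other than s^a, and components 4+a, ..., 3+a+b those
    of [qvec2] other than t^b. In K^(r+3) only the first r+3 components count. *)
Definition qcoef1 (k i : nat) : R :=
  (((k == 0) && (i == 0)) + ((k == 2) && (i == a)) + ((k == 4 + i) && (i < a)))%N%:R.

Definition qcoef2 (k j : nat) : R :=
  (((k == 1) && (j == b)) + ((k == 3) && (j == 0)) + ((k == 3 + a + j) && (0 < j)))%N%:R.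

Definition pvec s t (k : nat) : R := s * (k == 0)%:R + t * (k == 1)%:R.

Definition qvec1 s t (k : nat) : R := bform a (qcoef1 k) s t.

Definition qvec2 s t (k : nat) : R := bform b (qcoef2 k) s t.

Definition wvec s t u v (k : nat) : R := u * qvec1 s t k + v * qvec2 s t k.

Lemma bform_delta d (f : nat -> R) i0 s t : (i0 <= d)%N ->
  (forall i, f i = (i == i0)%:R) -> bform d f s t = s ^+ i0 * t ^+ (d - i0).
Proof.
rewrite -ltnS => lt hf; rewrite /bform (bigD1 (Ordinal lt)) //= big1 ?addr0.
  by rewrite hf eqxx mul1r.
by move=> i ii0; rewrite hf (negPf (ii0 : i != i0 :> nat)) !mul0r.
Qed.

Lemma bform0 d (f : nat -> R) s t : (forall i, f i = 0) -> bform d f s t = 0.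
Proof. by move=> hf; rewrite /bform big1 // => i _; rewrite hf !mul0r. Qed.

Lemma qvec1_0 s t : qvec1 s t 0 = t ^+ a.
Proof.
rewrite /qvec1 (@bform_delta _ _ 0) ?mul1r ?subn0 // => i.
by rewrite /qcoef1 /= !addn0.
Qed.

Lemma qvec1_1 s t : qvec1 s t 1 = 0.
Proof. by rewrite /qvec1 bform0. Qed.

Lemma qvec1_2 s t : qvec1 s t 2 = s ^+ a.
Proof.
rewrite /qvec1 (@bform_delta _ _ a) ?subnn ?mulr1 // => i.
by rewrite /qcoef1 /= addn0.
Qed.

Lemma qvec1_3 s t : qvec1 s t 3 = 0.
Proof. by rewrite /qvec1 bform0. Qed.

Lemma qvec2_0 s t : qvec2 s t 0 = 0.
Proof. by rewrite /qvec2 bform0. Qed.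

Lemma qvec2_1 s t : qvec2 s t 1 = s ^+ b.
Proof.
rewrite /qvec2 (@bform_delta _ _ b) ?subnn ?mulr1 // => i.
by rewrite /qcoef2 /= !addn0.
Qed.

Lemma qvec2_2 s t : qvec2 s t 2 = 0.
Proof. by rewrite /qvec2 bform0. Qed.

Lemma qvec2_3 s t : qvec2 s t 3 = t ^+ b.
Proof.
rewrite /qvec2 (@bform_delta _ _ 0) ?mul1r ?subn0 // => i.
rewrite /qcoef2 /= add0n (_ : (3 == 3 + a + i) && (0 < i) = false)%N ?addn0 //.
by apply/negP => /andP[/eqP]; lia.
Qed.

Lemma pvec_ge2 s t k : (1 < k)%N -> pvec s t k = 0.
Proof. by case: k => [|[|k]] //= _; rewrite /pvec !mulr0 addr0. Qed.

Lemma pvec_0 s t : pvec s t 0 = s.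
Proof. by rewrite /pvec mulr1 mulr0 addr0. Qed.

Lemma pvec_1 s t : pvec s t 1 = t.
Proof. by rewrite /pvec mulr1 mulr0 add0r. Qed.

Lemma bform_scale d (f : nat -> R) c s t :
  bform d f (c * s) (c * t) = c ^+ d * bform d f s t.
Proof.
rewrite /bform mulr_sumr; apply: eq_bigr => i _.
rewrite !exprMn -[in c ^+ d](subnKC (ltn_ord i : (i <= d)%N)) exprD; ring.
Qed.

End Family.

Lemma rmorph_bform (R S : comNzRingType) (h : {rmorphism R -> S}) d f s t :
  h (bform d f s t) = bform d (fun i => h (f i)) (h s) (h t).
Proof.
rewrite /bform rmorph_sum; apply: eq_bigr => i _.
by rewrite !rmorphM !rmorphXn.
Qed.

Lemma rmorph_wvec (R S : comNzRingType) (h : {rmorphism R -> S}) a b s t u v k :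
  h (wvec a b s t u v k) = wvec a b (h s) (h t) (h u) (h v) k.
Proof.
rewrite /wvec rmorphD !rmorphM !rmorph_bform; congr (_ * _ + _ * _);
by apply: eq_bigr => i _; rewrite rmorph_nat.
Qed.

Lemma rmorph_pvec (R S : comNzRingType) (h : {rmorphism R -> S}) s t k :
  h (pvec s t k) = pvec (h s) (h t) k.
Proof. by rewrite /pvec rmorphD !rmorphM !rmorph_nat. Qed.

Lemma hform_bform (K : fieldType) T N (rho : T -> 'rV[K]_N) d (f : nat -> K) (S U : T -> K) :
  hform rho 1 S -> hform rho 1 U -> hform rho d (fun z => bform d f (S z) (U z)).
Proof.
move=> hS hU; rewrite /bform; apply: hform_sum => i _.
have := hformM (hformZ (f i) (hformX i hS)) (hformX (d - i) hU).
by rewrite !mul1n subnKC // -ltnS.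
Qed.

Section Independence.
Variables (K : fieldType) (a b : nat).

(** Components 2 and 3 give u s^a = 0 and v t^b = 0; components 0 and 1 settle
    the points s = 0 and t = 0. *)
Lemma pq_indep (s t al u v : K) :
  (s != 0) || (t != 0) ->
  (forall k, (k < 4)%N -> al * pvec s t k + wvec a b s t u v k = 0) ->
  [/\ al = 0, u = 0 & v = 0].
Proof.
move=> st h.
have h0 := h 0%N isT; have h1 := h 1%N isT; have h2 := h 2%N isT; have h3 := h 3%N isT.
move: h0 h1 h2 h3; rewrite /wvec pvec_0 pvec_1 !pvec_ge2 // !mulr0 !add0r.
rewrite qvec1_0 qvec1_1 qvec1_2 qvec1_3 qvec2_0 qvec2_1 qvec2_2 qvec2_3.
rewrite !mulr0 ?addr0 ?add0r => h0 h1 /eqP h2 /eqP h3.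
have [s0|s0] := eqVneq s 0.
  rewrite s0 eqxx /= in st; move: h3;
    rewrite mulf_eq0 expf_eq0 (negPf st) andbF orbF => /eqP v0.
  move: h0; rewrite s0 mulr0 add0r => /eqP;
    rewrite mulf_eq0 expf_eq0 (negPf st) andbF orbF => /eqP u0.
  by move: h1; rewrite v0 mul0r addr0 => /eqP;
    rewrite mulf_eq0 (negPf st) orbF => /eqP al0; split.
move: h2; rewrite mulf_eq0 expf_eq0 (negPf s0) andbF orbF => /eqP u0.
move: h0; rewrite u0 mul0r addr0 => /eqP; rewrite mulf_eq0 (negPf s0) orbF => /eqP al0.
move: h1; rewrite al0 mul0r add0r => /eqP;
  rewrite mulf_eq0 expf_eq0 (negPf s0) andbF orbF => /eqP v0.
by split.
Qed.

End Independence.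

Section Congruence.
Variables (K : numClosedFieldType) (a e r : nat).
Hypothesis r0 : (0 < r)%N.
Let b := (a + e)%N.
Local Notation m := (r.+3).

Lemma m4 k : (k < 4)%N -> (k < m)%N.
Proof. by move=> k4; apply: leq_trans k4 _; rewrite !ltnS. Qed.

Definition pcol (c : 'rV[K]_(2 + 2)) := pvec (c 0 is_) (c 0 it_).
Definition wcolumn (c : 'rV[K]_(2 + 2)) := wvec a b (c 0 is_) (c 0 it_) (c 0 iu_) (c 0 iv_).

Local Notation wcol := wcolumn.

Definition mkc (s t u v : K) : 'rV[K]_(2 + 2) :=
  \row_i [:: s; t; u; v]`_i.

Lemma Xe_coordE (c : 'rV[K]_(2 + 2)) : Xe_coord c =
  ((c 0 is_ != 0) || (c 0 it_ != 0)) && ((c 0 iu_ != 0) || (c 0 iv_ != 0)).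
Proof.
have rv2 (x : 'rV[K]_2) : (x != 0) = (x 0 ord0 != 0) || (x 0 ord_max != 0).
  apply/rV0Pn/orP => [ [i +] | [h|h] ]; [|by exists ord0|by exists ord_max].
  have [->|i0] := eqVneq i ord0; first by left.
  suff -> : i = ord_max by right.
  by apply/val_inj; case: i i0 => -[|[|]].
by rewrite /Xe_coord !rv2 !mxE.
Qed.

Lemma mkcE s t u v :
  [/\ mkc s t u v 0 is_ = s, mkc s t u v 0 it_ = t,
    mkc s t u v 0 iu_ = u & mkc s t u v 0 iv_ = v].
Proof.
by split; rewrite mxE.
Qed.

Lemma indep_c c : Xe_coord c -> indep r (pcol c) (wcol c).
Proof.
rewrite Xe_coordE => /andP[st uv] al be h.
have [k k4|al0 u0 v0] := @pq_indep K a b (c 0 is_) (c 0 it_) al (be * c 0 iu_) (be * c 0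
  iv_) st.
  by have <- := h k (m4 k4); rewrite /wcol /pcol /wvec; ring.
split => //; apply/eqP; move/eqP: u0; move/eqP: v0; rewrite !mulf_eq0.
by case/orP=> // /eqP v0; case/orP=> // /eqP u0; rewrite u0 v0 !eqxx in uv.
Qed.

(** The members of the congruence: the equations of [z] form a line in the pencil
    of centre [pvec] in the plane spanned by [pvec], [qvec1] and [qvec2]. *)
Definition Sigma : set (Gr K r.+1 m) :=
  [set z | exists2 c, Xe_coord c & val z = ann r (pcol c) (wcol c)].

Lemma Sigma_mem c : Xe_coord c -> exists2 z, Sigma z & val z = ann r (pcol c) (wcol c).
Proof. by move=> hc; exists (annGr (indep_c hc)) => //; exists c. Qed.

Lemma lform_Sigma z c : Xe_coord c -> val z = ann r (pcol c) (wcol c) ->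
  exists2 lam, lam != 0 & forall i j : 'I_m,
    lform z (delta_mx 0 i) (delta_mx 0 j) = lam * (pcol c i * wcol c j - wcol c i * pcol c j).
Proof.
move=> hc zE; have [lam l0 h] := lform_ann (indep_c hc) zE.
by exists lam => // i j; rewrite h !dot_delta.
Qed.

End Congruence.

(** * The parametrization in Plücker coordinates *)

Section Param.
Variables (K : numClosedFieldType) (a e r : nat).
Hypothesis r0 : (0 < r)%N.
Let b := (a + e)%N.
Local Notation m := (r.+3).
Local Notation Sg := (@Sigma K a e r).
Local Notation wcol := (@wcolumn K a e).

Lemma Xe_section_nat (n : nat) : Xe_section e 0 0 (n%:R : {mpoly K[2 + 2]}).
Proof. by rewrite -(rmorph_nat (@mpolyC (2 + 2) K)); exact: Xe_sectionC. Qed.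

Lemma Xe_sectionX (l : 'I_(2 + 2)) i j :
  ((l == iu_) + (l == iv_) = i)%N -> ((l == is_) + (l == it_) + e * (l == iu_) = j)%N ->
  Xe_section e i j ('X_l : {mpoly K[2 + 2]}).
Proof.
rewrite Xe_sectionE => hi hj mu; rewrite msuppX inE => /eqP->.
by rewrite !mnm1E.
Qed.

Lemma Xe_section_bform d (f : nat -> nat) :
  Xe_section e 0 d (bform d (fun i => (f i)%:R) 'X_is_ 'X_it_ : {mpoly K[2 + 2]}).
Proof.
rewrite /bform; apply: Xe_section_sum => i _.
have s1 : Xe_section e 0 1 ('X_is_ : {mpoly K[2 + 2]}) by apply: Xe_sectionX;
  rewrite /= ?muln0.
have t1 : Xe_section e 0 1 ('X_it_ : {mpoly K[2 + 2]}) by apply: Xe_sectionX;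
  rewrite /= ?muln0.
have := Xe_sectionM (Xe_sectionM (@Xe_section_nat (f i)) (@Xe_sectionXn K e 0 1 _ i s1))
  (@Xe_sectionXn K e 0 1 _ (d - i) t1).
by rewrite !muln0 !muln1 !add0n subnKC // -ltnS.
Qed.

Lemma Xe_section_pvec k : Xe_section e 0 1 (pvec 'X_is_ 'X_it_ k : {mpoly K[2 + 2]}).
Proof.
have s1 : Xe_section e 0 1 ('X_is_ : {mpoly K[2 + 2]}) by apply: Xe_sectionX;
  rewrite /= ?muln0.
have t1 : Xe_section e 0 1 ('X_it_ : {mpoly K[2 + 2]}) by apply: Xe_sectionX;
  rewrite /= ?muln0.
rewrite /pvec; apply: Xe_sectionD.
  by have := Xe_sectionM s1 (@Xe_section_nat (k == 0%N)).
by have := Xe_sectionM t1 (@Xe_section_nat (k == 1%N)).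
Qed.

Lemma Xe_section_wvec k :
  Xe_section e 1 b (wvec a b 'X_is_ 'X_it_ 'X_iu_ 'X_iv_ k : {mpoly K[2 + 2]}).
Proof.
have u1 : Xe_section e 1 e ('X_iu_ : {mpoly K[2 + 2]}) by apply: Xe_sectionX;
  rewrite //= muln1.
have v1 : Xe_section e 1 0 ('X_iv_ : {mpoly K[2 + 2]}) by apply: Xe_sectionX;
  rewrite //= muln0.
rewrite /wvec; apply: Xe_sectionD.
  by have := Xe_sectionM u1 (@Xe_section_bform a _); rewrite addnC [(e + a)%N]addnC; apply.
by have := Xe_sectionM v1 (@Xe_section_bform b _); rewrite addnC; apply.
Qed.

(** The Plücker coordinates are the 2x2 minors of the equations [pcol c] and
    [wcol c], whose entries are sections of O(F) and O(C_0 + b F). *)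
Lemma plucker_param : exists Dp : 'I_#|ksub r.+1 m| -> {mpoly K[2 + 2]},
  (forall i, Xe_section e 1 b.+1 (Dp i)) /\
  forall z c, Xe_coord c -> val z = ann r (pcol c) (wcol c) ->
    exists2 lam, lam != 0 & plrow z = lam *: eval_forms Dp c.
Proof.
have [J hJ] := choice (fun i => @plrow_lform K r i).
have [J2 hJ2] := choice hJ; have [eps heps] := choice hJ2.
pose P k : {mpoly K[2 + 2]} := pvec 'X_is_ 'X_it_ k.
pose W k : {mpoly K[2 + 2]} := wvec a b 'X_is_ 'X_it_ 'X_iu_ 'X_iv_ k.
exists (fun i => eps i *: (P (J i) * W (J2 i) - W (J i) * P (J2 i))); split=> [i|z c hc zE].
  have PW k l : Xe_section e 1 b.+1 (P k * W l).
    exact: (@Xe_sectionM K e 0 1 1 b _ _ (@Xe_section_pvec k) (@Xe_section_wvec l)).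
  apply: Xe_sectionZ; apply: Xe_sectionD => //.
  by rewrite -scaleN1r mulrC; apply: Xe_sectionZ.
have [lam l0 lE] := lform_Sigma r0 hc zE; exists lam => //.
apply/rowP => i; rewrite heps lE !mxE mevalZ mevalB !mevalM mulrCA /P /W.
by rewrite !rmorph_pvec !rmorph_wvec /= !mevalXU.
Qed.

Lemma Xe_coord_dense (c : 'rV[K]_(2 + 2)) :
  ('X_is_ * 'X_iu_ : {mpoly K[2 + 2]}).@[c 0] != 0 -> Xe_coord c.
Proof.
by rewrite mevalM !mevalXU Xe_coordE mulf_eq0 negb_or => /andP[-> ->].
Qed.

Lemma Sigma_irreducible : irreducible_set gr_closed Sg.
Proof.
have [Dp [hD DE]] := plucker_param.
apply: (@irreducible_param K _ _ _ _ Dp ('X_is_ * 'X_iu_) (mkc 1 0 1 0)).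
- by rewrite mevalM !mevalXU; have [-> _ -> _] := mkcE (1 : K) 0 1 0; rewrite mulr1 oner_eq0.
- move=> c /Xe_coord_dense hc; have [z Sz zE] := Sigma_mem a e r0 hc.
  by exists z; split => //; apply: DE.
by move=> z [c hc zE]; have [lam _ ->] := DE z c hc zE; exists c, lam.
Qed.

Lemma Sigma_no_chain3 : ~ irreducible_chain gr_closed Sg 3.
Proof.
have [Dp [hD DE]] := plucker_param.
apply: (not_irreducible_chain3 hD) => z [c hc zE].
by have [lam _ ->] := DE z c hc zE; exists c, lam.
Qed.

(** * Equations of the family *)

Definition dplk (z : Gr K r.+1 m) (i j : nat) : K :=
  lform z (delta_mx 0 (inord i)) (delta_mx 0 (inord j)).

Lemma dplk_ann z x y : indep r x y -> val z = ann r x y -> exists2 lam, lam != 0 &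
  forall i j, (i < m)%N -> (j < m)%N -> dplk z i j = lam * (x i * y j - y i * x j).
Proof.
move=> ind zE; have [lam l0 h] := lform_ann ind zE; exists lam => // i j im jm.
by rewrite /dplk h !dot_delta !inordK.
Qed.

Lemma dplk_Sigma z c : Xe_coord c -> val z = ann r (pcol c) (wcol c) -> exists2 lam, lam != 0 &
  forall i j, (i < m)%N -> (j < m)%N ->
    dplk z i j = lam * (pcol c i * wcol c j - wcol c i * pcol c j).
Proof. by move=> hc; apply: dplk_ann; apply: indep_c. Qed.

Lemma hform_dplk i j : hform plrow 1 (fun z => dplk z i j).
Proof. exact: hform_lform. Qed.

End Param.

Section Det3.
Variable R : comNzRingType.
Implicit Types x y z : nat -> R.

Definition det3 x y z i j k : R :=
  x i * (y j * z k - y k * z j) - x j * (y i * z k - y k * z i)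
  + x k * (y i * z j - y j * z i).

Lemma det3_scale (P : pred nat) c1 c2 x x' y z i j k :
  (forall l, P l -> c1 * x l = c2 * x' l) -> P i -> P j -> P k ->
  c1 * det3 x y z i j k = c2 * det3 x' y z i j k.
Proof.
move=> h Pi Pj Pk; rewrite /det3.
have e (u v w : R) : c1 * (x i * u - x j * v + x k * w) =
   (c1 * x i) * u - (c1 * x j) * v + (c1 * x k) * w by ring.
by rewrite e !h //; ring.
Qed.

End Det3.

Lemma cramer3 (K : fieldType) (x y z : nat -> K) i j :
  y i * z j - y j * z i != 0 ->
  exists u v, forall k, det3 x y z i j k = 0 -> x k = u * y k + v * z k.
Proof.
set D := _ - _ => D0.
exists ((x i * z j - x j * z i) / D), ((y i * x j - y j * x i) / D) => k h.
apply: (mulfI D0); rewrite mulrDr.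
transitivity (det3 x y z i j k + (x i * z j - x j * z i) * y k + (y i * x j - y j * x i) *
  z k).
  by rewrite /det3 /D; ring.
by rewrite h add0r; field.
Qed.

Section Hat.
Variable R : comNzRingType.

(** Coordinates modulo the vector [pvec s t]. *)
Definition hat (s t : R) (w : nat -> R) (i : nat) : R :=
  if (1 < i)%N then w i else t * w 0%N - s * w 1%N.

(** When [s] and [t] are forms of degree 1, the component 1 of [hat s t w] has
    degree one more than the components from 2 on. *)
Definition hdeg (i : nat) : nat := if (1 < i)%N then 0 else 1.

End Hat.

Section Closed.
Variables (K : numClosedFieldType) (a e r : nat).
Hypothesis r0 : (0 < r)%N.
Hypothesis rn : (r <= (a + (a + e)).+1)%N.
Let b := (a + e)%N.
Local Notation m := (r.+3).
Local Notation Sg := (@Sigma K a e r).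
Local Notation wcol := (@wcolumn K a e).

(* components in which t^a and s^b occur a second time when r is maximal *)
Let k1 := (if a == 0 then 2 else 4)%N.
Let k2 := (3 + a + b)%N.

Lemma qvec1_k1 (s t : K) : qvec1 a s t k1 = t ^+ a.
Proof.
rewrite /k1; case: (posnP a) => [->|a0]; first by rewrite qvec1_2.
rewrite /qvec1 (@bform_delta _ _ _ 0) ?mul1r ?subn0 // => i.
by rewrite /qcoef1; congr (_ %:R); lia.
Qed.

Lemma qvec2_k1 (s t : K) : qvec2 a b s t k1 = 0.
Proof.
rewrite /k1; case: (posnP a) => [->|a0]; first by rewrite qvec2_2.
by rewrite /qvec2 bform0 // => i; rewrite /qcoef2 (_ : (_ + _)%N = 0%N) //; lia.
Qed.

Lemma qvec1_k2 (s t : K) : qvec1 a s t k2 = 0.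
Proof.
by rewrite /qvec1 bform0 // => i; rewrite /qcoef1 /k2 /b [X in X%:R](_ : _ = 0%N) //; lia.
Qed.

Lemma qvec2_k2 (s t : K) : qvec2 a b s t k2 = s ^+ b.
Proof.
rewrite /qvec2 (@bform_delta _ _ _ b) ?subnn ?mulr1 // => i.
by rewrite /qcoef2 /k2 /b; congr (_ %:R); lia.
Qed.

(** Let l be the space of equations of [z]. The condition [point_eqs] says that
    l meets the span of the first two coordinate forms. If for some k >= 2
    the numbers S = dplk z 0 k and T = dplk z 1 k are not both zero, the
    intersection is spanned by [pvec S T], and [wedge z k d] is a multiple of
    the second generator of l modulo [pvec S T]. Then [span_eqs] says that l is
    contained in the span of [pvec], [qvec1] and [qvec2] at (S : T). If all these
    numbers vanish, l is spanned by the first two coordinate forms. This l is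
    a member at (s : t) = (1 : 0) if r < n, and has to be excluded by a linear
    equation if r = n. *)
Definition point_eqs (z : Gr K r.+1 m) : Prop :=
  forall i j, (1 < i < m)%N -> (1 < j < m)%N -> dplk z i j = 0.

Definition wedge (z : Gr K r.+1 m) (k : nat) (d : bool) (i : nat) : K :=
  if (1 < i)%N then dplk z d i else - (dplk z d k * dplk z 0 1).

Definition span_eqs (z : Gr K r.+1 m) : Prop :=
  forall k d i1 i2 i3, (1 < k < m)%N -> (0 < i1 < m)%N -> (0 < i2 < m)%N -> (0 < i3 < m)%N ->
  let S := dplk z 0 k in let T := dplk z 1 k in
  det3 (wedge z k d) (hat S T (qvec1 a S T)) (hat S T (qvec2 a b S T)) i1 i2 i3 = 0.

Definition linear_eqs (z : Gr K r.+1 m) : Prop :=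
  r = (a + b).+1 -> dplk z 0 1 = dplk z 0 k2 - dplk z 1 k1.

Lemma hform_hat d (w : nat -> Gr K r.+1 m -> K) (S T : Gr K r.+1 m -> K) i :
  hform plrow 1 S -> hform plrow 1 T -> (forall k, hform plrow d (w k)) ->
  hform plrow (d + hdeg i) (fun z => hat (S z) (T z) (fun k => w k z) i).
Proof.
move=> hS hT hw; rewrite /hat /hdeg; case: ifP => _; first by rewrite addn0.
by rewrite addnC; apply: hformB; apply: hformM.
Qed.

Lemma hform_det3 d1 d2 d3 (x y z : nat -> Gr K r.+1 m -> K) i j k :
  (forall i, hform plrow (d1 + hdeg i) (x i)) -> (forall i, hform plrow (d2 + hdeg i) (y i)) ->
  (forall i, hform plrow (d3 + hdeg i) (z i)) ->
  hform plrow (d1 + d2 + d3 + hdeg i + hdeg j + hdeg k)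
    (fun u => det3 (fun i => x i u) (fun i => y i u) (fun i => z i u) i j k).
Proof.
move=> hx hy hz; rewrite /det3.
have M i1 j1 l1 : hform plrow (d1 + hdeg i1 + (d2 + hdeg j1 + (d3 + hdeg l1)))
    (fun u => x i1 u * (y j1 u * z l1 u)) by apply: hformM => //; apply: hformM.
have M2 i1 j1 l1 : hform plrow (d1 + hdeg i1 + (d2 + hdeg j1 + (d3 + hdeg l1)))
    (fun u => x i1 u * (y j1 u * z l1 u - y l1 u * z j1 u)).
  have := M i1 l1 j1; rewrite (_ : (_ + _)%N = d1 + hdeg i1 + (d2 + hdeg j1 + (d3 + hdeg
    l1)))%N; last by lia.
  by move=> /(hformB (M i1 j1 l1)); apply: hform_eq => u; rewrite mulrBr.
apply: hformD; first apply: hformB.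
- by have := M2 i j k; congr hform; lia.
- by have := M2 j i k; congr hform; lia.
by have := M2 k i j; congr hform; lia.
Qed.

Lemma closed_point_eqs : hform_closed plrow point_eqs.
Proof.
exists (nat * nat)%type, (fun ij z =>
  if (1 < ij.1 < m)%N && (1 < ij.2 < m)%N then dplk z ij.1 ij.2 else 0).
split=> [[i j]|z] /=.
  by exists 1%N; case: (_ && _); [apply: hform_dplk | apply: hform0].
split=> [h [i j]|h i j hi hj] /=; first by case: ifP => // /andP[hi hj]; apply: h.
by have := h (i, j); rewrite /= hi hj.
Qed.

Lemma hform_wedge k d i : hform plrow (1 + hdeg i) (fun z => wedge z k d i).
Proof.
rewrite /wedge /hdeg; case: (1 < i)%N; first exact: hform_dplk.
by apply: hformN; apply: hformM; apply: hform_dplk.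
Qed.

Lemma closed_span_eqs : hform_closed plrow span_eqs.
Proof.
pose S k z := dplk (r := r) (K := K) z 0 k; pose T k z := dplk (r := r) (K := K) z 1 k.
exists (nat * bool * (nat * nat * nat))%type, (fun q z => let: (k, d, (i1, i2, i3)) := q in
  if [&& 1 < k < m, 0 < i1 < m, 0 < i2 < m & 0 < i3 < m]%N then
  det3 (wedge z k d) (hat (S k z) (T k z) (qvec1 a (S k z) (T k z))) (hat (S k z) (T k z)
    (qvec2 a b (S k z) (T k z))) i1 i2 i3
  else 0).
split=> [[[k d] [[i1 i2] i3]]|z].
  case: [&& _, _, _ & _]; last by exists 0%N; apply: hform0.
  have hq dd (f : nat -> nat -> K) i : hform plrow (dd + hdeg i)
      (fun z => hat (S k z) (T k z) (fun l => bform dd (f l) (S k z) (T k z)) i).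
    by apply: hform_hat => [||l]; [exact: hform_dplk.. | apply: hform_bform;
      exact: hform_dplk].
  have := hform_det3 i1 i2 i3 (hform_wedge k d) (hq a (qcoef1 K a)) (hq b (qcoef2 K a b)).
  by exists (1 + a + b + hdeg i1 + hdeg i2 + hdeg i3)%N.
split=> [h [[k d] [[i1 i2] i3]]|h k d i1 i2 i3 h1 h2 h3 h4].
  by case: ifP => // /and4P[*]; apply: h.
by have := h (k, d, (i1, i2, i3)); rewrite h1 h2 h3 h4.
Qed.

Lemma closed_linear_eqs : hform_closed plrow linear_eqs.
Proof.
have [e3|ne3] := pselect (r = (a + b).+1); last first.
  by exists False, (fun _ _ => 0); split=> // z; split=> // _ /ne3.
exists unit, (fun _ z => dplk z 0 1 - (dplk z 0 k2 - dplk z 1 k1)); split=> [_|z].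
  by exists 1%N; do 2 (apply: hformB; first exact: hform_dplk); exact: hform_dplk.
split=> [/(_ e3) -> _|/(_ tt)/eqP]; first by rewrite subrr.
by rewrite subr_eq0 => /eqP h _.
Qed.

Lemma Sigma_point_eqs z : Sg z -> point_eqs z.
Proof.
move=> [c hc zE] i j /andP[i1 im] /andP[j1 jm]; have [lam l0 h] := dplk_Sigma r0 hc zE.
by rewrite h // /pcol !pvec_ge2 //; ring.
Qed.

Lemma Sigma_linear_eqs z : Sg z -> linear_eqs z.
Proof.
move=> [c hc zE] rE; have [lam l0 h] := dplk_Sigma r0 hc zE.
have k2m : (k2 < m)%N by rewrite rE /k2 /b; lia.
have k1m : (k1 < m)%N by rewrite rE /k1 /b; case: eqP => ?; lia.
have k1g : (1 < k1)%N by rewrite /k1; case: eqP.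
rewrite !h //= /pcol pvec_0 pvec_1 !pvec_ge2 // /wcol /wvec.
rewrite qvec1_0 qvec2_0 qvec1_1 qvec2_1 qvec1_k1 qvec2_k1 qvec1_k2 qvec2_k2; ring.
Qed.

Lemma Sigma_span_eqs z : Sg z -> span_eqs z.
Proof.
move=> [c hc zE] k d i1 i2 i3 /andP[k_1 km] /andP[i10 i1m] /andP[i20 i2m] /andP[i30 i3m] S T.
have [lam l0 h] := dplk_Sigma r0 hc zE.
set s := c 0 is_; set t := c 0 it_; set u := c 0 iu_; set v := c 0 iv_.
pose x := lam * wcol c k.
have SE : S = x * s by rewrite /S h // /pcol pvec_0 pvec_ge2 // /x -/s; ring.
have TE : T = x * t by rewrite /T h // /pcol pvec_1 pvec_ge2 // /x -/t; ring.
pose D i := if (1 < i)%N then 1 else x.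
have h1 i : hat S T (qvec1 a S T) i = x ^+ a * (D i * hat s t (qvec1 a s t) i).
  by rewrite /hat /D SE TE /qvec1 !bform_scale; case: ifP => _; ring.
have h2 i : hat S T (qvec2 a b S T) i = x ^+ b * (D i * hat s t (qvec2 a b s t) i).
  by rewrite /hat /D SE TE /qvec2 !bform_scale; case: ifP => _; ring.
have h0 i : (0 < i < m)%N -> wedge z k d i =
    lam * (if d then t else s) * (D i * (u * hat s t (qvec1 a s t) i + v * hat s t (qvec2 a
      b s t) i)).
  move=> /andP[i0 im]; rewrite /wedge /hat /D.
  have [i_1|i_1] := ltnP 1 i.
    by rewrite h //; [case: d; rewrite /= /pcol ?pvec_0 ?pvec_1 pvec_ge2 // /wcol /wvec -/s
      -/t -/u -/v; ring | case: d].
  rewrite !h //; last by case: d.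
  rewrite /pcol pvec_0 pvec_1 [pvec _ _ k]pvec_ge2 // mulr0 subr0 -/s -/t /x /wcol /wvec
    -/s -/t -/u -/v.
  by case: d; rewrite /= ?pvec_0 ?pvec_1; ring.
by rewrite /det3 !h1 !h2 !h0 ?i10 ?i20 ?i30 //; ring.
Qed.

Lemma ann_sub (z : Gr K r.+1 m) c : Xe_coord c ->
  (forall v, dot v (pcol c) = 0 -> dot v (wcol c) = 0 -> v \in val z) \/
  (forall v, v \in val z -> dot v (pcol c) = 0 /\ dot v (wcol c) = 0) ->
  val z = ann r (pcol c) (wcol c).
Proof.
move=> hc; have dE := eqP (dim_ann (indep_c r0 hc)); have dz := eqP (valP z).
case=> h.
  apply/esym/eqP; rewrite eqEdim dE dz leqnn andbT; apply/subvP => v.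
  by rewrite mem_ann => /andP[/eqP h1 /eqP]; apply: h.
apply/eqP; rewrite eqEdim dE dz leqnn andbT; apply/subvP => v.
by rewrite mem_ann => /h[-> ->]; rewrite eqxx.
Qed.

Lemma dplk_neq0 (z : Gr K r.+1 m) : ~ (forall i j, (i < m)%N -> (j < m)%N -> dplk z i j = 0).
Proof.
move=> h; have [i zi] := plrow_neq0 z; have [j1 [j2 [eps hp]]] := @plrow_lform K r i.
have := h j1 j2 (ltn_ord j1) (ltn_ord j2); rewrite /dplk !inord_val => lz.
by rewrite hp lz mulr0 eqxx in zi.
Qed.

(** In this case l is spanned by the first two coordinate forms. If r < n, the
    component s^b of [qvec2] with index 3+a+b is not there, so that [qvec2] at
    (1 : 0) is the coordinate form with index 1. *)
Lemma directrix z : point_eqs z -> linear_eqs z ->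
  (forall k, (1 < k < m)%N -> dplk z 0 k = 0 /\ dplk z 1 k = 0) ->
  val z = ann r (pcol (mkc 1 0 0 1)) (wcol (mkc 1 0 0 1)).
Proof.
move=> E1 E3 h; have [x [y [ind zE]]] := ann_exists z; have [lam l0 lE] := dplk_ann ind zE.
have lC i j : (i < m)%N -> (j < m)%N -> dplk z i j = - dplk z j i.
  by move=> im jm; rewrite !lE //; ring.
have hc : Xe_coord (mkc (1 : K) 0 0 1).
  by rewrite Xe_coordE; have [-> -> -> ->] := mkcE (1 : K) 0 0 1; rewrite eqxx oner_eq0.
have l01 : dplk z 0 1 != 0.
  apply/eqP => l01; apply: (@dplk_neq0 z) => i j im jm.
  have lxx k : (k < m)%N -> dplk z k k = 0 by move=> km; rewrite lE //; ring.
  case: i im => [|[|i]] im; case: j jm => [|[|j]] jm //; rewrite ?lxx //.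
  - by have [-> _] := h j.+2 jm.
  - by rewrite lC // l01 oppr0.
  - by have [_ ->] := h j.+2 jm.
  - by rewrite lC //; have [-> _] := h i.+2 im; rewrite oppr0.
  - by rewrite lC //; have [_ ->] := h i.+2 im; rewrite oppr0.
  by rewrite E1.
have rlt : (r < (a + b).+1)%N.
  rewrite ltn_neqAle rn andbT; apply/eqP => rE; move: l01; rewrite E3 //.
  have k2m : (1 < k2 < m)%N by rewrite rE /k2 /b; lia.
  have k1m : (1 < k1 < m)%N by rewrite rE /k1 /b; case: eqP => ?; lia.
  by have [-> _] := h _ k2m; have [_ ->] := h _ k1m; rewrite subrr eqxx.
have xy0 k : (1 < k < m)%N -> x k = 0 /\ y k = 0.
  move=> kk; have /andP[_ km] := kk; have [] := h k kk; rewrite !lE //.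
  move=> /eqP + /eqP; rewrite !mulf_eq0 (negPf l0) /= !subr_eq0 => /eqP h0 /eqP h1.
  have D0 : x 0%N * y 1%N - y 0%N * x 1%N != 0.
    by move: l01; rewrite lE // mulf_eq0 negb_or => /andP[].
  split; apply: (mulfI D0); rewrite mulr0.
    transitivity (x 0%N * (y 1%N * x k) - x 1%N * (y 0%N * x k)); first by ring.
    by rewrite -h0 -h1; ring.
  transitivity (y 1%N * (x 0%N * y k) - y 0%N * (x 1%N * y k)); first by ring.
  by rewrite h0 h1; ring.
apply: ann_sub => //; left=> v hp hw.
have [s1 t0 u0 v1] := mkcE (1 : K) 0 0 1.
have wE k : (k < m)%N -> wcol (mkc 1 0 0 1) k = (k == 1)%N%:R.
  move=> km; rewrite /wcolumn /wvec s1 t0 u0 v1 mul0r add0r mul1r /qvec2.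
  have -> : bform b (qcoef2 K a b k) 1 0 = qcoef2 K a b k b.
    rewrite /bform (bigD1 ord_max) //= subnn expr1n !mulr1 big1 ?addr0 // => i ib.
    rewrite expr0n subn_eq0 (_ : (b <= i)%N = false) ?mulr0 //.
    by apply: contraNF ib => bi; apply/eqP/val_inj/eqP; rewrite /= eqn_leq bi -ltnS ltn_ord.
  by rewrite /qcoef2 /b; congr (_ %:R); move: km rlt; rewrite /b; lia.
have v0 : v 0 ord0 = 0.
  move: hp; rewrite /dot (bigD1 ord0) //= big1 ?addr0 => [|i i0].
    by rewrite /pcol s1 pvec_0 mulr1.
  rewrite /pcol s1 t0; case: i i0 => -[|[|i]] im //= _.
    by rewrite pvec_1 mulr0.
  by rewrite pvec_ge2 ?mulr0.
have v1' : v 0 (inord 1) = 0.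
  move: hw; rewrite /dot (bigD1 (inord 1)) //= big1 ?addr0 => [|i i0].
    by rewrite wE ?inordK // eqxx mulr1.
  rewrite wE // (_ : (i == 1 :> nat) = false) ?mulr0 //.
  by apply: contraNF i0 => /eqP i1; apply/eqP/val_inj; rewrite /= inordK.
have dot0 w : (forall k, (1 < k < m)%N -> w k = 0) -> dot v w = 0.
  move=> hw0; rewrite /dot big1 // => i _.
  case: (ltnP 1 i) => [i1|i1]; first by rewrite hw0 ?mulr0 // i1 /=.
  have [i0|i0] := eqVneq (nat_of_ord i) 0%N.
    by rewrite (_ : i = ord0) ?v0 ?mul0r //; apply/val_inj.
  by rewrite (_ : i = inord 1) ?v1' ?mul0r //; apply/val_inj; rewrite /= inordK //; lia.
rewrite zE mem_ann !dot0 ?eqxx //.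
  by move=> k kk; have [] := xy0 k kk.
by move=> k kk; have [] := xy0 k kk.
Qed.

(** Since [qvec1] and [qvec2] remain independent modulo [pvec], some 2x2 minor of
    theirs does not vanish, and Cramer's rule applies. *)
Lemma hat_solve (S T : K) (w : nat -> K) : (S != 0) || (T != 0) ->
  (forall i1 i2 i3, (0 < i1 < m)%N -> (0 < i2 < m)%N -> (0 < i3 < m)%N ->
     det3 (hat S T w) (hat S T (qvec1 a S T)) (hat S T (qvec2 a b S T)) i1 i2 i3 = 0) ->
  exists u v, forall i, (0 < i < m)%N ->
    hat S T w i = u * hat S T (qvec1 a S T) i + v * hat S T (qvec2 a b S T) i.
Proof.
move=> ST h.
have m4 i : (0 < i < 4)%N -> (0 < i < m)%N by move=> /andP[-> i4] /=;
  apply: leq_trans i4 _; rewrite !ltnS.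
suff [i [j [hi hj ij]]] : exists i j, [/\ (0 < i < m)%N, (0 < j < m)%N &
    hat S T (qvec1 a S T) i * hat S T (qvec2 a b S T) j
    - hat S T (qvec1 a S T) j * hat S T (qvec2 a b S T) i != 0].
  by have [u [v huv]] := cramer3 (hat S T w) ij; exists u, v => k hk; apply/huv/h.
have H1 : hat S T (qvec1 a S T) 1 = T ^+ a.+1.
  by rewrite /hat /= qvec1_0 qvec1_1 mulr0 subr0 exprS.
have H2 : hat S T (qvec2 a b S T) 1 = - S ^+ b.+1.
  by rewrite /hat /= qvec2_0 qvec2_1 mulr0 sub0r exprS.
have H3 : hat S T (qvec1 a S T) 2 = S ^+ a by rewrite /hat /= qvec1_2.
have H4 : hat S T (qvec2 a b S T) 2 = 0 by rewrite /hat /= qvec2_2.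
have H5 : hat S T (qvec1 a S T) 3 = 0 by rewrite /hat /= qvec1_3.
have H6 : hat S T (qvec2 a b S T) 3 = T ^+ b by rewrite /hat /= qvec2_3.
have [S0|S0] := eqVneq S 0.
  rewrite S0 eqxx /= in ST; exists 1%N, 3%N; split; [exact: m4 | exact: m4 |].
  by rewrite H1 H6 H5 mul0r subr0 mulf_neq0 // expf_neq0.
have [T0|T0] := eqVneq T 0.
  exists 1%N, 2%N; split; [exact: m4 | exact: m4 |].
  by rewrite H1 H2 H3 H4 mulr0 sub0r mulrN opprK mulf_neq0 // expf_neq0.
exists 2%N, 3%N; split; [exact: m4 | exact: m4 |].
by rewrite H3 H6 H5 mul0r subr0 mulf_neq0 // expf_neq0.
Qed.

Lemma dotB v al x y (w : nat -> K) : (forall i, (i < m)%N -> w i = x i - al * y i) ->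
  @dot K r v w = dot v x - al * dot v y.
Proof.
move=> h; rewrite /dot mulr_sumr -sumrB; apply: eq_bigr => i _.
by rewrite h //; ring.
Qed.

Lemma equations_Sigma z : point_eqs z -> span_eqs z -> linear_eqs z -> Sg z.
Proof.
move=> E1 E2 E3.
have [h|/existsNP[k /not_implyP[kk nh]]] :=
    pselect (forall k, (1 < k < m)%N -> dplk z 0 k = 0 /\ dplk z 1 k = 0).
  exists (mkc 1 0 0 1); last exact: directrix.
  by rewrite Xe_coordE; have [-> -> -> ->] := mkcE (1 : K) 0 0 1; rewrite eqxx oner_eq0.
have /andP[k_1 km] := kk.
have [x [y [ind zE]]] := ann_exists z; have [lam l0 lE] := dplk_ann ind zE.
pose S := dplk z 0 k; pose T := dplk z 1 k.
have ST : (S != 0) || (T != 0).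
  by rewrite -negb_and; apply/negP => /andP[/eqP S0 /eqP T0]; apply: nh.
(* a second equation [w] of [z], independent of [pvec S T] *)
have PE i : (i < m)%N -> pvec S T i = lam * (y k * x i - x k * y i).
  move=> im; case: i im => [|[|i]] im.
  - by rewrite pvec_0 /S lE //; ring.
  - by rewrite pvec_1 /T lE //; ring.
  have := E1 i.+2 k im kk; rewrite pvec_ge2 // lE // => <-; ring.
have [w [kap [kap0 wE wz]]] : exists w kap, [/\ kap != 0,
    forall i j, (i < m)%N -> (j < m)%N ->
      pvec S T i * w j - pvec S T j * w i = kap * dplk z i j &
    forall v, v \in val z -> dot v w = 0].
  have [xk|xk] := eqVneq (x k) 0; last first.
    exists x, (x k); split => // [i j im jm|v]; first by rewrite !PE // lE //; ring.
    by rewrite zE mem_ann => /andP[/eqP].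
  exists y, (y k); split => [|i j im jm|v].
  - apply/eqP => yk; move: ST; rewrite /S /T !lE // xk yk !mulr0 subrr mulr0 eqxx //.
  - by rewrite !PE // lE //; ring.
  by rewrite zE mem_ann => /andP[_ /eqP].
have Pz v : v \in val z -> dot v (pvec S T) = 0.
  rewrite zE mem_ann => /andP[/eqP dx /eqP dy].
  transitivity (\sum_(i < m) (lam * y k * (v 0 i * x i) - lam * x k * (v 0 i * y i))).
    by apply: eq_bigr => i _; rewrite PE //; ring.
  by rewrite sumrB -!mulr_sumr -/(dot v x) -/(dot v y) dx dy !mulr0 subrr.
have omE d i : (0 < i < m)%N -> kap * wedge z k d i = (if d then T else S) * hat S T w i.
  move=> /andP[i0 im]; rewrite /wedge /hat; case: (ltnP 1 i) => i1.
    rewrite -wE //; last by case: d.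
    by rewrite (pvec_ge2 _ _ i1) mul0r subr0; case: d; rewrite ?pvec_0 ?pvec_1.
  rewrite mulrN mulrCA -wE // pvec_0 pvec_1 /S /T.
  by case: d => /=; ring.
have [u [v uvE]] : exists u v, forall i, (0 < i < m)%N ->
    hat S T w i = u * hat S T (qvec1 a S T) i + v * hat S T (qvec2 a b S T) i.
  apply: hat_solve => // i1 i2 i3 h1 h2 h3.
  have [d d0] : exists d : bool, (if d then T else S) != 0.
    by case/orP: ST => ?; [exists false | exists true].
  apply: (mulfI d0); rewrite mulr0.
  have := E2 k d i1 i2 i3 kk h1 h2 h3; rewrite -/S -/T => h.
  transitivity (kap * det3 (wedge z k d) (hat S T (qvec1 a S T)) (hat S T (qvec2 a b S T))
    i1 i2 i3).
    by apply/esym/(det3_scale (P := fun i => 0 < i < m)%N) => // i; apply: omE.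
  by rewrite h mulr0.
pose c := mkc S T u v; have [cs ct cu cv] := mkcE S T u v.
pose W := wcol c.
have WE i : (0 < i < m)%N -> hat S T w i = hat S T W i.
  move=> hi; rewrite uvE // /hat /W /wcolumn /wvec cs ct cu cv; case: ifP => _; ring.
have uv : (u != 0) || (v != 0).
  rewrite -negb_and; apply/negP => /andP[/eqP u0 /eqP v0].
  have w0 i : (0 < i < m)%N -> hat S T w i = 0 by move=> hi; rewrite uvE // u0 v0 !mul0r addr0.
  case/orP: ST => /eqP; apply; apply: (mulfI kap0); rewrite mulr0.
    by have := omE false k; rewrite w0 ?km ?(ltnW k_1) // mulr0 /wedge k_1; apply.
  by have := omE true k; rewrite w0 ?km ?(ltnW k_1) // mulr0 /wedge k_1; apply.
have hc : Xe_coord c by rewrite Xe_coordE cs ct cu cv ST uv.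
exists c => //; apply: ann_sub => //; right=> v' v'z.
have PcE : pcol c = pvec S T by rewrite /pcol cs ct.
rewrite PcE; split; first exact: Pz.
have h1 : T * (w 0%N - W 0%N) = S * (w 1%N - W 1%N).
  have := WE 1%N isT; rewrite /hat /= => h; apply/eqP; rewrite -subr_eq0.
  rewrite (_ : _ - _ = (T * w 0%N - S * w 1%N) - (T * W 0%N - S * W 1%N)); last by ring.
  by rewrite h subrr.
have [al alE] : exists al, forall i, (i < m)%N -> W i = w i - al * pvec S T i.
  have w2 i : (1 < i < m)%N -> W i = w i.
    by move=> /andP[hi him]; have := WE i; rewrite (ltnW hi) him /hat hi => /(_ isT).
  have [S0|S0] := eqVneq S 0.
    have T0 : T != 0 by move: ST; rewrite S0 eqxx.
    exists ((w 1%N - W 1%N) / T) => -[|[|i]] im.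
    - rewrite pvec_0 S0 mulr0 subr0; apply: (mulfI T0).
      by move: h1; rewrite S0 mul0r mulrBr => /eqP; rewrite subr_eq0 => /eqP.
    - by rewrite pvec_1 divfK // subKr.
    by rewrite pvec_ge2 // mulr0 subr0 w2.
  exists ((w 0%N - W 0%N) / S) => -[|[|i]] im.
  - by rewrite pvec_0 divfK // subKr.
  - rewrite pvec_1; apply: (mulfI S0).
    transitivity (S * w 1%N - T * (w 0%N - W 0%N)); first by rewrite h1; ring.
    by field.
  by rewrite pvec_ge2 // mulr0 subr0 w2.
by rewrite (dotB v' alE) Pz // wz // mulr0 subr0.
Qed.

Lemma Sigma_form_closed : hform_closed plrow Sg.
Proof.
have [I [f [hf fE]]] := hform_closedI closed_point_eqs (hform_closedI closed_span_eqs
  closed_linear_eqs).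
exists I, f; split=> // z; rewrite -fE; split=> [Sz|[E1 [E2 E3]]]; last exact: equations_Sigma.
by split; [exact: Sigma_point_eqs | split; [exact: Sigma_span_eqs | exact: Sigma_linear_eqs]].
Qed.

End Closed.

(** * The congruence *)

Section Dim.
Variables (K : numClosedFieldType) (a e r : nat).
Hypothesis r0 : (0 < r)%N.
Hypothesis rn : (r <= (a + (a + e)).+1)%N.
Let b := (a + e)%N.
Local Notation m := (r.+3).
Local Notation Sg := (@Sigma K a e r).
Local Notation wcol := (@wcolumn K a e).

(** The action of pairs of scalars by which X_e is a quotient. *)
Definition torus (al be : K) (c : 'rV[K]_(2 + 2)) : 'rV[K]_(2 + 2) :=
  mkc (al * c 0 is_) (al * c 0 it_) (al ^+ e * be * c 0 iu_) (be * c 0 iv_).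

Lemma meval_section i j (F : {mpoly K[2 + 2]}) al be c : Xe_section e i j F ->
  F.@[torus al be c 0] = al ^+ j * be ^+ i * F.@[c 0].
Proof.
rewrite Xe_sectionE => hF; rewrite !mevalE mulr_sumr [LHS]big_seq [RHS]big_seq.
apply: eq_bigr => mu /hF[<- <-].
rewrite !prod4; have [-> -> -> ->] :=
  mkcE (al * c 0 is_) (al * c 0 it_) (al ^+ e * be * c 0 iu_) (be * c 0 iv_).
rewrite !exprMn !exprD exprM; ring.
Qed.

Lemma eval_forms_torus N (F : 'I_N -> {mpoly K[2 + 2]}) i j al be c :
  (forall l, Xe_section e i j (F l)) ->
  eval_forms F (torus al be c) = (al ^+ j * be ^+ i) *: eval_forms F c.
Proof. by move=> hF; apply/rowP => l; rewrite !mxE (meval_section _ _ _ (hF l)). Qed.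

Lemma eq_coord (c d : 'rV[K]_(2 + 2)) : c 0 is_ = d 0 is_ -> c 0 it_ = d 0 it_ ->
  c 0 iu_ = d 0 iu_ -> c 0 iv_ = d 0 iv_ -> c = d.
Proof.
move=> h1 h2 h3 h4; apply/rowP => -[[|[|[|[|//]]]] hl].
- by move: h1; congr (c 0 _ = d 0 _); apply/val_inj.
- by move: h2; congr (c 0 _ = d 0 _); apply/val_inj.
- by move: h3; congr (c 0 _ = d 0 _); apply/val_inj.
by move: h4; congr (c 0 _ = d 0 _); apply/val_inj.
Qed.

(** The fibre t = 0 contains the annihilator of the first two coordinate forms
    whenever [Sigma] does. This makes it the locus in [Sigma] of linear equations,
    which say that the coordinate form 0 is an equation of [z]. *)
Definition fibre : set (Gr K r.+1 m) :=
  [set z | exists c, [/\ Xe_coord c, c 0 it_ = 0 & val z = ann r (pcol c) (wcol c)]].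

Lemma fibre_closed : gr_closed fibre.
Proof.
apply: gr_closed_form.
have h1 j : hform_closed plrow [set z : Gr K r.+1 m | (1 < j < m)%N -> dplk z 1 j = 0].
  case: (_ && _); last by exists False, (fun _ _ => 0); split=> // z; split.
  by have [J [g [hg gE]]] := hform_closed_zero (hform_dplk K r 1 j); exists J, g;
    split=> // z; rewrite -gE /=; split=> // ->.
have [J [g [hg gE]]] := hform_closedI (Sigma_form_closed K r0 rn) (hform_closed_forall h1).
exists J, g; split=> // z; rewrite -gE /=; split.
  move=> [c [hc c0 zE]]; split; first by exists c.
  move=> j /andP[j1 jm]; have [lam _ ->] := dplk_Sigma r0 hc zE => //.
  by rewrite /pcol c0 pvec_1 pvec_ge2 //; ring.
move=> [Sz h].
have [c hc zE] := Sz; have [t0|t0] := eqVneq (c 0 it_) 0; first by exists c.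
exists (mkc 1 0 0 1); have [c1 c2 c3 c4] := mkcE (1 : K) 0 0 1.
split=> //; first by rewrite Xe_coordE c1 c2 c3 c4 eqxx oner_eq0.
apply: directrix => //; [exact: (Sigma_point_eqs r0 Sz) | exact: (Sigma_linear_eqs r0 rn
  Sz) |].
move=> j hj; have hj' := h j hj; split=> //.
have /andP[j1 jm] := hj; move: hj'; have [lam l0 lE] := dplk_Sigma r0 hc zE.
rewrite !lE // /pcol pvec_0 pvec_1 !pvec_ge2 // !mulr0 !subr0 => /eqP.
by rewrite !mulf_eq0 (negPf l0) (negPf t0) /= => /eqP->; rewrite !mulr0.
Qed.

Lemma fibre_irreducible : irreducible_set gr_closed fibre.
Proof.
have [Dp [hD DE]] := plucker_param K a e r0.
pose g i : {mpoly K[2 + 2]} := Dp i \mPo [tuple 1; 0; 'X_iu_; 'X_iv_].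
pose c1 (c : 'rV[K]_(2 + 2)) := mkc 1 0 (c 0 iu_) (c 0 iv_).
have gE c : eval_forms g c = eval_forms Dp (c1 c).
  apply/rowP => i; rewrite !mxE comp_mpoly_meval; apply: meval_eq => l.
  rewrite /c1 mxE; case: l => -[|[|[|[|//]]]] hl.
  - by rewrite (tnth_nth 0) /= meval1.
  - by rewrite (tnth_nth 0) /= meval0.
  - by rewrite (tnth_nth 0) /= mevalXU.
  by rewrite (tnth_nth 0) /= mevalXU.
apply: (@irreducible_param K _ _ _ _ g 'X_iu_ (mkc 0 0 1 0)).
- by rewrite mevalXU; have [_ _ -> _] := mkcE (0 : K) 0 1 0; rewrite oner_eq0.
- move=> c; rewrite mevalXU => hu; have [s1 t0 uE vE] := mkcE (1 : K) 0 (c 0 iu_) (c 0 iv_).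
  have hc : Xe_coord (c1 c) by rewrite Xe_coordE s1 t0 uE vE hu oner_eq0.
  have [z Sz zE] := Sigma_mem a e r0 hc; exists z; split; first by exists (c1 c).
  by rewrite gE; apply: DE.
move=> z [c [hc t0 zE]]; have [lam _ lE] := DE z c hc zE.
have s0 : c 0 is_ != 0 by move: hc; rewrite Xe_coordE t0 eqxx orbF => /andP[].
pose d := mkc 1 0 (c 0 iu_ / c 0 is_ ^+ e) (c 0 iv_).
have [d1 d2 d3 d4] := mkcE (1 : K) 0 (c 0 iu_ / c 0 is_ ^+ e) (c 0 iv_).
have cE : c = torus (c 0 is_) 1 d.
  apply: eq_coord; rewrite /torus [in RHS]mxE /=.
  - by rewrite d1 mulr1.
  - by rewrite d2 t0 mulr0.
  - by rewrite d3 mulr1 mulrC divfK // expf_neq0.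
  by rewrite d4 mul1r.
exists d; exists (lam * (c 0 is_ ^+ b.+1 * 1 ^+ 1)).
have c1d : c1 d = d by apply: eq_coord; rewrite /c1 [in LHS]mxE.
by rewrite lE gE c1d {1}cE (eval_forms_torus _ _ _ hD) scalerA.
Qed.

Lemma Sigma_congruence : congruence Sg.
Proof.
have cl : gr_closed Sg := gr_closed_form (Sigma_form_closed K r0 rn).
have irr := @Sigma_irreducible K a e r r0.
have coord u v w : (u != 0) || (v != 0) -> Xe_coord (mkc (1 : K) w u v).
  by move=> uv; rewrite Xe_coordE; have [-> _ -> ->] := mkcE (1 : K) w u v;
    rewrite oner_eq0 uv.
have [|z0 S0 z0E] := @Sigma_mem K a e r r0 (mkc 1 0 1 0); first by rewrite coord ?oner_eq0.
have [|z1 S1 z1E] := @Sigma_mem K a e r r0 (mkc 1 0 0 1);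
  first by rewrite coord ?oner_eq0 ?orbT.
have [|z2 S2 z2E] := @Sigma_mem K a e r r0 (mkc 1 1 1 0); first by rewrite coord ?oner_eq0.
split=> //; split; last exact: Sigma_no_chain3.
have fS : fibre `<=` Sg by move=> z [c [hc _ zE]]; exists c.
have f0 : fibre z0.
  exists (mkc 1 0 1 0); split=> //; first by rewrite coord ?oner_eq0.
  by have [_ -> _ _] := mkcE (1 : K) 0 1 0.
have f1 : fibre z1.
  exists (mkc 1 0 0 1); split=> //; first by rewrite coord ?oner_eq0 ?orbT.
  by have [_ -> _ _] := mkcE (1 : K) 0 0 1.
have m3 : (2 < m)%N by rewrite !ltnS.
have l0 : dplk z0 0 2 != 0.
  have [||lam l0 ->] := @dplk_Sigma K a e r r0 z0 (mkc 1 0 1 0) => //;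
    first by rewrite coord ?oner_eq0.
  have [h1 h2 h3 h4] := mkcE (1 : K) 0 1 0.
  rewrite /pcol /wcolumn h1 h2 h3 h4 pvec_0 pvec_ge2 // /wvec qvec1_2 qvec2_2 expr1n.
  by rewrite (_ : _ * _ = lam) //; ring.
have l1 : dplk z1 0 2 = 0.
  have [||lam _ ->] := @dplk_Sigma K a e r r0 z1 (mkc 1 0 0 1) => //;
    first by rewrite coord ?oner_eq0 ?orbT.
  have [h1 h2 h3 h4] := mkcE (1 : K) 0 0 1.
  rewrite /pcol /wcolumn h1 h2 h3 h4 pvec_0 pvec_ge2 // /wvec qvec1_2 qvec2_2; ring.
have l2 : dplk z2 1 2 != 0.
  have [||lam l2 ->] := @dplk_Sigma K a e r r0 z2 (mkc 1 1 1 0) => //;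
    first by rewrite coord ?oner_eq0.
  have [h1 h2 h3 h4] := mkcE (1 : K) 1 1 0.
  rewrite /pcol /wcolumn h1 h2 h3 h4 pvec_1 pvec_ge2 // /wvec qvec1_2 qvec2_2 expr1n.
  by rewrite (_ : _ * _ = lam) //; ring.
exists (fun i => if i == 0%N then [set z | z = z0] else if i == 1%N then fibre else Sg); split.
  case=> [|[|[|//]]] _ /=.
  - split; [exact: gr_closed_form (hform_closed_eq z0) | | by move=> z ->].
    split; first by exists z0.
    by move=> A B _ _ AB; have [Az|Bz] := AB z0 erefl; [left | right] => z ->.
  - by split=> //; [exact: fibre_closed | exact: fibre_irreducible].
  by split.
case=> [|[|//]] _ /=; split.
- by move=> z ->.
- by move=> /(_ z1 f1) e1; move: l0; rewrite -e1 l1 eqxx.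
- exact: fS.
move=> /(_ z2 S2)[c [hc t0 zE]]; move: l2; have [lam _ ->] := dplk_Sigma r0 hc zE => //.
by rewrite /pcol t0 pvec_1 pvec_ge2 // mul0r mulr0 subrr mulr0 eqxx.
Qed.

End Dim.

(** * Common zeros of binary forms *)

Section Elimination.
Variables (K : fieldType) (a b : nat).

(** A Sylvester matrix in degree a + b: the rows are the products of [g] with the
    first [a] monomials of degree [a], and of [f] with all monomials of degree
    [b], ordered so that the matrix is the identity for f = s^a, g = t^b. The
    usual degree a + b - 1 would not do when a = b = 0. *)
Definition elim_mx (f g : nat -> K) : 'M[K]_((a + b).+1) :=
  \matrix_(k, l) if (a <= k)%N then \sum_(i < a.+1) f i * (l == (k - a) + i :> nat)%N%:R
                 else \sum_(j < b.+1) g j * (l == k + j :> nat)%N%:R.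

Lemma sum_pick n (F : nat -> K) (j : nat) : (j < n)%N ->
  \sum_(l < n) F l * (l == j :> nat)%:R = F j.
Proof.
move=> jn; rewrite (bigD1 (Ordinal jn)) //= eqxx mulr1 big1 ?addr0 // => l lj.
by rewrite (_ : (l == j :> nat) = false) ?mulr0 //; apply: contraNF lj => /eqP e;
  apply/eqP/val_inj.
Qed.

(** At a common zero the vector of monomials of degree a + b is in the kernel. *)
Lemma elim_root (f g : nat -> K) s t : (s != 0) || (t != 0) ->
  bform a f s t = 0 -> bform b g s t = 0 -> \det (elim_mx f g) = 0.
Proof.
move=> st hf hg; rewrite -det_tr; apply/eqP/det0P.
pose v : 'rV[K]_((a + b).+1) := \row_l (s ^+ l * t ^+ (a + b - l)); exists v.
  case/orP: st => h; apply/rV0Pn.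
    by exists ord_max; rewrite mxE /= subnn mulr1 expf_neq0.
  by exists ord0; rewrite mxE mul1r expf_neq0.
have key d (h : nat -> K) k0 : (k0 + d <= a + b)%N -> bform d h s t = 0 ->
    \sum_(l < (a + b).+1) (s ^+ l * t ^+ (a + b - l)) * \sum_(i < d.+1) h i * (l == k0 + i
      :> nat)%N%:R = 0.
  move=> kd h0; under eq_bigr => l _ do rewrite mulr_sumr.
  rewrite exchange_big /=.
  transitivity (s ^+ k0 * t ^+ (a + b - (k0 + d)) * bform d h s t); last by rewrite h0 mulr0.
  rewrite /bform mulr_sumr; apply: eq_bigr => i _; have := ltn_ord i; rewrite ltnS => id.
  under eq_bigr => l _ do rewrite mulrA.
  rewrite (@sum_pick _ (fun l => s ^+ l * t ^+ (a + b - l) * h i)); last by lia.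
  have -> : (a + b - (k0 + i) = (a + b - (k0 + d)) + (d - i))%N by lia.
  by rewrite !exprD; ring.
apply/rowP => k; rewrite !mxE; have := ltn_ord k; rewrite ltnS => kab.
under eq_bigr => l _ do rewrite !mxE.
by case: (leqP a k) => ak; [apply: key => //; lia | apply: key => //; lia].
Qed.

Lemma elim_diag (f g : nat -> K) c :
  (forall i, (i <= a)%N -> f i = c * (i == a)%:R) ->
  (forall j, (j <= b)%N -> g j = c * (j == 0)%:R) ->
  \det (elim_mx f g) = c ^+ (a + b).+1.
Proof.
move=> hf hg; rewrite (_ : elim_mx f g = c%:M) ?det_scalar //.
apply/matrixP => k l; rewrite !mxE -mulr_natr -val_eqE /= eq_sym; have := ltn_ord k;
  rewrite ltnS => kab.
case: (leqP a k) => ak.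
  rewrite (eq_bigr (fun i : 'I_a.+1 => c * (l == k - a + i :> nat)%N%:R * (i == a :> nat)%:R)).
    by rewrite (@sum_pick _ (fun i => c * (l == k - a + i :> nat)%N%:R)) // subnK.
  by move=> i _; rewrite hf 1?mulrAC // -ltnS.
rewrite (eq_bigr (fun i : 'I_b.+1 => c * (l == k + i :> nat)%N%:R * (i == 0 :> nat)%:R)).
  by rewrite (@sum_pick _ (fun i => c * (l == k + i :> nat)%N%:R)) // addn0.
by move=> i _; rewrite hg 1?mulrAC // -ltnS.
Qed.

End Elimination.

Section InfiniteValues.
Variable K : numFieldType.

Lemma infinite_values T (A : set T) (phi : T -> K) :
  (forall i : nat, exists z, A z /\ phi z = i.+1%:R) -> infinite_set A.
Proof.
move=> h finA; have [f hf] := choice h.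
apply: infinite_nat; have finj : {in setT &, injective f}.
  move=> i j _ _ eij; have [_ hi] := hf i; have [_ hj] := hf j.
  by move: hi; rewrite eij hj => /eqP; rewrite eqr_nat => /eqP[].
have : finite_set (f @` setT) by apply: sub_finite_set finA => _ [i _ <-]; have [] := hf i.
by apply: card_le_finite; have := inj_card_eq finj; rewrite card_eq_le => /andP[].
Qed.

Lemma bform_coef0 d (f : nat -> K) : (forall s, bform d f s 1 = 0) ->
  forall i, (i <= d)%N -> f i = 0.
Proof.
move=> h i id; pose p := \poly_(i < d.+1) f i.
have pE s : p.[s] = 0.
  rewrite -(h s) horner_poly /bform; apply: eq_bigr => j _.
  by rewrite expr1n mulr1.
have p0 : p = 0.
  by apply/eqP; apply: contraT => /poly_nonroot[x]; rewrite pE eqxx.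
by have := congr1 (fun q : {poly K} => q`_i) p0; rewrite coef_poly ltnS id coef0.
Qed.

Lemma perp2 (x1 x2 y1 y2 : K) : (x1 != 0) || (x2 != 0) -> (y1 != 0) || (y2 != 0) ->
  x1 * y1 + x2 * y2 = 0 -> exists2 mu, mu != 0 & x1 = mu * y2 /\ x2 = - (mu * y1).
Proof.
move=> hx hy e.
have [y10|y10] := eqVneq y1 0.
  rewrite y10 eqxx /= in hy; move: e; rewrite y10 mulr0 add0r => /eqP.
  rewrite mulf_eq0 (negPf hy) orbF => /eqP x20; rewrite x20 eqxx orbF in hx.
  by exists (x1 / y2); rewrite ?mulf_neq0 ?invr_eq0 // divfK // mulr0 oppr0.
have x1E : x1 = - x2 / y1 * y2.
  apply: (mulIf y10); rewrite mulrAC divfK // mulNr; apply/eqP.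
  by rewrite -subr_eq0 opprK e.
exists (- x2 / y1); last by rewrite divfK // opprK.
rewrite mulf_neq0 ?invr_eq0 // oppr_eq0; apply: contraTneq hx => x20.
by rewrite x1E x20 oppr0 !mul0r eqxx.
Qed.

End InfiniteValues.

(** * Members through a point *)

Section Points.
Variables (K : numClosedFieldType) (a e r : nat).
Hypothesis r0 : (0 < r)%N.
Hypothesis rn : (r <= (a + (a + e)).+1)%N.
Let b := (a + e)%N.
Local Notation m := (r.+3).
Local Notation Sg := (@Sigma K a e r).
Local Notation wcol := (@wcolumn K a e).
Implicit Types v : 'rV[K]_m.

Definition co v (k : nat) : K := v 0 (inord k).

Lemma dotE v x : dot v x = \sum_(k < m) co v k * x k.
Proof. by apply: eq_bigr => k _; rewrite /co inord_val. Qed.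

Lemma dot_supp v x (s : seq nat) : uniq s -> (forall k, k \in s -> (k < m)%N) ->
  (forall k, (k < m)%N -> k \notin s -> co v k * x k = 0) ->
  dot v x = \sum_(k <- s) co v k * x k.
Proof.
move=> us sm h; rewrite dotE -(big_mkord xpredT (fun k => co v k * x k)).
rewrite (bigID (mem s)) /= [X in _ + X]big_nat_cond [X in _ + X]big1 ?addr0; last first.
  by move=> k /andP[/andP[_ km] ks]; apply: h.
rewrite -big_filter; apply/perm_big/uniq_perm => //.
  by rewrite filter_uniq // iota_uniq.
by move=> k; rewrite mem_filter mem_index_iota andb_idr // => /sm.
Qed.

Lemma dot_pvec v s t : dot v (pvec s t) = s * co v 0 + t * co v 1.
Proof.
rewrite (@dot_supp _ _ [:: 0; 1]%N) //.
- by rewrite !big_cons big_nil pvec_0 pvec_1; ring.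
- by move=> k; rewrite !inE => /orP[] /eqP->.
by move=> [|[|k]] //= _ _; rewrite pvec_ge2 // mulr0.
Qed.

Lemma dot_bform v d (f : nat -> nat -> K) s t :
  dot v (fun k => bform d (f k) s t) = bform d (fun i => dot v (fun k => f k i)) s t.
Proof.
rewrite /dot /bform; under eq_bigr => k _ do rewrite mulr_sumr.
rewrite exchange_big; apply: eq_bigr => i _; rewrite -mulrA mulr_suml.
by apply: eq_bigr => k _; rewrite !mulrA.
Qed.

Lemma dot_wvec v s t u w : dot v (wvec a b s t u w) =
  u * dot v (qvec1 a s t) + w * dot v (qvec2 a b s t).
Proof.
rewrite /dot !mulr_sumr -big_split; apply: eq_bigr => k _; rewrite /wvec /=; ring.
Qed.

Lemma mem_Sigma (z : Gr K r.+1 m) c v : val z = ann r (pcol c) (wcol c) ->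
  v \in val z <-> c 0 is_ * co v 0 + c 0 it_ * co v 1 = 0 /\
    c 0 iu_ * dot v (qvec1 a (c 0 is_) (c 0 it_)) + c 0 iv_ * dot v (qvec2 a b (c 0 is_) (c
      0 it_)) = 0.
Proof.
move=> ->; rewrite mem_ann dot_pvec dot_wvec.
by split=> [/andP[/eqP-> /eqP->]|[-> ->]] //; rewrite eqxx.
Qed.

Lemma dot_coef v (x : nat -> K) k : (k < m)%N -> co v 0 = 0 -> co v 1 = 0 ->
  (forall l, (1 < l)%N -> x l = (l == k)%:R) -> (1 < k)%N -> dot v x = co v k.
Proof.
move=> km v0 v1 h k1; rewrite (@dot_supp _ _ [:: k]) //.
- by rewrite big_cons big_nil addr0 h // eqxx mulr1.
- by move=> l; rewrite inE => /eqP->.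
move=> [|[|l]] lm; rewrite inE => lk; rewrite ?v0 ?v1 ?mul0r //.
by rewrite h // (negPf lk) mulr0.
Qed.

(** Let v be a vector in all members. From [pvec], v_0 = v_1 = 0. Every other
    component of v occurs, up to these, as a coefficient of the binary form
    qvec1(v) or qvec2(v), and both forms vanish identically. *)
Lemma no_fixed_point : ~ exists x, fixed_point Sg x.
Proof.
move=> [x hx]; pose v := rep x.
have hv s t u w : (s != 0) || (t != 0) -> (u != 0) || (w != 0) ->
    s * co v 0 + t * co v 1 = 0 /\
    u * dot v (qvec1 a s t) + w * dot v (qvec2 a b s t) = 0.
  move=> st uw; have [c1 c2 c3 c4] := mkcE s t u w.
  have hc : Xe_coord (mkc s t u w) by rewrite Xe_coordE c1 c2 c3 c4 st.
  have [z Sz zE] := Sigma_mem a e r0 hc.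
  have : v \in val z by have := hx z Sz; rewrite /incident => /subvP; apply;
    rewrite rep_line memv_line.
  by move/(mem_Sigma v zE); rewrite c1 c2 c3 c4.
have n1 : (1 : K) != 0 by rewrite oner_eq0.
have v0 : co v 0 = 0.
  by have [] := hv 1 0 1 0; rewrite ?n1 // mul1r mul0r addr0.
have v1 : co v 1 = 0.
  by have [] := hv 0 1 1 0; rewrite ?n1 ?orbT // mul1r mul0r add0r.
have q1 i : (i <= a)%N -> dot v (fun k => qcoef1 K a k i) = 0.
  apply: (bform_coef0 (f := fun i => dot v (fun k => qcoef1 K a k i))) => s;
    rewrite -dot_bform.
  by have [||_] := hv s 1 1 0; rewrite ?n1 ?orbT // mul1r mul0r addr0.
have q2 i : (i <= b)%N -> dot v (fun k => qcoef2 K a b k i) = 0.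
  apply: (bform_coef0 (f := fun i => dot v (fun k => qcoef2 K a b k i))) => s;
    rewrite -dot_bform.
  by have [||_] := hv s 1 0 1; rewrite ?n1 ?orbT // mul1r mul0r add0r.
suff vk k : (k < m)%N -> co v k = 0.
  have /eqP := rep_neq0 x; apply; apply/rowP => k.
  by rewrite mxE -[RHS](vk k (ltn_ord k)) /co inord_val.
move=> km; case: (ltnP 1 k) => k_1; last by case: k km k_1 => [|[|k]].
case: (eqVneq k 3) => [k3|k3].
  rewrite -(q2 0%N (leq0n _)) (@dot_coef _ _ k) // => l l1.
  by rewrite /qcoef2; congr (_ %:R); lia.
case: (ltnP k (4 + a)) => ka.
  case: (eqVneq k 2) => [k2|k2].
    rewrite -(q1 a (leqnn _)) (@dot_coef _ _ k) // => l l1.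
    by rewrite /qcoef1; congr (_ %:R); lia.
  rewrite -(q1 (k - 4)%N) ?(@dot_coef _ _ k) //; last by lia.
  by move=> l l1; rewrite /qcoef1; congr (_ %:R); lia.
rewrite -(q2 (k - 3 - a)%N) ?(@dot_coef _ _ k) //; last by rewrite /b; lia.
by move=> l l1; rewrite /qcoef2; congr (_ %:R); lia.
Qed.

(** The values of [qvec1] and [qvec2] on [v] at the point (v_1 : - v_0), the zero of
    [pvec] on [v]. *)
Definition qval1 v : K := dot v (qvec1 a (co v 1) (- co v 0)).
Definition qval2 v : K := dot v (qvec2 a b (co v 1) (- co v 0)).

Local Notation Q1 := qval1.
Local Notation Q2 := qval2.

Lemma ann_torus (z : Gr K r.+1 m) al be c d : al != 0 -> be != 0 -> Xe_coord d ->
  c = torus e al be d -> val z = ann r (pcol c) (wcol c) ->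
  val z = ann r (pcol d) (wcol d).
Proof.
move=> al0 be0 hd cE zE; apply: ann_sub => //; right=> v /(mem_Sigma v zE).
rewrite /pcol /wcolumn dot_pvec dot_wvec cE /torus.
have [-> -> -> ->] := mkcE (al * d 0 is_) (al * d 0 it_) (al ^+ e * be * d 0 iu_) (be * d 0
  iv_).
rewrite /qvec1 /qvec2 !dot_bform !bform_scale => -[h1 h2]; split.
  by apply: (mulfI al0); rewrite mulr0 -h1; ring.
apply: (mulfI (expf_neq0 b al0)); apply: (mulfI be0); rewrite !mulr0 -h2 /b exprD; ring.
Qed.

(** The value of [pvec] determines (s : t), and the values of [qvec1] and [qvec2]
    then determine (u : v). *)
Lemma unique_member v : (co v 0 != 0) || (co v 1 != 0) -> (Q1 v != 0) || (Q2 v != 0) ->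
  exists2 z, Sg z /\ v \in val z & forall z', Sg z' -> v \in val z' -> z' = z.
Proof.
move=> hv hQ; pose c := mkc (co v 1) (- co v 0) (Q2 v) (- Q1 v).
have [c1 c2 c3 c4] := mkcE (co v 1) (- co v 0) (Q2 v) (- Q1 v).
have hc : Xe_coord c by rewrite Xe_coordE c1 c2 c3 c4 !oppr_eq0 orbC hv orbC hQ.
have [z Sz zE] := Sigma_mem a e r0 hc; exists z.
  split=> //; apply/(mem_Sigma v zE); rewrite c1 c2 c3 c4 -/(Q1 v) -/(Q2 v).
  by split; ring.
move=> z' [d hd z'E] /(mem_Sigma v z'E)[h1 h2]; apply/val_inj; rewrite zE.
have := hd; rewrite Xe_coordE => /andP[dst duv].
have [al al0 [dE1 dE2]] := perp2 dst hv h1.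
have dE2' : d 0 it_ = al * - co v 0 by rewrite dE2 mulrN.
have {}h2 : (al ^+ a * d 0 iu_) * Q1 v + (al ^+ b * d 0 iv_) * Q2 v = 0.
  rewrite -[RHS]h2 dE1 dE2' /Q1 /Q2 /qvec1 /qvec2 !dot_bform !bform_scale; ring.
have duv' : (al ^+ a * d 0 iu_ != 0) || (al ^+ b * d 0 iv_ != 0).
  by rewrite !mulf_eq0 !expf_eq0 (negPf al0) !andbF.
have [mu mu0 [dE3 dE4]] := perp2 duv' hQ h2.
apply: (ann_torus (al := al) (be := mu / al ^+ b) al0 _ hc _ z'E).
  by rewrite mulf_neq0 // invr_eq0 expf_neq0.
apply: eq_coord; rewrite /torus [in RHS]mxE /=.
- by rewrite c1.
- by rewrite c2.
- apply: (mulfI (expf_neq0 a al0)); rewrite dE3 c3 /b exprD.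
  by field; rewrite !expf_neq0.
apply: (mulfI (expf_neq0 b al0)); rewrite dE4 c4.
by field; rewrite expf_neq0.
Qed.

End Points.

(** * Order and focal locus *)

Section Focal.
Variables (K : numClosedFieldType) (a e r : nat).
Hypothesis r0 : (0 < r)%N.
Let b := (a + e)%N.
Local Notation m := (r.+3).
Local Notation Sg := (@Sigma K a e r).
Local Notation wcol := (@wcolumn K a e).
Local Notation Q1 := (@qval1 K a r).
Local Notation Q2 := (@qval2 K a e r).
Implicit Types v : 'rV[K]_m.

Lemma incidentE (x : Gr K 1 m) (z : Gr K r.+1 m) : incident x z = (rep x \in val z).
Proof. by rewrite /incident rep_line -memvE. Qed.

Lemma dotDl v w x : dot (v + w) x = dot v x + dot w x.
Proof. by rewrite /dot -big_split; apply: eq_bigr => i _; rewrite mxE mulrDl. Qed.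

Lemma dotZl al v x : dot (al *: v) x = al * dot v x.
Proof. by rewrite /dot mulr_sumr; apply: eq_bigr => i _; rewrite mxE mulrA. Qed.

Lemma dot0 x : dot (0 : 'rV[K]_m) x = 0.
Proof. by rewrite /dot big1 // => i _; rewrite mxE mul0r. Qed.

Lemma co_dot v k : (k < m)%N -> co v k = dot v (fun l => (l == k)%:R).
Proof.
move=> km; rewrite (@dot_supp _ _ _ _ [:: k]) //.
- by rewrite big_cons big_nil eqxx mulr1 addr0.
- by move=> l; rewrite inE => /eqP->.
by move=> l lm; rewrite inE => /negPf->; rewrite mulr0.
Qed.

Lemma hform_co k : hform rep 1 (fun x : Gr K 1 m => co (rep x) k).
Proof. exact: hform_coord. Qed.

Lemma hform_dot d (x : nat -> Gr K 1 m -> K) : (forall k, hform rep d (x k)) ->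
  hform rep (1 + d) (fun z => dot (rep z) (fun k => x k z)).
Proof.
by move=> hx; apply: hform_sum => k _; apply: hformM => //; apply: hform_coord.
Qed.

Lemma hform_Q1 : hform rep (1 + a) (fun x => Q1 (rep x)).
Proof.
apply: (hform_dot (x := fun k x => qvec1 a (co (rep x) 1) (- co (rep x) 0) k)) => k.
by apply: hform_bform; [apply: hform_co | apply: hformN; apply: hform_co].
Qed.

Definition ev k : 'rV[K]_m := delta_mx 0 (inord k).

Lemma dot_ev k x : (k < m)%N -> dot (ev k) x = x k.
Proof. by move=> km; rewrite dot_delta inordK. Qed.

Lemma Sigma_order : has_order Sg 1.
Proof.
exists [set x | co (rep x) 0 * Q1 (rep x) = 0]; split.
- apply/zariski_closed_form/hform_closed_zero; apply: hformM;
  [exact: hform_co | exact: hform_Q1].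
- have e0 : ev 0 != 0.
    apply/eqP => /(congr1 (fun v => dot v (fun=> 1))); rewrite dot_ev // dot0.
    by apply/eqP; rewrite oner_eq0.
  move=> /(_ (pt e0) I) /=; have [lam l0 ->] := rep_pt e0.
  have c0 : co (lam *: ev 0) 0 = lam by rewrite co_dot // dotZl dot_ev // mulr1.
  have c1 : co (lam *: ev 0) 1 = 0 by rewrite co_dot // dotZl dot_ev // mulr0.
  move/eqP; rewrite /qval1 c0 c1 dotZl dot_ev // qvec1_0 !mulf_eq0 expf_eq0 oppr_eq0.
  by rewrite (negPf l0) andbF.
move=> x _ /= /eqP; rewrite mulf_eq0 negb_or => /andP[h0 hQ].
have [||z [Sz zx] uz] := @unique_member K a e r r0 (rep x); rewrite ?h0 ?hQ //.
rewrite (_ : members_through Sg x = [set z]); first exact: card_set1.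
apply/seteqP; split=> z'; rewrite /members_through /= incidentE; first by case; apply: uz.
by move->.
Qed.

Lemma mem_rep v (v0 : v != 0) (z : Gr K r.+1 m) : v \in val z -> incident (pt v0) z.
Proof. by move=> vz; rewrite incidentE; have [lam _ ->] := rep_pt v0; apply: memvZ. Qed.

Definition focal_res v := \det (elim_mx a b (fun i => dot v (fun k => qcoef1 K a k i))
                                          (fun i => dot v (fun k => qcoef2 K a b k i))).

Lemma hform_focal_res : hform rep ((a + b).+1 * 1) (fun x => focal_res (rep x)).
Proof.
apply: hform_det => k l.
have hd (f : nat -> K) : hform rep 1 (fun x : Gr K 1 m => dot (rep x) f).
  by have := hform_dot (fun k => hformC rep (f k)).
suff : hform rep 1 (fun x : Gr K 1 m => if (a <= k)%N then
    \sum_(i < a.+1) (l == (k - a) + i :> nat)%N%:R * dot (rep x) (fun k => qcoef1 K a k i)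
  else \sum_(j < b.+1) (l == k + j :> nat)%N%:R * dot (rep x) (fun k => qcoef2 K a b k j)).
  apply: hform_eq => x; rewrite mxE; case: ifP => _; apply: eq_bigr => i _; exact: mulrC.
by case: (a <= k)%N; apply: hform_sum => i _; apply: hformZ; apply: hd.
Qed.

(** If (x_0, x_1) <> (0, 0) and [qvec1], [qvec2] do not both vanish on x at the point
    (x_1 : - x_0), there is only one member through x. Hence the focal locus is
    contained in the union of x_0 = x_1 = 0 and [focal_res = 0]. The vectors [v1]
    and [v2] represent points of it that lie on only one of the two. *)
Lemma focal_reducible : reducible_set zariski_closed (focal_locus Sg).
Proof.
have n1 : (1 : K) != 0 by rewrite oner_eq0.
have m4 k : (k < 4)%N -> (k < m)%N by move=> k4; apply: leq_trans k4 _; rewrite !ltnS.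
have evn v (f : nat -> K) : dot v f != 0 -> v != 0.
  by apply: contraNneq => ->; rewrite dot0.
(* a point with x_0 = x_1 = 0 *)
pose v1 : 'rV[K]_m := ev 2 + ev 3.
have d1 f : dot v1 f = f 2 + f 3 by rewrite dotDl !dot_ev ?m4.
have v10 : v1 != 0 by apply: (evn _ (fun k => (k == 2)%:R)); rewrite d1 addr0.
have Z1 : focal_locus Sg (pt v10).
  apply: (@infinite_values _ _ _ (fun z => dplk z 1 2 / dplk z 0 2)) => i.
  have i0 : (i.+1%:R : K) != 0 by rewrite pnatr_eq0.
  set t : K := i.+1%:R in i0 *; have [c1 c2 c3 c4] := mkcE 1 t (- t ^+ b) 1.
  have hc : Xe_coord (mkc 1 t (- t ^+ b) 1) by rewrite Xe_coordE c1 c2 c3 c4 n1 orbT.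
  have [z Sz zE] := Sigma_mem a e r0 hc; exists z; split.
    split=> //; apply: mem_rep; apply/(mem_Sigma v1 zE);
      rewrite c1 c2 c3 c4 !co_dot ?m4 // !d1 /=.
    rewrite qvec1_2 qvec1_3 qvec2_2 qvec2_3 expr1n; split; ring.
  have [lam l0 lE] := dplk_Sigma r0 hc zE; rewrite !lE ?m4 //.
  rewrite /pcol /wcolumn c1 c2 c3 c4 pvec_0 pvec_1 pvec_ge2 // /wvec qvec1_2 qvec2_2 expr1n.
  by field; rewrite l0 expf_neq0.
(* a point over (s : t) = (1 : 1) *)
pose v2 : 'rV[K]_m := (ev 0 + ev 3) + (-1) *: (ev 1 + ev 2).
have d2 f : dot v2 f = (f 0 + f 3) - (f 1 + f 2).
  by rewrite dotDl dotZl !dotDl !dot_ev ?m4 // mulN1r.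
have v20 : v2 != 0 by apply: (evn _ (fun k => (k == 0)%:R)); rewrite d2 /= !addr0 subr0.
have Z2 : focal_locus Sg (pt v20).
  apply: (@infinite_values _ _ _ (fun z => dplk z 0 3 / dplk z 0 2)) => i.
  set t : K := i.+1%:R; have [c1 c2 c3 c4] := mkcE (1 : K) 1 1 t.
  have hc : Xe_coord (mkc 1 1 1 t) by rewrite Xe_coordE c1 c2 c3 c4 n1.
  have [z Sz zE] := Sigma_mem a e r0 hc; exists z; split.
    split=> //; apply: mem_rep; apply/(mem_Sigma v2 zE);
      rewrite c1 c2 c3 c4 !co_dot ?m4 // !d2 /=.
    rewrite qvec1_0 qvec1_1 qvec1_2 qvec1_3 qvec2_0 qvec2_1 qvec2_2 qvec2_3 !expr1n; split;
      ring.
  have [lam l0 lE] := dplk_Sigma r0 hc zE; rewrite !lE ?m4 //.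
  rewrite /pcol /wcolumn c1 c2 c3 c4 pvec_0 !pvec_ge2 // /wvec qvec1_2 qvec2_2 qvec1_3
    qvec2_3 !expr1n.
  by field; rewrite l0.
split; first by exists (pt v10).
move=> [_ /(_ [set x | co (rep x) 0 = 0 /\ co (rep x) 1 = 0] [set x | focal_res (rep x) = 0])].
case=> [|||h|h].
- apply: zariski_closed_form; apply: hform_closedI; apply: hform_closed_zero; exact: hform_co.
- apply: zariski_closed_form; apply: hform_closed_zero; exact: hform_focal_res.
- move=> x Zx /=; have [[h0 h1]|hn] := pselect (co (rep x) 0 = 0 /\ co (rep x) 1 = 0);
  first by left.
  have st : (co (rep x) 0 != 0) || (co (rep x) 1 != 0).
    by rewrite -negb_and; apply/negP => /andP[/eqP ? /eqP ?]; apply: hn.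
  right; have [Qn|] := boolP ((Q1 (rep x) != 0) || (Q2 (rep x) != 0)).
    have [z _ uz] := unique_member r0 st Qn; exfalso; apply: Zx.
    apply: (@sub_finite_set _ _ [set z]); last exact: finite_set1.
    by move=> z' [Sz']; rewrite incidentE; apply: uz.
  rewrite negb_or !negbK => /andP[/eqP hQ1 /eqP hQ2].
  apply: (@elim_root _ _ _ _ _ (co (rep x) 1) (- co (rep x) 0)).
  + by rewrite oppr_eq0 orbC.
  + by rewrite -dot_bform.
  by rewrite -dot_bform.
- have [] := h _ Z2; have [lam l0 ->] := rep_pt v20.
  rewrite co_dot // dotZl d2 /= !addr0 subr0 mulr1 => l00.
  by rewrite l00 eqxx in l0.
have := h _ Z1; rewrite /=; have [lam l0 ->] := rep_pt v10.
rewrite /focal_res (@elim_diag _ _ _ _ _ lam).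
- by move/eqP; rewrite expf_eq0 (negPf l0) andbF.
- by move=> i ia; rewrite dotZl d1 -natrD; congr (_ * _%:R); rewrite /qcoef1; lia.
by move=> j jb; rewrite dotZl d1 -natrD; congr (_ * _%:R); rewrite /qcoef2; lia.
Qed.

End Focal.

(** * Determinants of order 3 *)

Section Det3Theory.

Lemma sum3 (R : comNzRingType) n (A B C : 'I_n -> R) :
  (\sum_k A k) * ((\sum_k B k) * (\sum_k C k)) =
  \sum_k0 \sum_k1 \sum_k2 A k0 * (B k1 * C k2).
Proof.
rewrite mulr_suml; apply: eq_bigr => k0 _; rewrite mulr_suml mulr_sumr.
by apply: eq_bigr => k1 _; rewrite !mulr_sumr.
Qed.

Lemma det3_trilinear (R : comNzRingType) n (h : nat -> 'I_n -> R) (x y z : 'I_n -> R) :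
  det3 (fun i => \sum_k h i k * x k) (fun i => \sum_k h i k * y k)
       (fun i => \sum_k h i k * z k) 0 1 2 =
  \sum_k0 \sum_k1 \sum_k2
    det3 (fun i => h i k0) (fun i => h i k1) (fun i => h i k2) 0 1 2 * (x k0 * y k1 * z k2).
Proof.
rewrite /det3 !mulrBr !sum3 -!sumrB -big_split /=; apply: eq_bigr => k0 _.
rewrite -!sumrB -big_split /=; apply: eq_bigr => k1 _.
rewrite -!sumrB -big_split /=; apply: eq_bigr => k2 _; ring.
Qed.

Lemma det3E (R : comNzRingType) (A : 'M[R]_3) :
  \det A = det3 (fun i => A (inord i) (inord 0)) (fun i => A (inord i) (inord 1))
                (fun i => A (inord i) (inord 2)) 0 1 2.
Proof.
pose B i j := A (inord i) (inord j).
have AE i j : A i j = B i j by rewrite /B !inord_val.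
rewrite (expand_det_row _ ord0) !big_ord_recl big_ord0 addr0 /cofactor.
rewrite !(expand_det_row _ ord0) !big_ord_recl !big_ord0 /cofactor !det_mx11 !mxE.
rewrite !AE /det3 -!/(B _ _) /= /bump /= !addn0 !add0n.
by rewrite !add1n; ring.
Qed.

Lemma det3_0 (K : fieldType) (x y z : nat -> K) : det3 x y z 0 1 2 = 0 ->
  exists al be ga, [|| al != 0, be != 0 | ga != 0] /\
    forall i, (i < 3)%N -> al * x i + be * y i + ga * z i = 0.
Proof.
pose col (j : 'I_3) := if j == 0 :> nat then x else if j == 1 :> nat then y else z.
pose A : 'M[K]_3 := \matrix_(i, j) col j i.
have e (i : nat) : (i < 3)%N -> (inord i : 'I_3) = i :> nat by move=> i3; rewrite inordK.
have -> : det3 x y z 0 1 2 = \det A^T.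
  by rewrite det_tr det3E /det3 /A !mxE /col !e.
move=> /eqP/det0P[v v0 vA]; exists (v 0 (inord 0)), (v 0 (inord 1)), (v 0 (inord 2)).
split.
  have /rV0Pn[j] := v0; rewrite -[j]inord_val.
  by case: j => -[|[|[|//]]] hj /= ->; rewrite ?orbT.
move=> i i3; have := congr1 (fun w : 'rV_3 => w 0 (inord i)) vA; rewrite !mxE => <-.
rewrite !big_ord_recl big_ord0 addr0 !mxE /= /col /= !e //.
rewrite addrA; congr (v 0 _ * _ + v 0 _ * _ + v 0 _ * _); by apply/val_inj; rewrite /= inordK.
Qed.

(** After subtracting multiples of the first column, the other two are divisible
    by [X - x]. *)
Lemma double_root (K : fieldType) (P Q R : nat -> {poly K}) x al be :
  (forall i, (i < 3)%N -> (Q i).[x] = al * (P i).[x]) ->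
  (forall i, (i < 3)%N -> (R i).[x] = be * (P i).[x]) ->
  (det3 P Q R 0 1 2).[x] = 0 /\ (det3 P Q R 0 1 2)^`().[x] = 0.
Proof.
move=> hQ hR.
have fac (F : nat -> {poly K}) c i : (F i).[x] = c * (P i).[x] ->
    exists G, F i = c *: P i + G * ('X - x%:P).
  move=> h; have : root (F i - c *: P i) x by rewrite /root !hornerE h subrr.
  by move=> /factor_theorem[G GE]; exists G; rewrite -GE addrC subrK.
have [Q0 Q0E] := fac Q al 0%N (hQ 0%N isT); have [Q1 Q1E] := fac Q al 1%N (hQ 1%N isT).
have [Q2 Q2E] := fac Q al 2%N (hQ 2%N isT).
have [R0 R0E] := fac R be 0%N (hR 0%N isT); have [R1 R1E] := fac R be 1%N (hR 1%N isT).
have [R2 R2E] := fac R be 2%N (hR 2%N isT).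
pose E := P 0%N * (Q1 * R2 - Q2 * R1) - P 1%N * (Q0 * R2 - Q2 * R0) + P 2%N * (Q0 * R1 - Q1
  * R0).
have -> : det3 P Q R 0 1 2 = ('X - x%:P) * (('X - x%:P) * E).
  by rewrite /det3 Q0E Q1E Q2E R0E R1E R2E -!mul_polyC /E; ring.
move: E => E; split; first by rewrite hornerM hornerXsubC subrr mul0r.
by rewrite derivM derivXsubC mul1r hornerD !hornerM !hornerXsubC subrr !mul0r addr0.
Qed.

End Det3Theory.

(** * The class *)

Section Pencil.
Variables (K : numClosedFieldType) (a e r : nat).
Let b := (a + e)%N.
Local Notation m := (r.+3).
Local Notation Sg := (@Sigma K a e r).
Local Notation wcol := (@wcolumn K a e).
Implicit Types H : 'M[K]_(3, m).

(** The restriction to a plane, with the rows of [H] as basis, of the linear form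
    [x]. *)
Definition hv H (x : nat -> K) (i : nat) : K := dot (row (inord i) H) x.

Definition hvp H (x : nat -> {poly K}) (i : nat) : {poly K} :=
  \sum_(k < m) (H (inord i) k)%:P * x k.

(** Over its zeros the restrictions to the plane of [pvec], [qvec1] and [qvec2] are
    dependent; t is set to 1. *)
Definition detpoly H : {poly K} :=
  det3 (hvp H (pvec 'X 1)) (hvp H (qvec1 a 'X 1)) (hvp H (qvec2 a b 'X 1)) 0 1 2.

Definition minor3 H (k0 k1 k2 : 'I_m) : K :=
  det3 (fun i => H (inord i) k0) (fun i => H (inord i) k1) (fun i => H (inord i) k2) 0 1 2.

Lemma hform_minor3 k0 k1 k2 : hform plrow 1 (fun h : Gr K 3 m => minor3 (basis_mx h) k0 k1 k2).
Proof.
pose f (j : 'I_3) := if j == 0 :> nat then k0 else if j == 1 :> nat then k1 else k2.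
have := @hform_minor K 3 m f; apply: hform_eq => h; rewrite det3E /minor3 /det3 !mxE /f.
by rewrite !inordK.
Qed.

Lemma hvE H x i : hv H x i = \sum_(k < m) H (inord i) k * x k.
Proof. by apply: eq_bigr => k _; rewrite mxE. Qed.

Lemma det3_hv H x y z : det3 (hv H x) (hv H y) (hv H z) 0 1 2 =
  \sum_k0 \sum_k1 \sum_k2 minor3 H k0 k1 k2 * (x k0 * y k1 * z k2).
Proof.
rewrite -(det3_trilinear (fun i k => H (inord i) k) (fun k => x k) (fun k => y k) (fun k =>
  z k)).
by rewrite /det3 !hvE.
Qed.

Lemma detpolyE H : detpoly H = \sum_k0 \sum_k1 \sum_k2 minor3 H k0 k1 k2 *:
  (pvec 'X 1 k0 * qvec1 a 'X 1 k1 * qvec2 a b 'X 1 k2).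
Proof.
rewrite /detpoly (det3_trilinear (fun i k => (H (inord i) k)%:P) (fun k => pvec 'X 1 k)
   (fun k => qvec1 a 'X 1 k) (fun k => qvec2 a b 'X 1 k)).
do 3 (apply: eq_bigr => ? _); rewrite -mul_polyC; congr (_ * _).
by rewrite /minor3 /det3 !(polyCD, polyCN, polyCB, polyCM).
Qed.

Lemma hform_detpoly i : hform plrow 1 (fun h : Gr K 3 m => (detpoly (basis_mx h))`_i).
Proof.
suff : hform plrow 1 (fun h : Gr K 3 m => \sum_(k0 < m) \sum_(k1 < m) \sum_(k2 < m)
    (pvec 'X 1 k0 * qvec1 a 'X 1 k1 * qvec2 a b 'X 1 k2 : {poly K})`_i * minor3 (basis_mx
      h) k0 k1 k2).
  apply: hform_eq => h; rewrite detpolyE !coef_sum; do 3 (rewrite ?coef_sum;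
    apply: eq_bigr => ? _).
  by rewrite coefZ mulrC.
by do 3 (apply: hform_sum => ? _); apply: hformZ; apply: hform_minor3.
Qed.

Lemma hform_det3_hv x y z :
  hform plrow 1 (fun h : Gr K 3 m =>
    det3 (hv (basis_mx h) x) (hv (basis_mx h) y) (hv (basis_mx h) z) 0 1 2).
Proof.
suff : hform plrow 1 (fun h : Gr K 3 m => \sum_(k0 < m) \sum_(k1 < m) \sum_(k2 < m)
    (x k0 * y k1 * z k2) * minor3 (basis_mx h) k0 k1 k2).
  apply: hform_eq => h; rewrite det3_hv; do 3 (apply: eq_bigr => ? _); exact: mulrC.
by do 3 (apply: hform_sum => ? _); apply: hformZ; apply: hform_minor3.
Qed.

Lemma horner_bform d (f : nat -> nat) x :
  (bform d (fun i => (f i)%:R) 'X 1 : {poly K}).[x] = bform d (fun i => (f i)%:R) x 1.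
Proof.
rewrite /bform horner_sum; apply: eq_bigr => i _.
by rewrite !expr1n !mulr1 hornerM horner_exp hornerX -polyC_natr hornerC.
Qed.

Lemma horner_hvp H x i :
  [/\ (hvp H (pvec 'X 1) i).[x] = hv H (pvec x 1) i,
      (hvp H (qvec1 a 'X 1) i).[x] = hv H (qvec1 a x 1) i &
      (hvp H (qvec2 a b 'X 1) i).[x] = hv H (qvec2 a b x 1) i].
Proof.
by split; rewrite hvE /hvp horner_sum; apply: eq_bigr => k _;
  rewrite hornerM hornerC ?horner_bform // /pvec !hornerE -!polyC_natr !hornerC.
Qed.

Lemma horner_detpoly H x :
  (detpoly H).[x] = det3 (hv H (pvec x 1)) (hv H (qvec1 a x 1)) (hv H (qvec2 a b x 1)) 0 1 2.
Proof.
have h i := horner_hvp H x i.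
rewrite /detpoly /det3 !hornerE; have [-> -> ->] := h 0%N; have [-> -> ->] := h 1%N.
by have [-> -> ->] := h 2%N.
Qed.

Lemma size_bform d (f : nat -> nat) : (size (bform d (fun i =>
  (f i)%:R) 'X 1 : {poly K}) <= d.+1)%N.
Proof.
rewrite /bform; apply: (leq_trans (size_sum _ _ _)); apply/bigmax_leqP => i _.
rewrite expr1n mulr1 -polyC_natr mul_polyC; apply: (leq_trans (size_scale_leq _ _)).
by rewrite size_polyXn.
Qed.

Lemma size_detpoly H : (size (detpoly H) <= (a + b).+2)%N.
Proof.
rewrite detpolyE; apply: (leq_trans (size_sum _ _ _)); apply/bigmax_leqP => i _.
apply: (leq_trans (size_sum _ _ _)); apply/bigmax_leqP => i0 _.
apply: (leq_trans (size_sum _ _ _)); apply/bigmax_leqP => i1 _.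
apply: (leq_trans (size_scale_leq _ _)).
have s0 k : (size (pvec 'X 1 k : {poly K}) <= 2)%N.
  rewrite /pvec; apply: (leq_trans (size_polyD _ _)); rewrite geq_max mul1r -!polyC_natr.
  apply/andP; split; last exact: (leq_trans (size_polyC_leq1 _)).
  by rewrite mulrC mul_polyC; apply: (leq_trans (size_scale_leq _ _)); rewrite size_polyX.
have s1 k : (size (qvec1 a 'X 1 k : {poly K}) <= a.+1)%N by apply: size_bform.
have s2 k : (size (qvec2 a b 'X 1 k : {poly K}) <= b.+1)%N by apply: size_bform.
apply: (leq_trans (size_polyMleq _ _)).
have G x y z w : (x <= 2 -> y <= a.+1 -> z <= b.+1 -> w <= (x + y).-1 ->
  (w + z).-1 <= (a + b).+2)%N.
  by clear; lia.
exact: (G _ _ _ _ (s0 i) (s1 i0) (s2 i1) (size_polyMleq _ _)).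
Qed.

End Pencil.

Section Class.
Variables (K : numClosedFieldType) (a e r : nat).
Hypothesis r0 : (0 < r)%N.
Let b := (a + e)%N.
Local Notation m := (r.+3).
Local Notation Sg := (@Sigma K a e r).
Local Notation wcol := (@wcolumn K a e).
Local Notation detpoly := (@detpoly K a e r).

Lemma line_of (U : {vspace 'rV[K]_2}) : (\dim U <= 1)%N -> exists w, forall u, u \in U ->
  exists al : K, u = al *: w.
Proof.
move=> dU; exists (vpick U) => u uU; apply/vlineP.
suff -> : <[vpick U]>%VS = U by [].
apply/eqP; rewrite eqEdim -memvE memv_pick dim_vline vpick0 -dimv_eq0.
by case: (\dim U) dU => [|[|]].
Qed.

Lemma dot_mulmx n (c : 'rV[K]_n) (B : 'M[K]_(n, m)) x :
  dot (c *m B) x = \sum_i c 0 i * dot (row i B) x.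
Proof.
rewrite /dot; under eq_bigr => k _ do rewrite mxE mulr_suml.
rewrite exchange_big; apply: eq_bigr => i _; rewrite mulr_sumr.
by apply: eq_bigr => k _; rewrite mxE mulrA.
Qed.

Lemma basis_mem (h : Gr K 3 m) i : row i (basis_mx h) \in val h.
Proof. by rewrite rowK; apply/vbasis_mem/mem_nth; rewrite size_tuple (eqP (valP h)). Qed.

Lemma dim_meet (h : Gr K 3 m) x y :
  (\dim (ann r x y :&: val h) + \dim (ann_map r x y @: val h) = 3)%N.
Proof. by rewrite capvC -[RHS](eqP (valP h)) -(limg_ker_dim (ann_map r x y) (val h)). Qed.

Lemma meet_line_minors (h : Gr K 3 m) x y : (2 <= \dim (ann r x y :&: val h))%N ->
  forall i j, hv (basis_mx h) x i * hv (basis_mx h) y j = hv (basis_mx h) x j * hv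
    (basis_mx h) y i.
Proof.
move=> d2; have dE := dim_meet h x y.
have [|w hw] := @line_of (ann_map r x y @: val h)%VS.
  have G (p q : nat) : (p + q = 3 -> 2 <= p -> q <= 1)%N by clear; lia.
  exact: G dE d2.
have F i : exists al, hv (basis_mx h) x i = al * w 0 ord0 /\ hv (basis_mx h) y i = al * w 0
  ord_max.
  have [al alE] := hw _ (memv_img (ann_map r x y) (basis_mem h (inord i))).
  exists al; have E j := congr1 (fun u : 'rV_2 => u 0 j) alE.
  by have := E ord0; have := E ord_max; rewrite !lfunE !mxE /hv /dot => <- <-; split;
    apply: eq_bigr => k _; rewrite !mxE.
move=> i j; have [al [-> ->]] := F i; have [be [-> ->]] := F j; ring.
Qed.

Lemma minors_meet_line (h : Gr K 3 m) x y mu :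
  (forall i, (i < 3)%N -> hv (basis_mx h) y i = mu * hv (basis_mx h) x i) ->
  (2 <= \dim (ann r x y :&: val h))%N.
Proof.
move=> hmu; have dE := dim_meet h x y.
suff d1 : (\dim (ann_map r x y @: val h) <= 1)%N.
  have G (p q : nat) : (p + q = 3 -> q <= 1 -> 2 <= p)%N by clear; lia.
  exact: G dE d1.
pose w : 'rV[K]_2 := \row_j if j == ord0 then 1 else mu.
apply: (@leq_trans (\dim <[w]>)); last by rewrite dim_vline; case: (_ != _).
apply/dimvS/subvP => _ /memv_imgP[v vh ->]; apply/vlineP; exists (dot v x).
have dy : dot v y = mu * dot v x.
  have [c ->] := mem_basis_mx vh; rewrite !dot_mulmx mulr_sumr; apply: eq_bigr => i _.
  by have := hmu i (ltn_ord i); rewrite /hv inord_val => ->; ring.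
rewrite lfunE; apply/rowP => j; rewrite !mxE.
case: (eqVneq j ord0) => j0.
  by rewrite mulr1 /dot; apply: eq_bigr => k _; rewrite mxE j0.
by rewrite mulrC -dy /dot; apply: eq_bigr => k _; rewrite mxE (negPf j0).
Qed.

Definition det_infty (H : 'M[K]_(3, m)) : K :=
  det3 (hv H (pvec 1 0)) (hv H (qvec1 a 1 0)) (hv H (qvec2 a b 1 0)) 0 1 2.

Definition det_directrix (H : 'M[K]_(3, m)) : K := minor3 H ord0 (inord 1) (inord 2).

Definition discriminant (H : 'M[K]_(3, m)) : K :=
  \det (elim_mx (a + b) (a + b) (fun j => j.+1%:R * (detpoly H)`_j.+1)
                                (fun j => ((a + b).+1 - j)%:R * (detpoly H)`_j)).

(** A plane is general enough if the first two coordinate forms have independent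
    restrictions to it, if no member with t = 0 meets it in a line, and if
    [detpoly] has degree n and no multiple root. *)
Definition class_obstruction (h : Gr K 3 m) : K :=
  let H := basis_mx h in det_directrix H * det_infty H * (detpoly H)`_(a + b).+1 *
    discriminant H.

Lemma hform_elim k l : hform plrow 1 (fun h : Gr K 3 m =>
  elim_mx (a + b) (a + b) (fun j => j.+1%:R * (detpoly (basis_mx h))`_j.+1)
    (fun j => ((a + b).+1 - j)%:R * (detpoly (basis_mx h))`_j) k l).
Proof.
suff : hform plrow 1 (fun h : Gr K 3 m => if (a + b <= k)%N then
    \sum_(i < (a + b).+1) (l == (k - (a + b)) + i :> nat)%N%:R * (i.+1%:R * (detpoly
      (basis_mx h))`_i.+1)
  else \sum_(j < (a + b).+1) (l == k + j :> nat)%N%:R * (((a + b).+1 - j)%:R * (detpoly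
    (basis_mx h))`_j)).
  apply: hform_eq => h; rewrite mxE; case: ifP => _; apply: eq_bigr => i _; exact: mulrC.
by case: (a + b <= k)%N; apply: hform_sum => i _; do 2 apply: hformZ; apply: hform_detpoly.
Qed.

Lemma hform_class_obstruction : exists d, hform plrow d class_obstruction.
Proof.
have hres : hform plrow ((a + b + (a + b)).+1 * 1) (fun h : Gr K 3 m =>
  discriminant (basis_mx h)).
  exact: hform_det hform_elim.
have h1 := @hform_minor3 K r ord0 (inord 1) (inord 2).
have h2 := @hform_det3_hv K r (pvec 1 0) (qvec1 a 1 0) (qvec2 a b 1 0).
by eexists; apply: hformM (hformM (hformM h1 h2) (@hform_detpoly K a e r (a + b).+1)) hres.
Qed.

Lemma bform_horner (p : {poly K}) d x : (size p <= d.+1)%N ->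
  bform d (fun i => p`_i) x 1 = p.[x].
Proof.
move=> sp; rewrite (horner_coef_wide _ sp) /bform; apply: eq_bigr => i _.
by rewrite expr1n mulr1.
Qed.

(** A common zero of a polynomial and its derivative is, by Euler's relation, a
    common zero of the two partial derivatives of the associated binary form,
    whose coefficients appear in [discriminant]. *)
Lemma discriminant_simple H x : discriminant H != 0 ->
  ~ ((detpoly H).[x] = 0 /\ (detpoly H)^`().[x] = 0).
Proof.
move=> dn [h0 h1]; have sD := @size_detpoly K a e r H.
move: dn; rewrite /discriminant (@elim_root _ _ _ _ _ x 1) ?eqxx ?oner_eq0 ?orbT //.
  rewrite -[RHS]h1 -(@bform_horner _ (a + b)).
    by rewrite /bform; apply: eq_bigr => i _; rewrite coef_deriv mulr_natl.
  by rewrite (leq_trans (size_poly _ _)) // -subn1 leq_subLR add1n.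
pose G := (a + b).+1%:R *: detpoly H - 'X * (detpoly H)^`().
have GE j : G`_j = ((a + b).+1 - j)%:R * (detpoly H)`_j.
  rewrite coefB coefZ coefXM coef_deriv.
  case: (ltnP (a + b).+1 j) => hj.
    rewrite (nth_default 0 (leq_trans sD hj)) !mulr0.
    by case: j hj => //= j hj; rewrite (nth_default 0 (leq_trans sD hj)) mul0rn subrr.
  rewrite natrB // mulrBl; congr (_ - _); case: j hj => [|j] _; first by rewrite mul0r.
  by rewrite mulr_natl.
have sG : (size G <= (a + b).+1)%N.
  apply/leq_sizeP => j hj; rewrite GE; move: hj; rewrite leq_eqVlt => /orP[/eqP <-|hj].
    by rewrite subnn mul0r.
  by rewrite (nth_default 0 (leq_trans sD hj)) mulr0.
transitivity (G.[x]); last by rewrite /G hornerD hornerN hornerZ hornerM h0 h1 !mulr0 subrr.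
by rewrite -(bform_horner _ sG) /bform; apply: eq_bigr => i _; rewrite GE.
Qed.

(** For the plane with this basis, [detpoly] is a multiple of X^n + 1. *)
Definition good_mx : 'M[K]_(3, m) :=
  \matrix_(i, k) nth 0 [:: (k == 0 :> nat)%:R; (k == 1 :> nat)%:R;
    (k == 2 :> nat)%:R + (k == 3 :> nat)%:R] i.

Lemma ltn4_r3 k : (k < 4)%N -> (k < m)%N.
Proof. by move=> k4; apply: leq_trans k4 _; rewrite !ltnS. Qed.

Definition good_map : 'Hom('rV[K]_3, 'rV[K]_m) := linfun (mulmxr good_mx).

Lemma good_row (c : 'rV[K]_3) : exists al be ga : K,
  [/\ c *m good_mx = 0 -> c = 0,
  forall x, dot (c *m good_mx) x = al * x 0%N + be * x 1%N + ga * (x 2 + x 3) &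
  forall k : 'I_m, (c *m good_mx) 0 k =
    al * (k == 0 :> nat)%:R + be * (k == 1 :> nat)%:R + ga * ((k == 2 :> nat)%:R + (k == 3
      :> nat)%:R)].
Proof.
exists (c 0 (inord 0)), (c 0 (inord 1)), (c 0 (inord 2)).
have E (k : 'I_m) : (c *m good_mx) 0 k = c 0 (inord 0) * (k == 0 :> nat)%:R
    + c 0 (inord 1) * (k == 1 :> nat)%:R + c 0 (inord 2) * ((k == 2 :> nat)%:R + (k == 3 :>
      nat)%:R).
  rewrite mxE !big_ord_recl big_ord0 addr0 !mxE /= addrA.
  by congr (c 0 _ * _ + c 0 _ * _ + c 0 _ * _); apply/val_inj; rewrite /= inordK.
have co_E x k : (k < m)%N -> co (c *m good_mx) k * x k = (c 0 (inord 0) * (k == 0)%:R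
    + c 0 (inord 1) * (k == 1)%:R + c 0 (inord 2) * ((k == 2)%:R + (k == 3)%:R)) * x k :> K.
  by move=> km; rewrite /co E inordK.
split=> // [c0|x].
  have h k : (k < 4)%N -> _ := fun k4 => esym (co_E (fun=> 1) k (ltn4_r3 k4)).
  have {}h k : (k < 4)%N -> c 0 (inord 0) * (k == 0)%:R
    + c 0 (inord 1) * (k == 1)%:R + c 0 (inord 2) * ((k == 2)%:R + (k == 3)%:R) = 0 :> K.
    by move=> k4; have := h k k4; rewrite /co c0 mxE mul0r mulr1.
  have := h 0%N isT; have := h 1%N isT; have := h 2%N isT.
  rewrite /= !(mulr0, mulr1, addr0, add0r) => e2 e1 e0.
  apply/rowP => j; rewrite mxE -[j]inord_val.
  by case: j => -[|[|[|//]]].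
rewrite (@dot_supp _ _ _ _ [:: 0; 1; 2; 3]%N) //.
- by rewrite !big_cons big_nil !co_E ?ltn4_r3 //=; ring.
- by move=> k; rewrite !inE => h; apply: ltn4_r3; move: h; clear; lia.
move=> k km; rewrite !inE !negb_or => /and4P[/negPf k0 /negPf k1 /negPf k2 /negPf k3].
by rewrite co_E // k0 k1 k2 k3 !(mulr0, addr0) mul0r.
Qed.

Lemma good_subproof : \dim (limg good_map) == 3.
Proof.
apply/eqP; rewrite limg_dim_eq ?dimvf ?dim_matrix //.
apply/eqP; rewrite capfv -subv0; apply/subvP => c; rewrite memv_ker lfunE /= memv0 => /eqP h.
by have [? [? [? [-> // _ _]]]] := good_row c.
Qed.

Definition good_plane : Gr K 3 m :=
  exist (fun U : {vspace 'rV[K]_m} => \dim U == 3) (limg good_map) good_subproof.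

Lemma class_obstruction_neq0 : class_obstruction good_plane != 0.
Proof.
pose H := basis_mx good_plane.
have [al hal] : exists al : nat -> nat -> K, forall i, (i < 3)%N -> forall x, hv H x i =
     al i 0%N * x 0%N + al i 1%N * x 1%N + al i 2%N * (x 2 + x 3).
  have h (i : nat) : exists al : nat -> K, forall x, hv H x i =
      al 0%N * x 0%N + al 1%N * x 1%N + al 2%N * (x 2 + x 3).
    have := basis_mem good_plane (inord i); rewrite /= => /memv_imgP[c _ cE].
    have [x0 [x1 [x2 [_ h _]]]] := good_row c.
    exists (fun j => if j == 0%N then x0 else if j == 1%N then x1 else x2) => x /=.
    by rewrite /hv cE lfunE /= h.
  by have [al h'] := choice h; exists al => i _; apply: h'.
have HE i (k : nat) : (i < 3)%N -> (k < m)%N -> H (inord i) (inord k) =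
    al i 0%N * (k == 0)%:R + al i 1%N * (k == 1)%:R + al i 2%N * ((k == 2)%:R + (k == 3)%:R).
  move=> i3 km; have := hal i i3 (fun l => (l == k)%:R); rewrite ![in RHS](eq_sym _ k) => <-.
  by rewrite /hv -co_dot // /co [RHS]mxE.
pose de := det3 (fun i => al i 0%N) (fun i => al i 1%N) (fun i => al i 2%N) 0 1 2.
have de0 : de != 0.
  apply/eqP => dE; have : det3 (al 0%N) (al 1%N) (al 2%N) 0 1 2 = 0.
    by rewrite -dE /de /det3; ring.
  move=> /det3_0[y0 [y1 [y2 [y_ne0 yal]]]].
  have [i zi] := plrow_neq0 good_plane.
  move/eqP: zi; apply; rewrite mxE; apply/eqP/det0P.
  exists (\row_j if j == 0 :> nat then y0 else if j == 1 :> nat then y1 else y2).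
    apply/rV0Pn; case/or3P: y_ne0 => yn.
    - by exists (inord 0); rewrite mxE inordK.
    - by exists (inord 1); rewrite mxE inordK.
    by exists (inord 2); rewrite mxE inordK.
  apply/rowP => j; rewrite !mxE !big_ord_recl big_ord0 addr0 !mxE -/H /=.
  set k := ksub_nth _ j.
  have HE' i' (i3 : (i' < 3)%N) := HE i' k i3 (ltn_ord k); rewrite inord_val in HE'.
  have E i' : (i' < 3)%N -> (vbasis (limg good_map))`_i' 0 k = H (inord i') k.
    by move=> i3; rewrite mxE inordK.
  rewrite -[bump 0 (bump 0 0)]/2%N -[bump 0 0]/1%N !E // !HE' //.
  have := yal 0%N isT; have := yal 1%N isT; have := yal 2%N isT => z2 z1 z0.
  transitivity ((y0 * al 0%N 0%N + y1 * al 1%N 0%N + y2 * al 2%N 0%N) * (k == 0 :> nat)%:R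
    + (y0 * al 0%N 1%N + y1 * al 1%N 1%N + y2 * al 2%N 1%N) * (k == 1 :> nat)%:R
    + (y0 * al 0%N 2%N + y1 * al 1%N 2%N + y2 * al 2%N 2%N) * ((k == 2 :> nat)%:R + (k == 3
      :> nat)%:R)); first by ring.
  by rewrite z0 z1 z2 !mul0r !addr0.
have dm : det_directrix H = de.
  have e0 : (ord0 : 'I_m) = inord 0 by apply/val_inj; rewrite /= inordK.
  by rewrite /det_directrix /minor3 /det3 e0 !HE ?ltn4_r3 //= /de /det3; ring.
have di : det_infty H = - de.
  rewrite /det_infty /det3 !hal // !pvec_0 !pvec_1 !pvec_ge2 // qvec1_0 qvec1_1 qvec1_2
    qvec1_3.
  by rewrite qvec2_0 qvec2_1 qvec2_2 qvec2_3 !expr1n /de /det3; ring.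
have dd : detpoly H = - de *: ('X^((a + b).+1) + 1).
  apply/eqP; rewrite -subr_eq0; apply: contraT => /poly_nonroot[x].
  rewrite (hornerD (detpoly H)) hornerN hornerZ (hornerD 'X^((a + b).+1) 1) hornerXn
    hornerC horner_detpoly /det3 !hal //.
  rewrite !pvec_0 !pvec_1 !pvec_ge2 // qvec1_0 qvec1_1 qvec1_2 qvec1_3.
  rewrite qvec2_0 qvec2_1 qvec2_2 qvec2_3 !expr1n (exprS x (a + b)) (exprD x a b) /de /det3.
  by move=> /eqP; case; ring.
have dc j : (detpoly H)`_j = - de * ((j == (a + b).+1)%:R + (j == 0)%:R).
  by rewrite dd coefZ coefD coefXn coef1.
rewrite /class_obstruction -/H dm di dc eqxx addr0 mulr1 /discriminant.
rewrite (@elim_diag _ _ _ _ _ (- de * (a + b).+1%:R)).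
- by rewrite !mulf_neq0 ?expf_neq0 ?mulf_neq0 ?oppr_eq0 // pnatr_eq0.
- move=> j _; rewrite dc addr0 eqSS mulrCA -mulrA; congr (_ * _).
  by case: eqP => [->|]; rewrite ?mulr0.
move=> j hj; rewrite dc (_ : (j == _.+1) = false) ?add0r; last by apply/negP => /eqP; lia.
by rewrite mulrCA -mulrA; congr (_ * _); case: eqP => [->|]; rewrite ?subn0 ?mulr0.
Qed.

End Class.

Section Count.
Variables (K : numClosedFieldType) (a e r : nat).
Hypothesis r0 : (0 < r)%N.
Let b := (a + e)%N.
Local Notation m := (r.+3).
Local Notation Sg := (@Sigma K a e r).
Local Notation wcol := (@wcolumn K a e).
Local Notation detpoly := (@detpoly K a e r).
Local Notation det_infty := (@det_infty K a e r).
Local Notation discriminant := (@discriminant K a e r).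

Variable h : Gr K 3 m.
Let H := basis_mx h.
Hypothesis det_directrix0 : det_directrix H != 0.
Hypothesis det_infty0 : det_infty H != 0.
Hypothesis lead0 : (detpoly H)`_(a + b).+1 != 0.
Hypothesis discriminant0 : discriminant H != 0.

Lemma hv_pvec s t i : hv H (pvec s t) i = s * H (inord i) ord0 + t * H (inord i) (inord 1).
Proof.
have R k : row (inord i) H 0 k = H (inord i) k by rewrite mxE.
rewrite /hv dot_pvec /co !R (_ : inord 0 = ord0) //.
by apply/val_inj; rewrite /= inordK.
Qed.

Lemma pvec_neq0 s t : (s != 0) || (t != 0) -> exists2 i, (i < 3)%N & hv H (pvec s t) i != 0.
Proof.
move=> st; apply: contrapT => no.
have z i : (i < 3)%N -> s * H (inord i) ord0 + t * H (inord i) (inord 1) = 0.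
  by move=> i3; rewrite -hv_pvec; apply/eqP/negPn/negP => hi; apply: no; exists i.
have := z 0%N isT; have := z 1%N isT; have := z 2%N isT => z2 z1 z0.
case/orP: st => /negP; apply; rewrite -(mulIr_eq0 _ (mulIf det_directrix0)); apply/eqP.
  rewrite (_ : s * det_directrix H = det3 (fun i =>
    s * H (inord i) ord0 + t * H (inord i) (inord 1))
     (fun i => H (inord i) (inord 1)) (fun i => H (inord i) (inord 2)) 0 1 2).
    by rewrite /det3 z0 z1 z2 !mul0r subrr addr0.
  by rewrite /det_directrix /minor3 /det3; ring.
rewrite (_ : t * det_directrix H = det3 (fun i => H (inord i) ord0)
  (fun i => s * H (inord i) ord0 + t * H (inord i) (inord 1)) (fun i =>
    H (inord i) (inord 2)) 0 1 2).
  by rewrite /det3 z0 z1 z2; ring.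
by rewrite /det_directrix /minor3 /det3; ring.
Qed.

Lemma hv_wvec s t u v i : hv H (wvec a b s t u v) i = u * hv H (qvec1 a s t) i + v * hv H
  (qvec2 a b s t) i.
Proof. exact: dot_wvec. Qed.

(** [z] is a member with (s : t) = (x : 1) that meets the plane in a line. *)
Definition member_at (x : K) (z : Gr K r.+1 m) : Prop := exists u v mu,
  [/\ (u != 0) || (v != 0), val z = ann r (pcol (mkc x 1 u v)) (wcol (mkc x 1 u v)) &
   forall i, (i < 3)%N -> u * hv H (qvec1 a x 1) i + v * hv H (qvec2 a b x 1) i = mu * hv H
     (pvec x 1) i].

Lemma mkc1_coord x u v : (u != 0) || (v != 0) -> Xe_coord (mkc x (1 : K) u v).
Proof.
by move=> uv; rewrite Xe_coordE; have [_ -> -> ->] := mkcE x (1 : K) u v;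
  rewrite oner_eq0 orbT uv.
Qed.

Lemma member_at_meets x z : member_at x z -> Sg z /\ (2 <= \dim (val z :&: val h))%N.
Proof.
move=> [u [v [mu [uv zE hmu]]]]; split; first by exists (mkc x 1 u v) => //; apply: mkc1_coord.
rewrite zE; apply: (minors_meet_line (mu := mu)) => i i3.
have [c1 c2 c3 c4] := mkcE x (1 : K) u v.
by rewrite /pcol /wcolumn c1 c2 c3 c4 -hmu // -hv_wvec.
Qed.

Lemma proportional s t y : (s != 0) || (t != 0) ->
  (forall i j, hv H (pvec s t) i * hv H y j = hv H (pvec s t) j * hv H y i) ->
  exists mu, forall i, hv H y i = mu * hv H (pvec s t) i.
Proof.
move=> /pvec_neq0[j _ pj] hm; exists (hv H y j / hv H (pvec s t) j) => i.
by apply: (mulfI pj); rewrite hm mulrA [_ * (_ / _)]mulrC divfK // mulrC.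
Qed.

Lemma det3_dependent (x y z : nat -> K) u v mu : (u != 0) || (v != 0) ->
  (forall i, (i < 3)%N -> u * y i + v * z i = mu * x i) -> det3 x y z 0 1 2 = 0.
Proof.
move=> uv hm; have h0 := hm 0%N isT; have h1 := hm 1%N isT; have h2 := hm 2%N isT.
case/orP: uv => n0; apply: (mulfI n0); rewrite mulr0.
  transitivity (det3 x (fun i => u * y i + v * z i) z 0 1 2); first by rewrite /det3; ring.
  by rewrite /det3 h0 h1 h2; ring.
transitivity (det3 x y (fun i => u * y i + v * z i) 0 1 2); first by rewrite /det3; ring.
by rewrite /det3 h0 h1 h2; ring.
Qed.

Lemma member_root z : Sg z -> (2 <= \dim (val z :&: val h))%N ->
  exists2 x, (detpoly H).[x] = 0 & member_at x z.
Proof.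
move=> [c hc zE] d2.
have := hc; rewrite Xe_coordE => /andP[st uv].
have [t0|t0] := eqVneq (c 0 it_) 0.
  rewrite t0 eqxx orbF in st.
  have hd : Xe_coord (mkc 1 0 (c 0 iu_ / c 0 is_ ^+ e) (c 0 iv_)).
    rewrite Xe_coordE; have [-> _ -> ->] := mkcE (1 : K) 0 (c 0 iu_ / c 0 is_ ^+ e) (c 0 iv_).
    by rewrite oner_eq0 mulf_eq0 invr_eq0 expf_eq0 (negPf st) andbF orbF.
  have [d1 d2' d3 d4] := mkcE (1 : K) 0 (c 0 iu_ / c 0 is_ ^+ e) (c 0 iv_).
  have cE : c = torus e (c 0 is_) 1 (mkc 1 0 (c 0 iu_ / c 0 is_ ^+ e) (c 0 iv_)).
    apply: eq_coord; rewrite /torus d1 d2' d3 d4 [in RHS]mxE /=.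
    - by rewrite mulr1.
    - by rewrite mulr0.
    - by rewrite mulr1 mulrC divfK // expf_neq0.
    by rewrite mul1r.
  have zE' := ann_torus r0 st (oner_neq0 K) hd cE zE.
  rewrite zE' in d2; have hm := meet_line_minors d2.
  rewrite /pcol /wcolumn d1 d2' d3 d4 in hm.
  have [|mu hmu] := proportional _ hm; first by rewrite oner_eq0.
  move/eqP: det_infty0; case.
  apply: (@det3_dependent _ _ _ (c 0 iu_ / c 0 is_ ^+ e) (c 0 iv_) mu).
    by move: hd; rewrite Xe_coordE d1 d2' d3 d4 => /andP[].
  by move=> i i3; rewrite -hv_wvec hmu.
pose u := c 0 iu_ / c 0 it_ ^+ e; pose x := c 0 is_ / c 0 it_; pose v := c 0 iv_.
have [d1 d2' d3 d4] := mkcE x (1 : K) u v.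
have uv' : (u != 0) || (v != 0).
  by rewrite /u mulf_eq0 invr_eq0 expf_eq0 (negPf t0) andbF orbF.
have hd := mkc1_coord x uv'.
have cE : c = torus e (c 0 it_) 1 (mkc x 1 u v).
  apply: eq_coord; rewrite /torus d1 d2' d3 d4 [in RHS]mxE /=.
  - by rewrite /x mulrC divfK.
  - by rewrite mulr1.
  - by rewrite /u mulr1 mulrC divfK // expf_neq0.
  by rewrite mul1r.
have zE' := ann_torus r0 t0 (oner_neq0 K) hd cE zE.
rewrite zE' in d2; have hm := meet_line_minors d2.
rewrite /pcol /wcolumn d1 d2' d3 d4 in hm.
have [|mu hmu] := proportional _ hm; first by rewrite oner_eq0 orbT.
have rel i : (i < 3)%N -> u * hv H (qvec1 a x 1) i + v * hv H (qvec2 a b x 1) i = mu * hv H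
  (pvec x 1) i.
  by move=> _; rewrite -hv_wvec hmu.
exists x; first by rewrite horner_detpoly; apply: det3_dependent uv' rel.
by exists u, v, mu.
Qed.

Lemma root_member x : (detpoly H).[x] = 0 -> exists z, member_at x z.
Proof.
rewrite horner_detpoly => /det3_0[al [u [v [aluv rel]]]].
have uv : (u != 0) || (v != 0).
  apply/negPn/negP; rewrite negb_or !negbK => /andP[/eqP u0 /eqP v0].
  have al0 : al != 0 by move: aluv; rewrite u0 v0 eqxx !orbF.
  have [|i i3] := @pvec_neq0 x 1; first by rewrite oner_eq0 orbT.
  move/eqP; apply; apply: (mulfI al0); rewrite mulr0.
  by have := rel i i3; rewrite u0 v0 !mul0r !addr0.
have [z _ zE] := Sigma_mem a e r0 (mkc1_coord x uv); exists z, u, v, (- al); split=> // i i3.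
by have /eqP := rel i i3; rewrite -addrA addrC addr_eq0 mulNr => /eqP.
Qed.

(** Two such members would make the restrictions of [qvec1] and [qvec2] multiples of
    that of [pvec], and [x] a double root. *)
Lemma member_at_inj x z z' : member_at x z -> member_at x z' -> z = z'.
Proof.
move=> [u [v [mu [uv zE rel]]]] [u' [v' [mu' [uv' zE' rel']]]].
have [d0|d0] := eqVneq (u * v' - u' * v) 0; last first.
  exfalso; apply: (discriminant_simple (x := x) discriminant0).
  apply: (@double_root _ _ _ _ _ ((v' * mu - v * mu') / (u * v' - u' * v))
                                 ((u * mu' - u' * mu) / (u * v' - u' * v))) => i i3;
    have [-> h1 h2] := horner_hvp a e H x i; rewrite ?h1 ?h2; apply: (mulfI d0).
    rewrite mulrA [_ * (_ / _)]mulrC divfK //.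
    transitivity (v' * (mu * hv H (pvec x 1) i) - v * (mu' * hv H (pvec x 1) i)); last by ring.
    by rewrite -rel // -rel' //; ring.
  rewrite mulrA [_ * (_ / _)]mulrC divfK //.
  transitivity (u * (mu' * hv H (pvec x 1) i) - u' * (mu * hv H (pvec x 1) i)); last by ring.
  by rewrite -rel // -rel' //; ring.
have [|||k k0 [uE vE]] := @perp2 _ u' v' v (- u) => //.
- by rewrite oppr_eq0 orbC.
- by rewrite -[RHS]oppr0 -d0; ring.
have nk0 : - k != 0 by rewrite oppr_eq0.
apply/val_inj; rewrite zE; apply/esym.
apply: (ann_torus r0 (oner_neq0 K) nk0 (mkc1_coord x uv) _ zE').
have [d1 d2 d3 d4] := mkcE x (1 : K) u v; have [e1 e2 e3 e4] := mkcE x (1 : K) u' v'.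
apply: eq_coord; rewrite ?e1 ?e2 ?e3 ?e4 /torus d1 d2 d3 d4 [in RHS]mxE /=.
- by rewrite mul1r.
- by rewrite mulr1.
- by rewrite uE expr1n; ring.
by rewrite vE; ring.
Qed.

(** If [z] belongs to two points of the projective line, both values of [pvec] are
    equations of it, and so its equations are spanned by the first two coordinate
    forms, whose restrictions to the plane are independent. *)
Lemma member_at_root_inj x x' z : member_at x z -> member_at x' z -> x = x'.
Proof.
move=> mz mz'; have [_ d2] := member_at_meets mz.
move: mz mz' => [u [v [mu [uv zE _]]]] [u' [v' [mu' [uv' zE' _]]]].
apply/eqP; rewrite -subr_eq0; apply/negPn/negP => xx.
pose de k (l : nat) : K := (l == k)%:R.
have ind : indep r (de 0%N) (de 1%N).
  move=> al be hab; have := hab 0%N isT; have := hab 1%N isT; rewrite /de /=.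
  by rewrite !mulr1 !mulr0 addr0 add0r.
have zD : val z = ann r (de 0%N) (de 1%N).
  apply/eqP; rewrite eqEdim (eqP (dim_ann ind)) (eqP (valP z)) leqnn andbT.
  apply/subvP => w wz; have := wz; have := wz.
  move=> /(mem_Sigma w zE)[+ _] /(mem_Sigma w zE')[+ _].
  have [-> -> _ _] := mkcE x (1 : K) u v; have [-> -> _ _] := mkcE x' (1 : K) u' v'.
  rewrite !mul1r => h1 h2; rewrite mem_ann -!co_dot //.
  have w0 : co w 0 = 0.
    apply: (mulfI xx); rewrite mulr0.
    transitivity ((x * co w 0 + co w 1) - (x' * co w 0 + co w 1)); first by ring.
    by rewrite h1 h2 subrr.
  by move: h1; rewrite w0 mulr0 add0r => ->; rewrite eqxx.
rewrite zD in d2; have hm := meet_line_minors d2.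
have E (i k : nat) : (k < m)%N -> hv H (de k) i = H (inord i) (inord k).
  by move=> km; rewrite /hv -co_dot // /co [LHS]mxE.
have {}hm i j : H (inord i) (inord 0) * H (inord j) (inord 1) = H (inord j) (inord 0) * H
  (inord i) (inord 1).
  by have := hm i j; rewrite -/H !E.
move/eqP: det_directrix0; apply; rewrite /det_directrix /minor3.
rewrite (_ : ord0 = inord 0); last by apply/val_inj; rewrite /= inordK.
transitivity (\sum_(p <- [:: (0, 1, 2); (1, 2, 0); (2, 0, 1)]%N)
   H (inord p.2) (inord 2) * (H (inord p.1.1) (inord 0) * H (inord p.1.2) (inord 1)
                            - H (inord p.1.2) (inord 0) * H (inord p.1.1) (inord 1))).
  by rewrite !big_cons big_nil /det3 /=; ring.
by rewrite big1 // => p _; rewrite hm subrr mulr0.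
Qed.

Lemma class_count : [set s | Sg s /\ (2 <= \dim (val s :&: val h))%N] #= `I_(a + b).+1.
Proof.
have sD : size (detpoly H) = (a + b).+2.
  apply/eqP; rewrite eqn_leq size_detpoly /=; rewrite ltnNge; apply: contra lead0 => sD.
  by rewrite nth_default.
have [rs rsE] := closed_field_poly_normal (detpoly H).
have D0 : detpoly H != 0 by rewrite -size_poly_eq0 sD.
have l0 : lead_coef (detpoly H) != 0 by rewrite lead_coef_eq0.
have srs : size rs = (a + b).+1.
  by move: sD; rewrite rsE size_scale // size_prod_XsubC => -[].
have rootE x : (x \in rs) = ((detpoly H).[x] == 0).
  by rewrite rsE hornerZ mulf_eq0 (negPf l0) -[_.[x] == 0]/(root _ x) root_prod_XsubC.
have urs : uniq rs.
  rewrite -separable_prod_XsubC.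
  rewrite unlock; apply: Pdiv.ClosedField.root_coprimep => x /eqP qx; apply/eqP => q'x.
  apply: (discriminant_simple (x := x) discriminant0).
  by rewrite rsE derivZ !hornerZ qx q'x mulr0.
have [z0 [_ z0E]] : exists z0, member_at rs`_0 z0 /\ True.
  have [z hz] : exists z, member_at rs`_0 z; last by exists z.
  by apply: root_member; apply/eqP; rewrite -rootE mem_nth // srs.
have ex_member x : exists z, (detpoly H).[x] = 0 -> member_at x z.
  have [hx|hx] := eqVneq (detpoly H).[x] 0; last by exists z0 => h0; rewrite h0 eqxx in hx.
  by have [z hz] := root_member hx; exists z.
have [phi hphi] := choice ex_member.
have rsi i : (i < (a + b).+1)%N -> (detpoly H).[rs`_i] = 0.
  by move=> hi; apply/eqP; rewrite -rootE mem_nth // srs.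
rewrite (_ : [set s | _] = (fun i => phi rs`_i) @` `I_(a + b).+1).
  apply: inj_card_eq => i j /set_mem/= hi /set_mem/= hj eij.
  have mi := hphi _ (rsi i hi); have mj := hphi _ (rsi j hj); rewrite eij in mi.
  apply/eqP; rewrite -(nth_uniq 0 _ _ urs) ?srs //; apply/eqP.
  exact: member_at_root_inj mi mj.
apply/seteqP; split=> z /=.
  move=> [Sz d2]; have [x hx mx] := member_root Sz d2.
  have xrs : x \in rs by rewrite rootE hx.
  exists (index x rs); first by rewrite /= -srs index_mem.
  by rewrite nth_index //; apply: member_at_inj (hphi _ hx) mx.
by move=> [i hi <-]; apply: (@member_at_meets rs`_i); apply/hphi/rsi.
Qed.

End Count.

Lemma Sigma_class (K : numClosedFieldType) (a e r : nat) : (0 < r)%N ->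
  has_class (@Sigma K a e r) (a + (a + e)).+1.
Proof.
move=> r0; exists [set h | class_obstruction a e h = 0]; split.
- have [d hd] := @hform_class_obstruction K a e r.
  exact/gr_closed_form/(hform_closed_zero hd).
- by move=> /(_ (good_plane K r0) I) /=; exact/eqP/class_obstruction_neq0.
move=> h _ /= /eqP; rewrite /class_obstruction !mulf_eq0 !negb_or =>
  /andP[/andP[/andP[h1 h2] h3] h4].
exact: class_count.
Qed.

(** * The rational normal ruled surface *)

Section NormalScroll.
Variables (K : numClosedFieldType) (a e : nat).
Let b := (a + e)%N.
Local Notation n3 := ((a + b).+4).

(** The exponents of the monomials u s^l t^(a+1-l), followed by v s^j t^(b+1-j). *)
Definition scroll_mon (l : nat) : 'X_{1..2 + 2} :=
  [multinom nth 0%N (if (l < a.+2)%N then [:: l; a.+1 - l; 1; 0]%N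
                     else [:: l - a.+2; b.+1 - (l - a.+2); 0; 1]%N) i | i < 2 + 2].

Definition scroll (l : 'I_n3) : {mpoly K[2 + 2]} := 'X_[scroll_mon l].

Lemma scroll_monE l : [/\ scroll_mon l is_ = (if l < a.+2 then l else l - a.+2)%N,
  scroll_mon l it_ = (if l < a.+2 then a.+1 - l else b.+1 - (l - a.+2))%N,
  scroll_mon l iu_ = (if l < a.+2 then 1 else 0)%N &
    scroll_mon l iv_ = (if l < a.+2 then 0 else 1)%N].
Proof. by split; rewrite mnmE; case: ifP. Qed.

Lemma scroll_section l : Xe_section e 1 b.+1 (scroll l).
Proof.
rewrite Xe_sectionE => mu; rewrite msuppX inE => /eqP->.
have hl := ltn_ord l; have [-> -> -> ->] := scroll_monE l.
by rewrite /b in hl *; case: ltnP => h1; rewrite ?muln1 ?muln0; split=> //; move: h1 hl;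
  clear; lia.
Qed.

Lemma eq_mnm4 (mu nu : 'X_{1..2 + 2}) : mu is_ = nu is_ -> mu it_ = nu it_ ->
  mu iu_ = nu iu_ -> mu iv_ = nu iv_ -> mu = nu.
Proof.
move=> h1 h2 h3 h4; apply/mnmP => -[[|[|[|[|//]]]] hl].
- by move: h1; congr (mu _ = nu _); apply/val_inj.
- by move: h2; congr (mu _ = nu _); apply/val_inj.
- by move: h3; congr (mu _ = nu _); apply/val_inj.
by move: h4; congr (mu _ = nu _); apply/val_inj.
Qed.

Lemma scroll_mon_inj (l l' : 'I_n3) : scroll_mon l = scroll_mon l' -> l = l'.
Proof.
move=> h; apply/val_inj => /=.
have := congr1 (fun mu : 'X_{1..2 + 2} => mu is_) h.
have := congr1 (fun mu : 'X_{1..2 + 2} => mu iu_) h => /=.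
have [-> _ -> _] := scroll_monE l; have [-> _ -> _] := scroll_monE l'.
by case: ltnP => h1; case: ltnP => h2 //; lia.
Qed.

Lemma scroll_mon_surj (mu : 'X_{1..2 + 2}) : (mu iu_ + mu iv_ = 1)%N ->
  (mu is_ + mu it_ + e * mu iu_ = b.+1)%N -> exists l : 'I_n3, scroll_mon l = mu.
Proof.
move=> h1 h2; have [u1|u0] : mu iu_ = 1%N \/ mu iu_ = 0%N by lia.
  have hl : (mu is_ < a.+2)%N by move: h2; rewrite u1 /b; lia.
  have hl3 : (mu is_ < n3)%N by rewrite /b; lia.
  exists (Ordinal hl3); have [m1 m2 m3 m4] := scroll_monE (mu is_); rewrite hl in m1 m2 m3 m4.
  by apply: eq_mnm4; rewrite /= ?m1 ?m2 ?m3 ?m4 //; move: h2; rewrite u1 /b; lia.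
have hl3 : (a.+2 + mu is_ < n3)%N by move: h2; rewrite u0 /b; lia.
exists (Ordinal hl3); have [m1 m2 m3 m4] := scroll_monE (a.+2 + mu is_).
rewrite ltnNge leq_addr /= addKn in m1 m2 m3 m4.
by apply: eq_mnm4; rewrite /= ?m1 ?m2 ?m3 ?m4 //; move: h2; rewrite u0; lia.
Qed.

Lemma coef_scroll (c : 'I_n3 -> K) (l : 'I_n3) : (\sum_l c l *: scroll l)@_(scroll_mon l) =
  c l.
Proof.
rewrite raddf_sum /= (bigD1 l) //= mcoeffZ mcoeffX eqxx mulr1 big1 ?addr0 // => l' ll.
rewrite mcoeffZ mcoeffX (_ : (_ == _) = false) ?mulr0 //.
by apply: contraNF ll => /eqP/scroll_mon_inj->.
Qed.

Lemma scroll_complete : complete_linear_system e 1 b.+1 scroll.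
Proof.
split=> [l|p hp]; first exact: scroll_section.
exists (fun l => p@_(scroll_mon l)); split=> [|c pE]; last first.
  by apply/funext => l; rewrite pE coef_scroll.
apply/mpolyP => mu.
have [[l <-]|no] := pselect (exists l : 'I_n3, scroll_mon l = mu);
  first by rewrite coef_scroll.
rewrite raddf_sum /= big1 => [|l _]; last first.
  rewrite mcoeffZ mcoeffX (_ : (_ == _) = false) ?mulr0 //.
  by apply/negP => /eqP h; apply: no; exists l.
apply/memN_msupp_eq0/negP; move: hp; rewrite Xe_sectionE => hp /hp[h1 h2].
by apply: no; apply: scroll_mon_surj.
Qed.

Lemma meval_scroll (l : 'I_n3) (c : 'rV[K]_(2 + 2)) : (scroll l).@[c 0] =
  if (l < a.+2)%N then c 0 iu_ * c 0 is_ ^+ l * c 0 it_ ^+ (a.+1 - l)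
  else c 0 iv_ * c 0 is_ ^+ (l - a.+2) * c 0 it_ ^+ (b.+1 - (l - a.+2)).
Proof.
have [m1 m2 m3 m4] := scroll_monE l.
by rewrite mevalX prod4 m1 m2 m3 m4; case: ifP => _; rewrite expr1 expr0; ring.
Qed.

Lemma section_linear j (F : {mpoly K[2 + 2]}) s t u v : Xe_section e 1 j F ->
  F.@[mkc s t u v 0] = u * F.@[mkc s t 1 0 0] + v * F.@[mkc s t 0 1 0].
Proof.
rewrite Xe_sectionE => hF; rewrite !mevalE !mulr_sumr -big_split [LHS]big_seq [RHS]big_seq.
apply: eq_bigr => mu /hF[h _] /=.
rewrite !prod4 !mxE /=.
have [[-> ->]|[-> ->]] : (mu iu_ = 1 /\ mu iv_ = 0)%N \/ (mu iu_ = 0 /\ mu iv_ = 1)%N.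
  by move: h; clear; lia.
  by rewrite !expr1 !expr0; ring.
by rewrite !expr1 !expr0; ring.
Qed.

End NormalScroll.

(** * The invariant *)
Section Invariant.
Variables (K : numClosedFieldType) (a e r : nat).
Hypothesis r0 : (0 < r)%N.
Let b := (a + e)%N.
Local Notation m := (r.+3).
Local Notation Sg := (@Sigma K a e r).
Local Notation wcol := (@wcolumn K a e).
Local Notation N := #|ksub r.+1 m|.
Local Notation n3 := ((a + b).+4).
Local Notation scroll := (@scroll K a e).

(* the Plücker coordinates of the members, as in [plucker_param] *)
Variable Dp : 'I_N -> {mpoly K[2 + 2]}.
Hypothesis hD : forall i, Xe_section e 1 b.+1 (Dp i).
Hypothesis DE : forall z c, Xe_coord c -> val z = ann r (pcol c) (wcol c) ->
  exists2 lam : K, lam != 0 & plrow z = lam *: eval_forms Dp c.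

(* their expression in the monomials of the normal model *)
Variable al : 'I_N -> 'I_n3 -> K.
Hypothesis alE : forall i, Dp i = \sum_l al i l *: scroll l.

(* linear forms giving the dual Plücker coordinates 02, 12 and 03 *)
Variables F02 F12 F03 : {mpoly K[N]}.
Hypotheses (h02 : F02 \is 1.-homog) (h12 : F12 \is 1.-homog) (h03 : F03 \is 1.-homog).
Hypotheses (e02 : forall z : Gr K r.+1 m, dplk z 0 2 = F02.@[plrow z 0])
           (e12 : forall z : Gr K r.+1 m, dplk z 1 2 = F12.@[plrow z 0])
           (e03 : forall z : Gr K r.+1 m, dplk z 0 3 = F03.@[plrow z 0]).

Local Notation D := (eval_forms Dp).
Local Notation Phi := (eval_forms scroll).
Implicit Types c : 'rV[K]_(2 + 2).

Definition scroll_proj i : {mpoly K[n3]} := \sum_l al i l *: 'X_l.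

Lemma scroll_proj_homog i : scroll_proj i \is 1.-homog.
Proof. by apply: rpred_sum => l _; apply: dhomogZ; rewrite dhomogX /= mdeg1. Qed.

Lemma scroll_proj_Phi lam c : eval_forms scroll_proj (lam *: Phi c) = lam *: D c.
Proof.
apply/rowP => i; rewrite mxE (meval_dhomog _ _ (scroll_proj_homog i)) expr1 !mxE;
  congr (_ * _).
rewrite alE !raddf_sum; apply: eq_bigr => l _ /=.
by rewrite !mevalZ mevalXU mxE.
Qed.

Lemma D_neq0 c : Xe_coord c -> D c != 0.
Proof.
move=> hc; have [z _ zE] := Sigma_mem a e r0 hc; have [lam _ lE] := DE hc zE.
have [i0] := plrow_neq0 z; apply: contraNneq => D0.
by rewrite lE D0 scaler0 mxE.
Qed.

Lemma Phi_neq0 c : Xe_coord c -> Phi c != 0.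
Proof.
by move=> /D_neq0; apply: contraNneq => P0;
  rewrite -[D c]scale1r -scroll_proj_Phi P0 scaler0 -(scale0r (Phi c)) scroll_proj_Phi
  scale0r.
Qed.

Lemma maps_scroll_proj (x : Gr K 1 n3) (y : Gr K 1 N) c : Xe_coord c -> val x = <[Phi c]>%VS ->
  maps_to scroll_proj x y <-> val y = <[D c]>%VS.
Proof.
move=> hc xE; split=> [[v xv ->]|yE].
  rewrite xE in xv; have [lam l0 ->] := line_eq (Phi_neq0 hc) xv.
  by rewrite scroll_proj_Phi lineZ.
by exists (Phi c) => //; rewrite -[Phi c]scale1r scroll_proj_Phi scale1r.
Qed.

Lemma image_Sigma (y : Gr K 1 N) : (plucker @` Sg) y <-> exists2 c,
  Xe_coord c & val y = <[D c]>%VS.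
Proof.
split=> [[z [c hc zE] <-]|[c hc yE]].
  by exists c => //; have [lam l0 lE] := DE hc zE; rewrite /= -/(plrow z) lE lineZ.
have [z Sz zE] := Sigma_mem a e r0 hc; exists z => //.
by apply/val_inj; rewrite yE; have [lam l0 lE] := DE hc zE; rewrite /= -/(plrow z) lE lineZ.
Qed.

(** With w = u qvec1 + v qvec2, the dual Plücker coordinates with indices 02, 12
    and 03 are s u s^a, t u s^a and s v t^b. These forms in them recover s, t,
    u, v up to the action of the torus. *)
Definition inv_tuple : (2 + 2).-tuple {mpoly K[N]} := [tuple F02; F12; F02 * F12 ^+ b;
  F03 * F02 ^+ a].

Definition scroll_inv (l : 'I_n3) : {mpoly K[N]} := scroll l \mPo inv_tuple.

Lemma scroll_inv_homog l : scroll_inv l \is (a + b).+2.-homog.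
Proof.
rewrite /scroll_inv comp_mpolyX prod4 !(tnth_nth 0) /= -!mulrA.
have hU : F02 * F12 ^+ b \is (1 + 1 * b).-homog by apply: dhomogM => //; apply: dhomogMn.
have hV : F03 * F02 ^+ a \is (1 + 1 * a).-homog by apply: dhomogM => //; apply: dhomogMn.
have [m1 m2 m3 m4] := scroll_monE a e l.
have := dhomogM (dhomogMn (scroll_mon a e l is_) h02) (dhomogM (dhomogMn (scroll_mon a e l
  it_) h12)
   (dhomogM (dhomogMn (scroll_mon a e l iu_) hU) (dhomogMn (scroll_mon a e l iv_) hV))).
have -> : (1 * scroll_mon a e l is_ + (1 * scroll_mon a e l it_ +
   ((1 + 1 * b) * scroll_mon a e l iu_ + (1 + 1 * a) * scroll_mon a e l iv_)) = (a + b).+2)%N.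
  rewrite m1 m2 m3 m4; have hl := ltn_ord l; rewrite !mul1n.
  by case: ltnP => h1; rewrite ?muln1 ?muln0; move: h1 hl; rewrite /b; clear; lia.
by [].
Qed.

(** The scalar [kap] is the one by which the coordinates 02, 12 and 03 differ from
    the 2x2 minors of [pcol c] and [wcol c]. *)
Lemma inverse_torus c : Xe_coord c -> exists2 kap, kap != 0 &
  [/\ F02.@[D c 0] = kap * (c 0 is_ * (c 0 iu_ * c 0 is_ ^+ a)),
      F12.@[D c 0] = kap * (c 0 it_ * (c 0 iu_ * c 0 is_ ^+ a)) &
      forall lam, eval_forms scroll_inv (lam *: D c) =
        (lam ^+ (a + b).+2 * ((kap * (c 0 iu_ * c 0 is_ ^+ a)) ^+ b.+1 *
          (kap * (c 0 is_ * c 0 it_ ^+ b) * F02.@[D c 0] ^+ a))) *: Phi c].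
Proof.
move=> hc; have [z _ zE] := Sigma_mem a e r0 hc.
have [lam l0 lE] := DE hc zE; have [lam' l0' lnE] := dplk_Sigma r0 hc zE.
pose kap := lam^-1 * lam'.
have m4 k : (k < 4)%N -> (k < m)%N by move=> k4; apply: leq_trans k4 _; rewrite !ltnS.
have FE (F : {mpoly K[N]}) i j : F \is 1.-homog -> dplk z i j = F.@[plrow z 0] ->
  (i < 4)%N -> (j < 4)%N ->
    F.@[D c 0] = kap * (pcol c i * wcol c j - wcol c i * pcol c j).
  move=> hF h i4 j4; rewrite /kap -mulrA -lnE ?m4 // h lE (meval_dhomog _ _ hF) expr1.
  by rewrite mulKf.
have w2 : wcol c 2 = c 0 iu_ * c 0 is_ ^+ a.
  by rewrite /wcolumn /wvec qvec1_2 qvec2_2 mulr0 addr0.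
have w3 : wcol c 3 = c 0 iv_ * c 0 it_ ^+ b.
  by rewrite /wcolumn /wvec qvec1_3 qvec2_3 mulr0 add0r.
have E02 : F02.@[D c 0] = kap * (c 0 is_ * (c 0 iu_ * c 0 is_ ^+ a)).
  by rewrite (FE _ 0%N 2%N h02 (e02 z)) // w2 /pcol pvec_0 pvec_ge2 // mulr0 subr0.
have E12 : F12.@[D c 0] = kap * (c 0 it_ * (c 0 iu_ * c 0 is_ ^+ a)).
  by rewrite (FE _ 1%N 2%N h12 (e12 z)) // w2 /pcol pvec_1 pvec_ge2 // mulr0 subr0.
have E03 : F03.@[D c 0] = kap * (c 0 is_ * (c 0 iv_ * c 0 it_ ^+ b)).
  by rewrite (FE _ 0%N 3%N h03 (e03 z)) // w3 /pcol pvec_0 pvec_ge2 // mulr0 subr0.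
exists kap; first by rewrite mulf_neq0 // invr_eq0.
split=> // t; apply/rowP => l; rewrite !mxE (meval_dhomog _ _ (scroll_inv_homog l)) -mulrA;
  congr (_ * _).
set sig := kap * (c 0 iu_ * c 0 is_ ^+ a); set be := kap * (c 0 is_ * c 0 it_ ^+ b) * _.
have := meval_section sig be c (@scroll_section K a e l); rewrite expr1 => <-.
rewrite /scroll_inv comp_mpoly_meval; apply: meval_eq => i.
rewrite (tnth_nth 0) mxE; case: i => -[|[|[|[|//]]]] hi /=.
- by rewrite E02 /sig; ring.
- by rewrite E12 /sig; ring.
- have S02 : F02.@[D c 0] = sig * c 0 is_ by rewrite E02 /sig; ring.
  have S12 : F12.@[D c 0] = sig * c 0 it_ by rewrite E12 /sig; ring.
  have sb : sig ^+ b = sig ^+ a * sig ^+ e by rewrite -exprD.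
  rewrite mevalM rmorphXn /= /be S02 S12 (exprMn b sig) (exprMn a sig) sb {1}/sig; ring.
by rewrite mevalM rmorphXn /= /be E03 E02; ring.
Qed.

Local Notation Y := (plucker @` Sg).

Lemma inverse_point (x : Gr K 1 n3) (y : Gr K 1 N) c : Xe_coord c ->
  val x = <[Phi c]>%VS -> val y = <[D c]>%VS ->
  c 0 is_ != 0 -> c 0 it_ != 0 -> c 0 iu_ != 0 ->
    maps_to scroll_proj x y /\ maps_to scroll_inv y x.
Proof.
move=> hc xE yE s0 t0 u0; split; first exact/(maps_scroll_proj y hc xE).
have [kap k0 [E02 _ gE]] := inverse_torus hc.
exists (D c) => //; rewrite -[D c]scale1r gE lineZ // E02.
by rewrite expr1n mul1r; do ?[apply: mulf_neq0 | apply: expf_neq0].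
Qed.

Definition unit_coord : 'rV[K]_(2 + 2) := mkc 1 1 1 1.

Lemma unit_coordP : [/\ Xe_coord unit_coord, unit_coord 0 is_ = 1,
  unit_coord 0 it_ = 1 & unit_coord 0 iu_ = 1].
Proof.
have [c1 c2 c3 c4] := mkcE (1 : K) 1 1 1.
by split=> //; rewrite Xe_coordE c1 c2 c3 c4 oner_eq0.
Qed.

Lemma hform_meval n d (F : {mpoly K[n]}) : F \is d.-homog ->
  hform rep d (fun y : Gr K 1 n => F.@[rep y 0]).
Proof. by move=> hF; exists F. Qed.

(** The open set is s t u != 0, on which the inverse is defined. *)
Lemma general_Y (P : Gr K 1 N -> Prop) :
  (forall y c, Xe_coord c -> val y = <[D c]>%VS ->
    c 0 is_ != 0 -> c 0 it_ != 0 -> c 0 iu_ != 0 -> P y) ->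
  generally zariski_closed Y P.
Proof.
move=> hP; exists [set y | F02.@[rep y 0] * F12.@[rep y 0] = 0]; split.
- by apply/zariski_closed_form/hform_closed_zero; apply: hformM; apply: hform_meval;
  [exact: h02|exact: h12].
- have [hc c1 c2 c3] := unit_coordP => sub.
  have [kap k0 [E02 E12 _]] := inverse_torus hc.
  have := sub (pt (D_neq0 hc)); rewrite /=; have [lam l0 ->] := rep_pt (D_neq0 hc).
  rewrite (meval_dhomog _ _ h02) (meval_dhomog _ _ h12) E02 E12 c1 c2 c3 !expr1n !mulr1 => h.
  have : lam * kap * (lam * kap) = 0 by apply: h; apply/image_Sigma; exists unit_coord.
  by move/eqP; rewrite !mulf_eq0 (negPf l0) (negPf k0).
move=> y /image_Sigma[c hc yE] /= /eqP; rewrite mulf_eq0 negb_or => /andP[].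
have [lam l0 ->] := val_rep yE; rewrite (meval_dhomog _ _ h02) (meval_dhomog _ _ h12).
have [kap k0 [-> -> _]] := inverse_torus hc.
rewrite !mulf_eq0 !negb_or => /and4P[_ _ s0 /andP[u0 _]] /and4P[_ _ t0 _].
exact: hP hc yE s0 t0 u0.
Qed.

Lemma general_X (P : Gr K 1 n3 -> Prop) :
  (forall x c, Xe_coord c -> val x = <[Phi c]>%VS ->
    c 0 is_ != 0 -> c 0 it_ != 0 -> c 0 iu_ != 0 -> P x) ->
  generally zariski_closed (Xe_image scroll) P.
Proof.
have la : (a.+1 < n3)%N by rewrite !ltnS; apply: leq_trans (leq_addr _ _) (leqW _).
pose l0 : 'I_n3 := ord0; pose l1 : 'I_n3 := Ordinal la.
have Pl0 k c : (k *: Phi c) 0 l0 = k * (c 0 iu_ * c 0 it_ ^+ a.+1).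
  by rewrite 2!mxE meval_scroll /= expr0 mulr1 subn0.
have Pl1 k c : (k *: Phi c) 0 l1 = k * (c 0 iu_ * c 0 is_ ^+ a.+1).
  by rewrite 2!mxE meval_scroll /= ltnSn subnn expr0 mulr1.
move=> hP; exists [set x | rep x 0 l0 * rep x 0 l1 = 0]; split.
- by apply/zariski_closed_form/hform_closed_zero; apply: hformM; apply: hform_coord.
- have [hc c1 c2 c3] := unit_coordP => sub.
  have := sub (pt (Phi_neq0 hc)); rewrite /=; have [lam lam0 ->] := rep_pt (Phi_neq0 hc).
  rewrite Pl0 Pl1 c1 c2 c3 !expr1n !mulr1 => h.
  have : lam * lam = 0 by apply: h; exists unit_coord.
  by move/eqP; rewrite !mulf_eq0 (negPf lam0).
move=> x [c hc xE] /= /eqP; rewrite mulf_eq0 negb_or => /andP[].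
have [lam lam0 ->] := val_rep xE; rewrite Pl0 Pl1 !mulf_eq0 !negb_or.
move=> /and3P[_ u0 ht] /and3P[_ _ hs]; apply: hP hc xE _ _ u0.
  by apply: contraNneq hs => ->; rewrite expr0n.
by apply: contraNneq ht => ->; rewrite expr0n.
Qed.

Lemma scroll_birational : birational (Xe_image scroll) Y scroll_proj.
Proof.
have [hc c1 c2 c3] := unit_coordP.
have nz : [/\ unit_coord 0 is_ != 0,
  unit_coord 0 it_ != 0 & unit_coord 0 iu_ != 0] by rewrite c1 c2 c3 oner_eq0.
have [s0 t0 u0] := nz.
have [mp mg] := inverse_point (x := pt (Phi_neq0 hc)) (y :=
  pt (D_neq0 hc)) hc erefl erefl s0 t0 u0.
split.
  split; first by exists 1%N => i; apply: scroll_proj_homog.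
    by exists (pt (Phi_neq0 hc)); [exists unit_coord | exists (pt (D_neq0 hc))].
  move=> x y [c hc' xE] /(maps_scroll_proj y hc' xE) yE; apply/image_Sigma; by exists c.
exists scroll_inv; split.
- split; first by exists (a + b).+2 => i; apply: scroll_inv_homog.
    exists (pt (D_neq0 hc)); last by exists (pt (Phi_neq0 hc)).
    by apply/image_Sigma; exists unit_coord.
  move=> y x /image_Sigma[c hc' yE] [v yv xE].
  have [lam l0 vE] : exists2 lam, lam != 0 & v = lam *: D c.
    by apply: (line_eq (D_neq0 hc')); rewrite -yE.
  have [kap k0 [_ _ gE]] := inverse_torus hc'.
  exists c => //; move: xE (valP x); rewrite vE gE; set k := (X in X *: Phi c).
  move=> xE; rewrite xE dim_vline; have [->|k_neq0 _] := eqVneq k 0;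
    first by rewrite scale0r eqxx.
  by rewrite lineZ.
- apply: (general_X (P := fun x => exists2 y,
  maps_to scroll_proj x y & maps_to scroll_inv y x)) => x c hc' xE s1 t1 u1.
  have [h1 h2] := inverse_point (x := x) (y := pt (D_neq0 hc')) hc' xE erefl s1 t1 u1.
  by exists (pt (D_neq0 hc')).
apply: (general_Y (P := fun y => exists2 x,
  maps_to scroll_inv y x & maps_to scroll_proj x y)) => y c hc' yE s1 t1 u1.
have [h1 h2] := inverse_point (x := pt (Phi_neq0 hc')) (y := y) hc' erefl yE s1 t1 u1.
by exists (pt (Phi_neq0 hc')).
Qed.

Lemma D_linear s t u v : D (mkc s t u v) = u *: D (mkc s t 1 0) + v *: D (mkc s t 0 1).
Proof. by apply/rowP => i; rewrite !mxE (@section_linear K e _ (Dp i) s t u v (@hD i)). Qed.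

Lemma mkc_coord (s t u v : K) : (s != 0) || (t != 0) -> (u != 0) || (v != 0) ->
  Xe_coord (mkc s t u v).
Proof.
by move=> st uv; rewrite Xe_coordE; have [-> -> -> ->] := mkcE s t u v; rewrite st.
Qed.

Lemma rule_subproof (s t : K) : (s != 0) || (t != 0) ->
  \dim <<[:: D (mkc s t 1 0); D (mkc s t 0 1)]>> == 2.
Proof.
move=> st; have n1 : (1 : K) != 0 by rewrite oner_eq0.
have B0 : D (mkc s t 0 1) != 0 by apply/D_neq0/mkc_coord; rewrite ?n1 ?orbT.
apply/eqP; suff : free [:: D (mkc s t 1 0); D (mkc s t 0 1)] by move/eqP.
rewrite free_cons seq1_free B0 andbT span_seq1; apply/negP => /vlineP[k kE].
have : D (mkc s t 1 (- k)) != 0 by apply/D_neq0/mkc_coord; rewrite ?n1.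
by rewrite D_linear kE scale1r scaleNr subrr eqxx.
Qed.

Definition rule (s t : K) (st : (s != 0) || (t != 0)) : Gr K 2 N :=
  exist (fun U : {vspace 'rV[K]_N} => \dim U == 2) _ (rule_subproof st).

Definition rules : set (Gr K 2 N) :=
  [set l | exists s t (st : (s != 0) || (t != 0)), l = rule st].

Lemma mem_rule s t w : w \in <<[:: D (mkc s t 1 0); D (mkc s t 0 1)]>>%VS <->
  exists u v, w = D (mkc s t u v).
Proof.
rewrite span_cons span_seq1; split=> [/memv_addP[_ /vlineP[u ->] [_ /vlineP[v ->] ->]]|[u
  [v ->]]].
  by exists u, v; rewrite -D_linear.
by rewrite D_linear; apply: memv_add; apply: memvZ; apply: memv_line.
Qed.

Lemma incident_rule s t (st : (s != 0) || (t != 0)) (y : Gr K 1 N) :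
  incident y (rule st) <-> exists u v, (u != 0) || (v != 0) /\ val y = <[D (mkc s t u v)]>%VS.
Proof.
rewrite /incident [val y]rep_line -memvE /=; split=> [/mem_rule[u [v yE]]|[u [v [uv yE]]]].
  exists u, v; rewrite -yE; split=> //; apply/negPn/negP;
    rewrite negb_or !negbK => /andP[/eqP u0 /eqP v0].
  by have := rep_neq0 y; rewrite yE D_linear u0 v0 !scale0r addr0 eqxx.
rewrite memvE yE -memvE; apply/mem_rule; by exists u, v.
Qed.

Lemma D_scale k s t u v : k != 0 ->
  D (mkc (k * s) (k * t) u v) = k ^+ b.+1 *: D (mkc s t (u / k ^+ e) v).
Proof.
move=> k0; have := eval_forms_torus k 1 (mkc s t (u / k ^+ e) v) hD.
rewrite expr1n mulr1 => <-; congr (eval_forms _ _).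
have [c1 c2 c3 c4] := mkcE s t (u / k ^+ e) v.
apply: eq_coord; rewrite /torus c1 c2 c3 c4 [in LHS]mxE [in RHS]mxE //=.
  by rewrite mulr1 mulrC divfK // expf_neq0.
by rewrite mul1r.
Qed.

Lemma rule_scale k s t (st : (s != 0) || (t != 0)) (st' : (k * s != 0) || (k * t != 0)) :
  k != 0 -> rule st' = rule st.
Proof.
move=> k0; apply/val_inj/eqP; rewrite eqEdim (eqP (rule_subproof st)) (eqP (rule_subproof
  st')) leqnn andbT.
apply/subvP => w /= /mem_rule[u [v ->]].
by rewrite D_scale // memvZ //; apply/mem_rule; exists (u / k ^+ e), v.
Qed.

Lemma rule_unique s t s' t' (st : (s != 0) || (t != 0)) (st' : (s' != 0) || (t' != 0)) k :
  k != 0 -> s' = k * s -> t' = k * t -> rule st' = rule st.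
Proof. by move=> k0 e1 e2; move: st'; rewrite e1 e2 => st'; apply: rule_scale. Qed.

(** Uniqueness at a general point: (s : t) is the ratio of the dual Plücker
    coordinates 02 and 12. *)
Lemma scroll_ruling : ruling Y rules.
Proof.
split.
- move=> l [s [t [st ->]]] y /incident_rule[u [v [uv yE]]]; apply/image_Sigma.
  by exists (mkc s t u v) => //; apply: mkc_coord.
- move=> y /image_Sigma[c hc yE]; have := hc; rewrite Xe_coordE => /andP[st uv].
  exists (rule st); first by exists (c 0 is_), (c 0 it_), st.
  apply/incident_rule; exists (c 0 iu_), (c 0 iv_); split=> //.
  by rewrite yE; congr <[D _]>%VS; apply: eq_coord; rewrite mxE.
apply: (general_Y (P := fun y => exists! l,
  rules l /\ incident y l)) => y c hc yE s0 t0 u0; have := hc;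
  rewrite Xe_coordE => /andP[st uv].
exists (rule st); split.
  split; first by exists (c 0 is_), (c 0 it_), st.
  apply/incident_rule; exists (c 0 iu_), (c 0 iv_); split=> //.
  by rewrite yE; congr <[D _]>%VS; apply: eq_coord; rewrite mxE.
move=> _ [[s' [t' [st' ->]]] /incident_rule[u' [v' [uv' yE']]]]; apply/esym.
have hc' := mkc_coord st' uv'.
have [lam l0 DE'] : exists2 lam, lam != 0 & D (mkc s' t' u' v') = lam *: D c.
  by apply: (line_eq (D_neq0 hc)); rewrite -yE.
have [kap k0 [E02 E12 _]] := inverse_torus hc;
  have [kap' k0' [E02' E12' _]] := inverse_torus hc'.
have [c1 c2 c3 c4] := mkcE s' t' u' v'.
rewrite DE' (meval_dhomog _ _ h02) E02 c1 c3 in E02'.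
rewrite DE' (meval_dhomog _ _ h12) E12 c1 c2 c3 in E12'.
pose x := kap' * (u' * s' ^+ a); pose z := lam * kap * (c 0 iu_ * c 0 is_ ^+ a).
have z0 : z != 0 by rewrite /z !mulf_neq0 ?expf_neq0.
have xs : x * s' = z * c 0 is_.
  by transitivity (kap' * (s' * (u' * s' ^+ a))); [rewrite /x | rewrite -E02' /z]; ring.
have xt : x * t' = z * c 0 it_.
  by transitivity (kap' * (t' * (u' * s' ^+ a))); [rewrite /x | rewrite -E12' /z]; ring.
have x0 : x != 0.
  by apply/eqP => x0; move: xs; rewrite x0 mul0r => /esym/eqP;
    rewrite mulf_eq0 (negPf z0) (negPf s0).
apply: (@rule_unique _ _ _ _ _ _ (z / x)); first by rewrite mulf_neq0 ?invr_eq0.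
  by rewrite mulrAC -xs mulrAC mulfV // mul1r.
by rewrite mulrAC -xt mulrAC mulfV // mul1r.
Qed.

Lemma scroll_fibre (q : Gr K 1 2) : exists2 l, rules l &
  [set y | exists2 x, fibre_image scroll q x &
    maps_to scroll_proj x y] = [set y | incident y l].
Proof.
pose w := rep q; have w0 := rep_neq0 q.
have st : (w 0 ord0 != 0) || (w 0 ord_max != 0).
  have /rV0Pn[j] := w0; have [->->//|j0] := eqVneq j ord0.
  suff -> : j = ord_max by move=> ->; rewrite orbT.
  by apply/val_inj; case: j j0 => -[|[|]].
exists (rule st); first by exists (w 0 ord0), (w 0 ord_max), st.
apply/seteqP; split=> y /=.
  move=> [x [c [hc cq] xE] /(maps_scroll_proj y hc xE) yE]; apply/incident_rule.
  move: cq; rewrite rep_line => /vlineP[k cE].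
  have cs : c 0 is_ = k * w 0 ord0 by have := congr1 (fun v : 'rV_2 => v 0 ord0) cE;
    rewrite !mxE.
  have ct : c 0 it_ = k * w 0 ord_max by have := congr1 (fun v : 'rV_2 => v 0 ord_max) cE;
    rewrite !mxE.
  have := hc; rewrite Xe_coordE => /andP[cst cuv].
  have k0 : k != 0 by apply: contraTneq cst => k0; rewrite cs ct k0 !mul0r eqxx.
  exists (c 0 iu_ / k ^+ e), (c 0 iv_); split.
    by rewrite mulf_eq0 invr_eq0 expf_eq0 (negPf k0) andbF orbF.
  rewrite yE (_ : c = mkc (k * w 0 ord0) (k * w 0 ord_max) (c 0 iu_) (c 0 iv_)).
    by rewrite D_scale // lineZ ?expf_neq0 //; congr <[D _]>%VS; apply: eq_coord; rewrite !mxE.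
  by apply: eq_coord; rewrite mxE.
move=> /incident_rule[u [v [uv yE]]]; have hc := mkc_coord st uv.
exists (pt (Phi_neq0 hc)); last first.
  by have [_] := maps_scroll_proj (x := pt (Phi_neq0 hc)) y hc erefl; apply.
exists (mkc (w 0 ord0) (w 0 ord_max) u v) => //; split=> //.
rewrite rep_line; suff -> : lsubmx (mkc (w 0 ord0) (w 0 ord_max) u v) = w by apply: memv_line.
apply/rowP => j; rewrite !mxE; case: j => -[|[|//]] hj /=; congr (w 0 _); exact/val_inj.
Qed.

End Invariant.

Lemma Sigma_invariant (K : numClosedFieldType) (a e r : nat) : (0 < r)%N ->
  has_invariant (@Sigma K a e r) (a + (a + e)).+1 e.
Proof.
move=> r0; have [Dp [hD DE]] := plucker_param K a e r0.
have [sc_sec sc_full] := scroll_complete K a e.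
have ex_al i : exists al : 'I_(a + (a + e)).+4 -> K, Dp i = \sum_l al l *: scroll K l.
  by have [al [h _]] := sc_full _ (hD i); exists al.
have [al alE] := choice ex_al.
have [F02 h02 e02] := hform_dplk K r 0 2; have [F12 h12 e12] := hform_dplk K r 1 2.
have [F03 h03 e03] := hform_dplk K r 0 3.
have half : (((a + (a + e)).+1 + e + 1) %/ 2 = (a + e).+1)%N.
  have -> : ((a + (a + e)).+1 + e + 1 = (a + e).+1 * 2)%N by lia.
  by rewrite mulnK.
exists (@scroll K a e), (scroll_proj al), (rules r0 hD DE); split; first by rewrite half;
  exact: scroll_complete.
split.
- exact: scroll_proj_homog.
- move=> x [c hc xE]; exists (pt (D_neq0 r0 DE hc)).
  by have [_] := maps_scroll_proj r0 DE alE (pt (D_neq0 r0 DE hc)) hc xE; apply.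
- apply/seteqP; split=> y.
    move=> /(image_Sigma r0 DE)[c hc yE]; exists (pt (Phi_neq0 r0 DE alE hc));
      first by exists c.
    by have [_] := maps_scroll_proj (x := pt (Phi_neq0 r0 DE alE hc)) r0 DE alE y hc erefl;
      apply.
  move=> [x [c hc xE] /(maps_scroll_proj r0 DE alE y hc xE) yE]; apply/(image_Sigma r0 DE);
    by exists c.
- exact: (scroll_birational r0 DE alE h02 h12 h03 e02 e12 e03).
by split; [exact: (scroll_ruling r0 hD DE h02 h12 h03 e02 e12 e03) | exact: scroll_fibre].
Qed.

(** * The theorem *)
Theorem proposition4p7 (R : realType) (n r e : nat)
    (hn : (1 <= n)%N) (hr : (1 <= r <= n)%N)
    (he : (0 <= e <= n - 1)%N) (hpar : (n - e = 1 %[mod 2])%N) :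
  exists Sigma : set (Gr R[i] r.+1 r.+3),
    congruence Sigma /\
    [/\ ~ (exists x, fixed_point Sigma x),
        has_order Sigma 1,
        has_class Sigma n,
        reducible_set zariski_closed (focal_locus Sigma)
      & has_invariant Sigma n e].
Proof.
have r0 : (0 < r)%N by case/andP: hr.
pose a := ((n - 1 - e) %/ 2)%N.
have nE : n = (a + (a + e)).+1.
  have /dvdnP[k kE] : (2 %| n - 1 - e)%N by rewrite /dvdn; move: hpar he hn; clear; lia.
  by rewrite /a kE mulnK //; move: kE he hn; clear; lia.
have rn : (r <= (a + (a + e)).+1)%N by rewrite -nE; case/andP: hr.
exists (@Sigma R[i] a e r); rewrite {1 2}nE; split; first exact: Sigma_congruence.
split.
- exact: no_fixed_point.
- exact: Sigma_order.
- exact: Sigma_class.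
- exact: focal_reducible.
exact: Sigma_invariant.
Qed.
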